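(* Given an edge-weighted $n$-vertex tree $T$, there is an $O(\log\log n)$-hop emulator $K_T$ for $T$ that has treewidth $O(\log\log n)$. Furthermore, $K_T$ can be constructed in $O(n\log\log n)$ time.
   Context: For an edge-weighted graph $G$, vertices $u,v$ and $h\in\mathbb{N}$, $d^{(h)}_G(u,v)$ is the minimum weight of a $u$–$v$ path in $G$ with at most $h$ edges ($\infty$ if none exists). Given an edge-weighted tree $T=(V_T,E_T,w_T)$, an edge-weighted graph $K=(V_K,E_K,w_K)$ is an $h$-hop emulator for $T$ if $V_K=V_T$ and $d^{(h)}_K(u,v)=d_T(u,v)$ for every pair $u,v\in V_T$, where $d_T$ is the tree distance. *)

(* Defs.v *)
From HB Require Import structures.
From mathcomp Require Import all_boot all_order all_algebra.
From mathcomp Require Import boolp classical_sets reals constructive_ereal.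
From mathcomp Require Import ereal exp.

Set Implicit Arguments.
Unset Strict Implicit.
Unset Printing Implicit Defensive.

Import Order.TTheory GRing.Theory Num.Theory.
Local Open Scope ring_scope.

Definition log2 (R : realType) (x : R) : R := ln x / ln 2.

(* [ucycleb e c] with [2 < size c] says that [c] lists the vertices of a
   simple cycle; sequences of size 2 would only be an edge traversed back and
   forth. *)
Definition is_tree (V : finType) (e : rel V) : Prop :=
  [/\ symmetric e, irreflexive e, (0 < #|V|)%N,
      forall u v, connect e u v
    & forall c : seq V, (2 < size c)%N -> ~~ ucycleb e c].

Record tree_decomposition (V : finType) (e : rel V)
    (B : finType) (f : rel B) (bag : B -> {set V}) : Prop := TreeDecomposition {
  td_tree : is_tree f;
  td_vertex : forall v, exists b, v \in bag b;
  td_edge : forall u v, e u v -> exists b, (u \in bag b) && (v \in bag b);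
  td_connected : forall v a b, v \in bag a -> v \in bag b ->
    connect [rel x y | [&& f x y, v \in bag x & v \in bag y]] a b
}.

Definition has_tree_decomposition (V : finType) (e : rel V) (k : nat) : Prop :=
  exists (B : finType) (f : rel B) (bag : B -> {set V}),
    tree_decomposition e f bag /\ k = (\max_(b : B) #|bag b|).-1.

Lemma has_tree_decomposition_trivial (V : finType) (e : rel V) :
  has_tree_decomposition e #|V|.-1.
Proof.
exists unit, (fun _ _ => false), (fun _ => [set: V]); split; last first.
  by rewrite (big_pred1 tt) ?cardsT // => -[].
split.
- split=> //; first by rewrite card_unit.
    by move=> [] []; exact: connect0.
  by move=> [|[] [|[] c]] //=; rewrite /ucycleb /= andbF.
- by move=> v; exists tt; rewrite inE.
- by move=> u v _; exists tt; rewrite !inE.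
- by move=> v [] [] _ _; exact: connect0.
Qed.

Lemma treewidth_subproof (V : finType) (e : rel V) :
  exists k, `[< has_tree_decomposition e k >].
Proof.
by exists #|V|.-1; apply/asboolP; exact: has_tree_decomposition_trivial.
Qed.

Definition treewidth (V : finType) (e : rel V) : nat :=
  ex_minn (treewidth_subproof e).

Record wgraph (R : realType) (V : finType) := WGraph {
  adj : rel V;
  wt : V -> V -> R;
  adj_sym : symmetric adj;
  adj_irr : irreflexive adj;
  wt_sym : forall u v, adj u v -> wt u v = wt v u;
  wt_ge0 : forall u v, adj u v -> 0 <= wt u v
}.

Section Distances.
Variables (R : realType) (V : finType).
Implicit Types (G T K : wgraph R V) (u v : V) (p : seq V).

(* [u :: p] is a simple path of [G] from [u] to [v]; it has [size p] edges. *)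
Definition is_path G u v p : Prop :=
  [/\ path (adj G) u p, last u p = v & uniq (u :: p)].

Fixpoint path_weight G u p : R :=
  if p is x :: q then wt G u x + path_weight G x q else 0.

(* There are finitely many simple paths, so the infima below are minima when
   the sets are nonempty, and [+oo] when they are empty. *)
Definition dist G u v : \bar R :=
  ereal_inf [set (path_weight G u p)%:E | p in [set p | is_path G u v p]]%classic.

Definition hop_dist (h : nat) G u v : \bar R :=
  ereal_inf [set (path_weight G u p)%:E
            | p in [set p | is_path G u v p /\ (size p <= h)%N]]%classic.

Definition hop_emulator (h : nat) T K : Prop :=
  forall u v, hop_dist h K u v = dist T u v.

End Distances.

Definition loglog_emulator (R : realType) (n C : nat)
    (T K : wgraph R 'I_n) : Prop :=
  exists h : nat,
    [/\ hop_emulator h T K,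
        h%:R <= C%:R * log2 (log2 n%:R) :> R
      & (treewidth (adj K))%:R <= C%:R * log2 (log2 n%:R) :> R].

(* Programs are written for a unit-cost random access machine, in a
   while-language whose memory consists of arrays of
   integer words and of arrays of reals, both addressed by integer words. Every
   evaluated operator and every executed command costs one unit of time.
   Integer arithmetic is that of machine words: results are reduced modulo the
   number [W] of word values (subtraction is truncated at 0). Reals are atomic:
   they can only be copied, added, subtracted and compared. *)

Inductive iexp :=
  | IConst of nat
  | ICell of nat & iexp
  | IAdd of iexp & iexp
  | ISub of iexp & iexp
  | IMul of iexp & iexp
  | IDiv of iexp & iexp.

Inductive rexp :=
  | RZero
  | RCell of nat & iexp
  | RAdd of rexp & rexp
  | RSub of rexp & rexp.

Inductive bexp :=
  | ILt of iexp & iexp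
  | IEq of iexp & iexp
  | RLt of rexp & rexp.

Inductive cmd :=
  | Skip
  | IStore of nat & iexp & iexp
  | RStore of nat & iexp & rexp
  | Seq of cmd & cmd
  | If of bexp & cmd & cmd
  | While of bexp & cmd.

Record state (R : realType) := State {
  icell : nat -> nat -> nat;
  rcell : nat -> nat -> R
}.

Definition upd (A : Type) (m : nat -> nat -> A) (a i : nat) (x : A) :=
  fun b j => if (b == a) && (j == i) then x else m b j.

Fixpoint icost (e : iexp) : nat :=
  match e with
  | IConst _ => 1
  | ICell _ e1 => (icost e1).+1
  | IAdd e1 e2 | ISub e1 e2 | IMul e1 e2 | IDiv e1 e2 =>
      (icost e1 + icost e2).+1
  end.

Fixpoint rcost (e : rexp) : nat :=
  match e with
  | RZero => 1
  | RCell _ e1 => (icost e1).+1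
  | RAdd e1 e2 | RSub e1 e2 => (rcost e1 + rcost e2).+1
  end.

Definition bcost (b : bexp) : nat :=
  match b with
  | ILt e1 e2 | IEq e1 e2 => (icost e1 + icost e2).+1
  | RLt e1 e2 => (rcost e1 + rcost e2).+1
  end.

Section Semantics.
Variables (R : realType) (W : nat).
Implicit Type s : state R.

Fixpoint ieval s (e : iexp) : nat :=
  match e with
  | IConst k => (k %% W)%N
  | ICell a e1 => icell s a (ieval s e1)
  | IAdd e1 e2 => ((ieval s e1 + ieval s e2) %% W)%N
  | ISub e1 e2 => ((ieval s e1 - ieval s e2) %% W)%N
  | IMul e1 e2 => ((ieval s e1 * ieval s e2) %% W)%N
  | IDiv e1 e2 => ((ieval s e1 %/ ieval s e2) %% W)%N
  end.

Fixpoint reval s (e : rexp) : R :=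
  match e with
  | RZero => 0
  | RCell a e1 => rcell s a (ieval s e1)
  | RAdd e1 e2 => reval s e1 + reval s e2
  | RSub e1 e2 => reval s e1 - reval s e2
  end.

Definition beval s (b : bexp) : bool :=
  match b with
  | ILt e1 e2 => (ieval s e1 < ieval s e2)%N
  | IEq e1 e2 => ieval s e1 == ieval s e2
  | RLt e1 e2 => reval s e1 < reval s e2
  end.

(* [exec c s t s']: started in [s], [c] terminates in [s'] after [t] steps. *)
Inductive exec : cmd -> state R -> nat -> state R -> Prop :=
  | ExecSkip s : exec Skip s 1 s
  | ExecIStore s a i e :
      exec (IStore a i e) s (icost i + icost e).+1
        (State (upd (icell s) a (ieval s i) (ieval s e)) (rcell s))
  | ExecRStore s a i e :
      exec (RStore a i e) s (icost i + rcost e).+1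
        (State (icell s) (upd (rcell s) a (ieval s i) (reval s e)))
  | ExecSeq s1 s2 s3 c1 c2 t1 t2 :
      exec c1 s1 t1 s2 -> exec c2 s2 t2 s3 ->
      exec (Seq c1 c2) s1 (t1 + t2).+1 s3
  | ExecIf s s' b c1 c2 t :
      exec (if beval s b then c1 else c2) s t s' ->
      exec (If b c1 c2) s (bcost b + t).+1 s'
  | ExecWhileF s b c :
      ~~ beval s b -> exec (While b c) s (bcost b).+1 s
  | ExecWhileT s1 s2 s3 b c t1 t2 :
      beval s1 b -> exec c s1 t1 s2 -> exec (While b c) s2 t2 s3 ->
      exec (While b c) s1 (bcost b + t1 + t2).+1 s3.

End Semantics.

(* Words of [c * (floor (log2 n) + 1)] bits. *)
Definition word_values (c n : nat) : nat := (2 ^ (c * (trunc_log 2 n).+1))%N.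

(* [L] lists every edge of [G] exactly once, in one of its two orientations,
   together with its weight. *)
Definition edge_list (R : realType) (n : nat) (G : wgraph R 'I_n)
    (L : seq ('I_n * 'I_n * R)) : Prop :=
  (forall u v w, (u, v, w) \in L -> adj G u v /\ w = wt G u v) /\
  (forall u v, adj G u v ->
     count (fun e => (e.1 == (u, v)) || (e.1 == (v, u))) L = 1%N).

(* Integer array 0 starts with the number of vertices and the number of edges;
   the edges are in integer arrays 1 and 2 and real array 0. The rest of the
   memory is unconstrained, so a program with such an input can assume nothing
   about it. *)
Definition stores (R : realType) (n : nat) (s : state R)
    (L : seq ('I_n * 'I_n * R)) : Prop :=
  [/\ icell s 0 0 = n, icell s 0 1 = size L
    & forall k u v w, onth L k = Some (u, v, w) ->
        [/\ icell s 1 k = u, icell s 2 k = v & rcell s 0 k = w]].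

(* Main.v *)
(* Root the tree and repeat the following for about [log log n] rounds. All
   trees of the current forest have fewer than [s * (s + 1) / 2] vertices; select,
   bottom-up, every vertex below which [s] vertices hang without a selected one
   in between, and every branching vertex of the selected ones. The unselected
   components have fewer than [s] vertices, and so has each tree of selected
   vertices (the branching vertices are fewer than the others). Each component
   touches at most two selected vertices, one above ([top]) and one below
   ([bel]); the emulator joins every unselected vertex to the one above, and also
   to the one below if that is a descendant. The next forest consists of the
   components and of the trees contracted to the selected vertices, so that it
   lives on the same vertex set and every round takes linear time.
   An ancestor-descendant pair is joined by two edges per round, hence any two
   vertices are, through their nearest common ancestor, by four. Eliminating the
   vertices in the lexicographic order of their selection bits, where [v] is
   adjacent to the at most two neighbours of its component in each round, is a
   perfect elimination, which bounds the treewidth by two per round. *)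

Require Import Defs.
From mathcomp Require Import all_boot all_order all_algebra.
From mathcomp Require Import boolp reals constructive_ereal ereal exp.
From mathcomp Require Import zify ring lra.

Set Implicit Arguments.
Unset Strict Implicit.
Unset Printing Implicit Defensive.

(** * Running programs *)

(** The numbers [s * (s + 1) / 2] come from a charging argument: a tree of [m] selected vertices in
    the next forest uses up at least [s * (m + 1) / 2] vertices of the old tree, whence [m < s].
    Read backwards, the thresholds start at 2, that is at single vertices, and are roughly squared
    each time; this gives [log log n] rounds. The treewidth rests on one invariant: at every earlier
    round, a tree of a later forest is either selected as a whole or lies inside a single component.
    So a vertex and its neighbours from a later round have the same neighbours from an earlier
    round. Distances need no reasoning about shortest paths. Both the tree and the emulator only
    have edges between ancestors and descendants, as long as the difference of the depths, and any
    walk in one of them yields a walk in the other that is no heavier. The program works without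
    recursion: peeling leaves numbers the vertices so that children precede their parents, and every
    pass is then a single loop. *)

Section Logic.
Variables (R : realType) (W : nat).
Implicit Types (s : state R) (c : cmd) (Q : state R -> Prop).

Definition runs c s T Q :=
  exists t s', [/\ exec W c s t s', t <= T & Q s'].

Lemma runs_weaken c s T1 T2 Q1 Q2 :
  T1 <= T2 -> (forall s', Q1 s' -> Q2 s') -> runs c s T1 Q1 -> runs c s T2 Q2.
Proof.
move=> leT impQ [t [s' [ex let1 q]]]; exists t, s'; split=> //; last exact: impQ.
exact: leq_trans leT.
Qed.

Lemma runs_seq c1 c2 s T1 T2 Q :
  runs c1 s T1 (fun s' => runs c2 s' T2 Q) -> runs (Seq c1 c2) s (T1 + T2).+1 Q.
Proof.
move=> [t1 [s1 [ex1 le1 [t2 [s2 [ex2 le2 q]]]]]].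
exists (t1 + t2).+1, s2; split=> //; first exact: ExecSeq ex1 ex2.
by rewrite ltnS leq_add.
Qed.

(* Evaluation without the reductions modulo [W]; [iok] says that it agrees with
   [ieval] because no intermediate value overflows. *)
Fixpoint ival s (e : iexp) : nat :=
  match e with
  | IConst k => k
  | ICell a e1 => icell s a (ival s e1)
  | IAdd e1 e2 => ival s e1 + ival s e2
  | ISub e1 e2 => ival s e1 - ival s e2
  | IMul e1 e2 => ival s e1 * ival s e2
  | IDiv e1 e2 => ival s e1 %/ ival s e2
  end.

Fixpoint iok s (e : iexp) : Prop :=
  match e with
  | IConst k => k < W
  | ICell a e1 => iok s e1
  | IAdd e1 e2 => [/\ iok s e1, iok s e2 & ival s e1 + ival s e2 < W]
  | ISub e1 e2 => [/\ iok s e1, iok s e2 & ival s e1 < W]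
  | IMul e1 e2 => [/\ iok s e1, iok s e2 & ival s e1 * ival s e2 < W]
  | IDiv e1 e2 => [/\ iok s e1, iok s e2 & ival s e1 < W]
  end.

Lemma iokE s e : iok s e -> ieval W s e = ival s e.
Proof.
elim: e => [k|a e IH|e1 IH1 e2 IH2|e1 IH1 e2 IH2|e1 IH1 e2 IH2|e1 IH1 e2 IH2] /=.
- exact: modn_small.
- by move=> /IH->.
- by move=> [/IH1-> /IH2->]; exact: modn_small.
- by move=> [/IH1-> /IH2-> lt]; rewrite modn_small ?(leq_ltn_trans (leq_subr _ _)).
- by move=> [/IH1-> /IH2->]; exact: modn_small.
- by move=> [/IH1-> /IH2-> lt]; rewrite modn_small ?(leq_ltn_trans (leq_div _ _)).
Qed.

Fixpoint rval s (e : rexp) : R :=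
  match e with
  | RZero => 0
  | RCell a e1 => rcell s a (ival s e1)
  | RAdd e1 e2 => rval s e1 + rval s e2
  | RSub e1 e2 => rval s e1 - rval s e2
  end%R.

Fixpoint rok s (e : rexp) : Prop :=
  match e with
  | RZero => True
  | RCell a e1 => iok s e1
  | RAdd e1 e2 | RSub e1 e2 => rok s e1 /\ rok s e2
  end.

Lemma rokE s e : rok s e -> reval W s e = rval s e.
Proof.
elim: e => [|a e|e1 IH1 e2 IH2|e1 IH1 e2 IH2] //=; first by move/iokE->.
- by move=> [/IH1-> /IH2->].
- by move=> [/IH1-> /IH2->].
Qed.

Definition bval s (b : bexp) : bool :=
  match b with
  | ILt e1 e2 => ival s e1 < ival s e2
  | IEq e1 e2 => ival s e1 == ival s e2
  | RLt e1 e2 => (rval s e1 < rval s e2)%R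
  end.

Definition bok s (b : bexp) : Prop :=
  match b with
  | ILt e1 e2 | IEq e1 e2 => iok s e1 /\ iok s e2
  | RLt e1 e2 => rok s e1 /\ rok s e2
  end.

Lemma bokE s b : bok s b -> beval W s b = bval s b.
Proof.
by case: b => e1 e2 /= [ok1 ok2]; rewrite ?(iokE ok1) ?(iokE ok2) ?(rokE ok1) ?(rokE ok2).
Qed.

(** [While] gets no precondition: loops go through [runs_for]. This leaves straight-line code and
    conditionals, whose worst-case [cost] depends on the program text alone. *)
Fixpoint wp c s Q : Prop :=
  match c with
  | Skip => Q s
  | IStore a i e => [/\ iok s i, iok s e
     & Q (State (upd (icell s) a (ival s i) (ival s e)) (rcell s))]
  | RStore a i e => [/\ iok s i, rok s e
     & Q (State (icell s) (upd (rcell s) a (ival s i) (rval s e)))]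
  | Seq c1 c2 => wp c1 s (fun s' => wp c2 s' Q)
  | If b c1 c2 =>
     [/\ bok s b, bval s b -> wp c1 s Q & ~~ bval s b -> wp c2 s Q]
  | While _ _ => False
  end.

Fixpoint cost c : nat :=
  match c with
  | Skip => 1
  | IStore a i e => (icost i + icost e).+1
  | RStore a i e => (icost i + rcost e).+1
  | Seq c1 c2 => (cost c1 + cost c2).+1
  | If b c1 c2 => (bcost b + maxn (cost c1) (cost c2)).+1
  | While _ _ => 0
  end.

Lemma wp_runs c s Q : wp c s Q -> runs c s (cost c) Q.
Proof.
elim: c s Q => [|a i e|a i e|c1 IH1 c2 IH2|b c1 IH1 c2 IH2|b c IH] s Q //=.
- by exists 1, s; split=> //; exact: ExecSkip.
- move=> [oki oke q]; eexists _, _; split; first exact: ExecIStore.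
    by [].
  by rewrite !iokE.
- move=> [oki oke q]; eexists _, _; split; first exact: ExecRStore.
    by [].
  by rewrite iokE // rokE.
- move=> /IH1 r1; apply: runs_seq; apply: runs_weaken r1 => // s'; exact: IH2.
- move=> [/bokE bE w1 w2].
  case: (boolP (bval s b)) => vb.
    have [t [s' [ex le q]]] := IH1 _ _ (w1 vb).
    exists (bcost b + t).+1, s'; split=> //; first by apply: ExecIf; rewrite bE vb.
    by rewrite ltnS leq_add2l leq_max le.
  have [t [s' [ex le q]]] := IH2 _ _ (w2 vb).
  exists (bcost b + t).+1, s'; split=> //.
    by apply: ExecIf; rewrite bE (negbTE vb).
  by rewrite ltnS leq_add2l leq_max le orbT.
Qed.

Definition ieq s e v := iok s e /\ ival s e = v.

Definition req s e v := rok s e /\ rval s e = v.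

Lemma wp_seq c1 c2 s Q : wp c1 s (fun s' => wp c2 s' Q) -> wp (Seq c1 c2) s Q.
Proof. by []. Qed.

(** Index and value are parameters so that the next state mentions simplified values; the raw
    expressions would be evaluated in ever larger states. *)
Lemma wp_istore a i e s Q vi ve : ieq s i vi -> ieq s e ve ->
  Q (State (upd (icell s) a vi ve) (rcell s)) -> wp (IStore a i e) s Q.
Proof. by move=> [oki <-] [oke <-]. Qed.

Lemma wp_rstore a i e s Q vi ve : ieq s i vi -> req s e ve ->
  Q (State (icell s) (upd (rcell s) a vi ve)) -> wp (RStore a i e) s Q.
Proof. by move=> [oki <-] [oke <-]. Qed.

Lemma wp_ilt e1 e2 c1 c2 s Q v1 v2 : ieq s e1 v1 -> ieq s e2 v2 ->
  (if v1 < v2 then wp c1 s Q else wp c2 s Q) -> wp (If (ILt e1 e2) c1 c2) s Q.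
Proof. by move=> [ok1 /= ->] [ok2 ->]; case: ifP. Qed.

Lemma wp_ieq e1 e2 c1 c2 s Q v1 v2 : ieq s e1 v1 -> ieq s e2 v2 ->
  (if v1 == v2 then wp c1 s Q else wp c2 s Q) -> wp (If (IEq e1 e2) c1 c2) s Q.
Proof. by move=> [ok1 /= ->] [ok2 ->]; case: ifP. Qed.

Lemma wp_mono c s (Q1 Q2 : state R -> Prop) :
  (forall s', Q1 s' -> Q2 s') -> wp c s Q1 -> wp c s Q2.
Proof.
elim: c s Q1 Q2 => [|a i e|a i e|c1 IH1 c2 IH2|b c1 IH1 c2 IH2|b c IH] s Q1 Q2 imp //=.
- exact: imp.
- by move=> [? ? /imp].
- by move=> [? ? /imp].
- by apply: IH1 => s'; exact: IH2.
- by move=> [? w1 w2]; split=> // h; [apply: IH1 (w1 h)|apply: IH2 (w2 h)].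
Qed.

Definition ivar x := ICell x (IConst 0).

Definition iset x e := IStore x (IConst 0) e.

Definition For x hi c :=
  Seq (iset x (IConst 0))
      (While (ILt (ivar x) hi) (Seq c (iset x (IAdd (ivar x) (IConst 1))))).

Definition set_ivar s x k := State (upd (icell s) x 0 k) (rcell s).

Definition for_time (h N T : nat) := N * (T + h + 20) + h + 20.

(* The invariant must not depend on the loop counter stored in [x], except
   through its first argument. *)
Lemma runs_for (Inv : nat -> state R -> Prop) N x hi c s T Q :
  N < W -> Inv 0 (set_ivar s x 0) ->
  (forall k s', k <= N -> icell s' x 0 = k -> Inv k s' ->
     iok s' hi /\ ival s' hi = N) ->
  (forall k s', k < N -> icell s' x 0 = k -> Inv k s' ->
     runs c s' T (fun s'' => icell s'' x 0 = k /\ Inv k.+1 (set_ivar s'' x k.+1))) ->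
  (forall s', Inv N s' -> Q s') ->
  runs (For x hi c) s (for_time (icost hi) N T) Q.
Proof.
move=> ltNW inv0 hiP bodyP postP.
have W0 : 0 < W by apply: leq_trans ltNW.
pose inc := iset x (IAdd (ivar x) (IConst 1)).
pose w := While (ILt (ivar x) hi) (Seq c inc).
have loop d k s' : d + k = N -> icell s' x 0 = k -> Inv k s' ->
    runs w s' (d * (T + icost hi + 20) + icost hi + 10) Q.
  elim: d k s' => [|d IHd] k s' dk xk inv.
    have [okh vh] := hiP k s' ltac:(lia) xk inv.
    exists (bcost (ILt (ivar x) hi)).+1, s'; split; last by apply: postP; rewrite -dk.
      by apply: ExecWhileF; rewrite /= iokE // mod0n vh xk; lia.
    by rewrite /=; lia.
  have [okh vh] := hiP k s' ltac:(lia) xk inv.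
  have [t1 [s1 [ex1 le1 [x1 inv1]]]] := bodyP k s' ltac:(lia) xk inv.
  have := IHd k.+1 (set_ivar s1 x k.+1) ltac:(lia) (ltac:(by rewrite /= /upd !eqxx)) inv1.
  move=> [t2 [s2 [ex2 le2 q]]].
  have exi : exec W inc s1 6 (set_ivar s1 x k.+1).
    have := ExecIStore W s1 x (IConst 0) (IAdd (ivar x) (IConst 1)).
    by rewrite /= mod0n x1 modnDmr modn_small ?addn1 //; lia.
  exists (bcost (ILt (ivar x) hi) + (t1 + 6).+1 + t2).+1, s2; split=> //.
    refine (ExecWhileT _ (ExecSeq ex1 exi) ex2).
    by rewrite /= iokE // mod0n vh xk; lia.
  by rewrite /=; lia.
have [t [s' [ex le q]]] := loop N 0 (set_ivar s x 0) (addn0 _)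
  (ltac:(by rewrite /= /upd !eqxx)) inv0.
exists (3 + t).+1, s'; split=> //; last by rewrite /for_time; lia.
apply: ExecSeq ex.
by have := ExecIStore W s x (IConst 0) (IConst 0); rewrite /= mod0n.
Qed.

End Logic.

(** * Treewidth from an elimination order *)

Section ParentTree.
Variables (B : finType) (root : B) (up : B -> B) (rank : B -> nat).
Hypothesis up_root : up root = root.
Hypothesis rank_up : forall b, b != root -> rank b < rank (up b).

Definition up_edge : rel B := fun x y => (x != y) && ((up x == y) || (up y == x)).

Lemma up_edge_sym : symmetric up_edge.
Proof. by move=> x y; rewrite /up_edge eq_sym orbC. Qed.

Lemma up_edge_up b : b != root -> up_edge b (up b).
Proof.
move=> nb; rewrite /up_edge eqxx andbT; apply/eqP => e.
by have := rank_up nb; rewrite -e ltnn.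
Qed.

Lemma rank_ub : exists m, forall b, rank b <= m.
Proof. by exists (\max_b rank b) => b; exact: leq_bigmax. Qed.

Lemma connect_root b : connect up_edge b root.
Proof.
have [m mP] := rank_ub.
have [d] := ubnP (m - rank b); elim: d b => // d IH b ltd.
have [->|nb] := eqVneq b root; first exact: connect0.
apply: connect_trans (connect1 (up_edge_up nb)) (IH _ _).
by have := rank_up nb; have := mP (up b); lia.
Qed.

(** On a cycle, a vertex of least [rank] could only have its own [up] as a neighbour, but its two
    neighbours there differ. *)
Lemma up_edge_tree : is_tree up_edge.
Proof.
have cs : connect_sym up_edge by apply: sym_connect_sym; exact: up_edge_sym.
split=> //.
- exact: up_edge_sym.
- by move=> x; rewrite /up_edge eqxx.
- by apply/card_gt0P; exists root.
- move=> u v; apply: connect_trans (connect_root u) _; rewrite cs; exact: connect_root.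
move=> c c2; apply/negP => /andP[cyc uc].
have c0 : 0 < size c by apply: ltn_trans c2.
have [x0 x0c] : exists x, x \in c by case: c {cyc uc c2} c0 => // x c _; exists x; rewrite mem_head.
have [x xc xmin] : exists2 x, x \in c & forall y, y \in c -> rank x <= rank y.
  by case: (arg_minnP rank x0c) => x xc xmin; exists x.
case: (rot_to xc) => i c' ec.
have cyc' : cycle up_edge (x :: c') by rewrite -ec rot_cycle.
have uc' : uniq (x :: c') by rewrite -ec rot_uniq.
have sc' : size (x :: c') = size c by rewrite -ec size_rot.
have mc' y : y \in x :: c' -> y \in c by rewrite -ec mem_rot.
case: c' => [|y c'] in ec cyc' uc' sc' mc' *; first by rewrite -sc' in c2.
case/lastP: c' => [|c' z] in ec cyc' uc' sc' mc' *; first by rewrite -sc' in c2.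
have isup w : w \in c -> up_edge x w -> w = up x.
  move=> wc /andP[nxw /orP[/eqP->//|/eqP uw]].
  have nw : w != root by apply: contraNneq nxw => e; rewrite -uw e up_root.
  by have := rank_up nw; rewrite uw ltnNge xmin.
move: cyc'; rewrite /= rcons_path last_rcons => /andP[exy /andP[_ ezx]].
have ey : y = up x by apply: isup => //; apply: mc'; rewrite !inE eqxx orbT.
have ez : z = up x.
  apply: isup; last by rewrite up_edge_sym.
  by apply: mc'; rewrite !inE mem_rcons mem_head !orbT.
by move: uc'; rewrite ey ez /= mem_rcons mem_head /= andbF.
Qed.

End ParentTree.

Section Elimination.
Variables (V : finType) (e : rel V) (N : V -> {set V}) (rank : V -> nat) (k : nat).
Hypothesis eN : forall u v, e u v -> (v \in N u) || (u \in N v).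
Hypothesis rankN : forall u v, v \in N u -> rank u < rank v.
Hypothesis cliqueN : forall v x y, x \in N v -> y \in N v -> x != y ->
  (y \in N x) || (x \in N y).
Hypothesis cardN : forall v, #|N v| <= k.

(** The node [None], with an empty bag, ties the trees of the elimination forest together. *)
Definition elim_up (b : option V) : option V :=
  if b is Some v then
    if [pick x in N v] is Some x0 then Some [arg min_(x < x0 in N v) rank x]
    else None
  else None.

Definition elim_bag (b : option V) : {set V} :=
  if b is Some v then v |: N v else set0.

Lemma elim_upP v :
  match elim_up (Some v) with
  | Some x => x \in N v /\ forall y, y \in N v -> rank x <= rank y
  | None => N v = set0
  end.
Proof.
rewrite /elim_up; case: pickP => [x0 x0N|N0].
  by case: arg_minnP => // x xN xmin; split.
by apply/setP => x; rewrite inE; have := N0 x.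
Qed.

Definition elim_rank (b : option V) : nat :=
  if b is Some v then rank v else (\max_v rank v).+1.

Lemma elim_tree : is_tree (up_edge elim_up).
Proof.
apply: (@up_edge_tree _ None elim_up elim_rank) => // -[v _|//].
have := elim_upP v; case: elim_up => [x [xN _]|_]; first exact: rankN.
by rewrite /= ltnS; exact: leq_bigmax.
Qed.

(** [N] describes a chordal supergraph of [e], with [N v] the neighbours of [v] that are eliminated
    later. The bag of [a] hangs below the bag of [x], the first eliminated member of [N a]. The
    clique condition puts the rest of [N a] into [N x], so a vertex [v] stays in the bags all the
    way up to the bag [Some v]. *)
Lemma elimination_treewidth : treewidth e <= k.
Proof.
rewrite /treewidth; case: ex_minnP => m _ mmin.
have leB : (\max_(b : option V) #|elim_bag b|).-1 <= k.
  suff: \max_(b : option V) #|elim_bag b| <= k.+1 by lia.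
  apply/bigmax_leqP => -[v|] _ /=; last by rewrite cards0.
  by apply: leq_trans (leq_card_setU _ _) _; rewrite cards1 add1n ltnS cardN.
apply: leq_trans leB; apply: mmin; apply/asboolP.
exists (option V), (up_edge elim_up), elim_bag; split=> //; split.
- exact: elim_tree.
- by move=> v; exists (Some v); rewrite !inE eqxx.
- move=> u v /eN /orP[vN|uN]; [exists (Some u)|exists (Some v)];
    by rewrite !inE ?eqxx ?vN ?uN ?orbT.
move=> v.
set f := (X in connect X).
have fs : connect_sym f.
  apply: sym_connect_sym => x y.
  by rewrite /f /= (up_edge_sym elim_up x y); congr andb; rewrite andbC.
suff top a : v \in elim_bag a -> connect f a (Some v).
  by move=> a b /top ca /top cb; apply: connect_trans ca _; rewrite fs.
case: a => [a|]; last by rewrite inE.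
have [d] := ubnP (rank v - rank a); elim: d a => // d IH a ltd va.
have [->|nav] := eqVneq a v; first exact: connect0.
have vN : v \in N a by move: va; rewrite !inE eq_sym (negbTE nav).
have := elim_upP a; case E: (elim_up (Some a)) => [x|]; last first.
  by move=> N0; move: vN; rewrite N0 inE.
move=> [xN xmin].
have vx : v \in elim_bag (Some x).
  rewrite !inE; have [//|nvx] := eqVneq v x.
  have /orP[//|/rankN] := cliqueN xN vN (ltac:(by rewrite eq_sym)).
  by rewrite ltnNge xmin.
have ra := rankN xN.
apply: connect_trans (IH x _ vx); last by have := rankN vN; lia.
apply: connect1; apply/and3P; split=> //; apply/andP; split; last by rewrite E eqxx.
by apply/eqP => -[ex]; rewrite ex ltnn in ra.
Qed.

End Elimination.

(** * One round *)

(** The absent parent [n] can be reached as a last ancestor, which allows [anc n par v (top v)] in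
    all cases; statements about vertices bound the upper end by [n]. *)
Inductive anc (n : nat) (par : nat -> nat) (i : nat) : nat -> Prop :=
  | AncRefl : anc n par i i
  | AncStep j : anc n par i j -> j < n -> anc n par i (par j).

(** Acyclicity is built into the numbering: increasing loops run bottom-up, decreasing ones
    top-down. *)
Definition is_forest n (par : nat -> nat) := forall i, i < n -> i < par i <= n.

Section Forest.
Variables (n : nat) (par : nat -> nat).
Hypothesis forest_par : is_forest n par.

Lemma anc_trans i j k : anc n par i j -> anc n par j k -> anc n par i k.
Proof. by move=> ij; elim=> // a b ja; exact: AncStep. Qed.

Lemma anc_cons i j : i < n -> anc n par (par i) j -> anc n par i j.
Proof. by move=> ltin; apply: anc_trans; apply: AncStep => //; exact: AncRefl. Qed.

Lemma anc_leq i j : anc n par i j -> i <= j.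
Proof. by elim=> // k _ le ltk; have := forest_par ltk; lia. Qed.

Lemma anc_inv i j : anc n par i j -> i = j \/ (i < n /\ anc n par (par i) j).
Proof.
elim=> [|k ik IH ltkn]; first by left.
right; have lt : i < n by have := anc_leq ik; lia.
split=> //; case: IH => [->|[_ ak]]; first exact: AncRefl.
exact: AncStep.
Qed.

Lemma anc_total i a b : anc n par i a -> anc n par i b ->
  anc n par a b \/ anc n par b a.
Proof.
move=> ia; elim=> [|k ik [ak|ka] ltk]; first by right.
  by left; exact: AncStep.
case: (anc_inv ka) => [<-|[_ ?]]; last by right.
by left; apply: AncStep => //; exact: AncRefl.
Qed.

(** The number of vertices in the subtree of [v]. Children have smaller numbers, so fuel [v.+1]
    suffices. *)
Fixpoint descf k v := if k is k'.+1 then 1 + \sum_(c < n | par c == v) descf k' c else 0.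

Definition desc v := descf v.+1 v.

Lemma descE v : desc v = 1 + \sum_(c < n | par c == v) desc c.
Proof.
have stable k1 k2 w : w < k1 -> w < k2 -> descf k1 w = descf k2 w.
  elim: k1 k2 w => // k1 IH [//|k2] w le1 le2 /=; congr S.
  apply: eq_bigr => c /eqP pc; have := forest_par (ltn_ord c).
  by rewrite pc => ltc; apply: IH; lia.
rewrite [in LHS]/desc /=; congr S; apply: eq_bigr => c /eqP pc.
by apply: stable => //; have := forest_par (ltn_ord c); lia.
Qed.

Lemma desc_lt2_par v : (forall w, w < n -> desc w < 2) -> v < n -> par v = n.
Proof.
move=> small ltv; have /andP[ltp lepn] := forest_par ltv.
move: lepn; rewrite leq_eqVlt => /orP[/eqP//|/small].
rewrite descE (bigD1 (Ordinal ltv)) //= descE; lia.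
Qed.

Lemma anc_isolated i a : (forall v, v < n -> par v = n) -> anc n par i a -> a < n -> i = a.
Proof. by move=> pn; case=> // j _ ltj; rewrite pn // ltnn. Qed.

(** The vertices below [k] with a parent at or above [k] are the roots of the forest on the first
    [k] vertices. In the step, [k] replaces its children among these roots. *)
Lemma sum_desc_frontier k : k <= n ->
  \sum_(c < n | (c < k) && (k <= par c)) desc c = k.
Proof.
elim: k => [|k IH] ltk; first by rewrite big1 // => c; rewrite ltn0.
have {}IH := IH (ltnW ltk).
rewrite (bigID (fun c : 'I_n => par c == k)) /= in IH.
rewrite (bigD1 (Ordinal ltk)) /=; last by have := forest_par ltk; lia.
rewrite descE.
have -> : \sum_(c < n | par c == k) desc c
    = \sum_(c < n | (c < k <= par c) && (par c == k)) desc c.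
  by apply: eq_bigl => c; have := forest_par (ltn_ord c); lia.
have -> : \sum_(c < n | (c < k.+1 <= par c) && (c != Ordinal ltk)) desc c
    = \sum_(c < n | (c < k <= par c) && (par c != k)) desc c.
  by apply: eq_bigl => c; rewrite -val_eqE /=; have := forest_par (ltn_ord c); lia.
by rewrite -addnA add1n -[in RHS]IH.
Qed.

Lemma desc_leq v : v < n -> desc v <= n.
Proof.
move=> ltv; apply: leq_trans (ltv); rewrite -[leqRHS](sum_desc_frontier ltv).
rewrite (bigD1 (Ordinal ltv)) /= ?leq_addr // ltnSn /=.
by have /andP[] := forest_par ltv.
Qed.

End Forest.

Section Level.
Variables (n s : nat) (par par' cnt bel top : nat -> nat) (sel : nat -> bool).

(* The nearest selected vertex of the subtree of [v]; [n] if there is none. *)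
Definition branch v := if sel v then v else bel v.

(* [n] stands for the absent parent of the roots; it counts as selected. *)
Record level_step : Prop := LevelStep {
  ls_forest : is_forest n par;
  ls_sel_n : sel n;
  ls_cnt v : v < n -> cnt v = 1 + \sum_(c < n | (par c == v) && ~~ sel c) cnt c;
  ls_small v : v < n -> ~~ sel v -> cnt v < s;
  ls_large v : v < n -> sel v -> s <= cnt v \/
    exists c d : 'I_n, [/\ c != d, par c = v, par d = v, branch c < n & branch d < n];
  ls_bel v : v < n -> bel v <= n;
  ls_bel_uniq c : c < n -> par c < n -> branch c < n -> ~~ sel (par c) ->
    bel (par c) = branch c;
  ls_bel_ex v : v < n -> bel v < n ->
    exists c : 'I_n, par c = v /\ branch c = bel v;
  ls_top v : v < n -> top v = if sel (par v) then par v else top (par v);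
  ls_par' v : v < n ->
    par' v = if sel v then top v else if sel (par v) then n else par v
}.

Hypothesis step : level_step.
Let forest_par := ls_forest step.

Lemma forest_ind (P : nat -> Prop) :
  (forall v, v < n -> (~~ sel (par v) -> par v < n -> P (par v)) -> P v) ->
  forall v, v < n -> P v.
Proof.
move=> IH v; have [d] := ubnP (n - v); elim: d v => // d IHd v ltd ltv.
apply: IH => // _ ltp; apply: IHd => //; have := forest_par ltv; lia.
Qed.

Lemma unsel_lt v : v < n -> ~~ sel (par v) -> par v < n.
Proof.
move=> ltv sp; have /andP[_ le] := forest_par ltv; rewrite ltn_neqAle le andbT.
by move: sp; apply: contraNneq => ->; exact: ls_sel_n step.
Qed.

(* The topmost vertex reachable from [v] through unselected vertices. *)
Fixpoint comp_rootf k v :=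
  if k is k'.+1 then if sel (par v) then v else comp_rootf k' (par v) else v.

Definition comp_root v := comp_rootf (n - v) v.

Lemma comp_rootE v : v < n ->
  comp_root v = if sel (par v) then v else comp_root (par v).
Proof.
have stable k1 k2 w : w < n -> n - w <= k1 -> n - w <= k2 ->
    comp_rootf k1 w = comp_rootf k2 w.
  elim: k1 k2 w => [|k1 IH] [|k2] w ltw le1 le2 /=; try lia.
  case: ifP => // /negbT /(unsel_lt ltw) ltp.
  by apply: IH => //; have := forest_par ltw; lia.
move=> ltv; rewrite /comp_root; case E: (n - v) => [|k] /=; first by lia.
case: ifP => // /negbT /(unsel_lt ltv) ltp.
by apply: stable => //; have := forest_par ltv; lia.
Qed.

Lemma comp_rootP v : v < n ->
  [/\ comp_root v < n, sel (par (comp_root v)), top v = par (comp_root v)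
    & anc n par v (comp_root v)].
Proof.
move: v; apply: forest_ind => v ltv IH; rewrite comp_rootE // (ls_top step) //.
case: ifP => [sp|/negbT sp]; first by split=> //; exact: AncRefl.
by have ltp := unsel_lt ltv sp; have [? ? ? ?] := IH sp ltp; split=> //; exact: anc_cons.
Qed.

Lemma top_sel v : v < n -> sel (top v).
Proof. by move/comp_rootP => [_ ? ->]. Qed.

Lemma anc_top v : v < n -> anc n par v (top v).
Proof. by move/comp_rootP => [lt _ -> a]; exact: AncStep. Qed.

Lemma top_bound v : v < n -> v < top v <= n.
Proof.
move=> ltv; have [ltr _ -> /(anc_leq forest_par) le] := comp_rootP ltv.
by have := forest_par ltr; lia.
Qed.

Lemma par'_forest : is_forest n par'.
Proof.
move=> v ltv; rewrite (ls_par' step) //; have := forest_par ltv.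
by have := top_bound ltv; do 2!case: ifP => _ //; lia.
Qed.

Lemma par'_unsel v : v < n -> ~~ sel v -> par' v < n -> ~~ sel (par v) /\ par' v = par v.
Proof.
move=> ltv /negbTE sv; rewrite (ls_par' step) // sv.
by case: ifP => // _; rewrite ltnn.
Qed.

Lemma par'_sel v : v < n -> sel v -> par' v = top v.
Proof. by move=> ltv sv; rewrite (ls_par' step) // sv. Qed.

Lemma anc_par'_edge v : v < n -> par' v < n -> anc n par v (par' v).
Proof.
move=> ltv; have [sv|sv] := boolP (sel v).
  by rewrite par'_sel // => _; exact: anc_top.
by move/(par'_unsel ltv sv) => [_ ->]; apply: AncStep => //; exact: AncRefl.
Qed.

Lemma anc_par' i j : anc n par' i j -> j < n -> anc n par i j.
Proof.
elim=> [|k ik IH ltk ltp]; first by move=> _; exact: AncRefl.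
by apply: anc_trans (IH ltk) _; exact: anc_par'_edge.
Qed.

Lemma branch_sel c : c < n -> branch c < n -> sel (branch c).
Proof.
have [d] := ubnP c; elim: d c => // d IH c ltd ltc.
rewrite /branch; case: ifP => // nsc ltb.
have [b [pb eb]] := ls_bel_ex step ltc ltb.
rewrite -eb; apply: IH => //; last by rewrite eb.
by have := forest_par (ltn_ord b); lia.
Qed.

Lemma branch_ind (P : nat -> nat -> Prop) :
  (forall c, c < n -> sel c -> P c c) ->
  (forall c y, c < n -> ~~ sel c -> forall b, b < n -> par b = c ->
     branch b = y -> P b y -> P c y) ->
  forall c, c < n -> branch c < n -> P c (branch c).
Proof.
move=> Psel Pun c; have [d] := ubnP c; elim: d c => // d IH c ltd ltc.
rewrite /branch; case: ifP => [sc _|/negbT nsc ltb]; first exact: Psel.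
have [b [pb eb]] := ls_bel_ex step ltc ltb.
rewrite -eb; apply: (Pun c _ ltc nsc b) => //; apply: IH => //; last by rewrite eb.
by have := forest_par (ltn_ord b); lia.
Qed.

Lemma anc_branch c : c < n -> branch c < n -> anc n par (branch c) c.
Proof.
move: c; apply: (branch_ind (P := fun c y => anc n par y c)) => c.
  by move=> *; exact: AncRefl.
by move=> y _ _ b ltb <- _ a; exact: AncStep.
Qed.

Lemma comp_root_branch c : c < n -> branch c < n -> comp_root (branch c) = comp_root c.
Proof.
move: c.
apply: (branch_ind (P := fun c y => comp_root y = comp_root c)) => // c y ltc sc b ltb pb _ ->.
by rewrite comp_rootE // pb (negbTE sc).
Qed.

Lemma branch_comp_root c : c < n -> branch c < n -> branch (comp_root c) = branch c.
Proof.
move: c; apply: forest_ind => c ltc IH ltb; rewrite comp_rootE //.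
case: ifP => // /negbT sp; have ltp := unsel_lt ltc sp.
have e : branch (par c) = branch c.
  by rewrite {1}/branch (negbTE sp); exact: ls_bel_uniq.
by rewrite -e; apply: IH => //; rewrite e.
Qed.

Lemma top_branch c : c < n -> branch c < n -> top (branch c) = top c.
Proof.
move=> ltc ltb; have [_ _ -> _] := comp_rootP ltb; have [_ _ -> _] := comp_rootP ltc.
by rewrite comp_root_branch.
Qed.

Lemma par'_comp i j : anc n par' i j -> j < n ->
  sel i = sel j /\ (~~ sel i -> comp_root i = comp_root j).
Proof.
elim=> // k ik IH ltk ltp; have [-> sk] := IH ltk.
have [s'|s'] := boolP (sel k); first by rewrite par'_sel // top_sel.
have [sp ->] := par'_unsel ltk s' ltp.
by rewrite (negbTE sp) sk ?IH //; split=> // _; rewrite comp_rootE // (negbTE sp).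
Qed.

(** No edge of the next forest joins a selected to an unselected vertex, so below [v] there only
    remains the part of its component counted by [cnt]. *)
Lemma desc_unsel v : v < n -> ~~ sel v -> desc n par' v = cnt v.
Proof.
have [d] := ubnP v; elim: d v => // d IH v ltd ltv sv.
rewrite (descE par'_forest) (ls_cnt step) //; congr S.
have eP (c : 'I_n) : (par' c == v) = (par c == v) && ~~ sel c.
  apply/eqP/andP => [pc|[/eqP pc sc]].
    have sc : ~~ sel c.
      by apply: contra sv => sc; rewrite -pc par'_sel //; exact: top_sel.
    by have [_ <-] := par'_unsel (ltn_ord c) sc (ltac:(by rewrite pc)); rewrite pc.
  by rewrite (ls_par' step) // pc (negbTE sc) (negbTE sv).
rewrite (eq_bigl _ _ eP); apply: eq_bigr => c /andP[/eqP pc sc].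
by apply: IH => //; have := forest_par (ltn_ord c); lia.
Qed.

(** A child [y] of [v] in the next forest lies below exactly one old child of [v], namely
    [comp_root y]. It is recovered as the branch of that child, because a component has at most one
    selected vertex below it; hence the map is injective. *)
Lemma desc_sel v : v < n -> sel v ->
  desc n par' v <= 1 + \sum_(c < n | (par c == v) && (branch c < n)) desc n par' (branch c).
Proof.
move=> ltv sv; rewrite (descE par'_forest) leq_add2l.
(* [comp_root y] is always below [n], so the default is never taken. *)
pose f (y : 'I_n) := odflt y (insub (comp_root y)).
have fE y : f y = comp_root y :> nat.
  by rewrite /f insubT //; case: (comp_rootP (ltn_ord y)).
have yP (y : 'I_n) : par' y == v -> [/\ sel y, par (f y) = v & branch (f y) = y].
  move=> /eqP py; have sy : sel y.
    apply: contraTT sv => sy.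
    by have [sp e] := par'_unsel (ltn_ord y) sy (ltac:(by rewrite py)); rewrite -py e.
  have by' : branch y = y by rewrite /branch sy.
  split=> //; rewrite fE.
    by have [_ _ <- _] := comp_rootP (ltn_ord y); rewrite -py par'_sel.
  by rewrite branch_comp_root ?by'.
rewrite (eq_bigr (fun y => desc n par' (branch (f y)))); last by move=> y /yP[_ _ ->].
rewrite -(big_imset (h := f) (A := [pred y : 'I_n | par' y == v])
             (fun c => desc n par' (branch c))) /=; last first.
  move=> y z /yP[_ _ ey] /yP[_ _ ez] e; apply: ord_inj; by rewrite -ey -ez e.
rewrite big_mkcond [leqRHS]big_mkcond /=; apply: leq_sum => c _.
case: ifP => // /imsetP[y /yP[_ pf bf] ->]; by rewrite pf bf eqxx ltn_ord.
Qed.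

(** The charging argument, doubled to avoid halves. Each branch brings [s] units per vertex of its
    next tree and a surplus of [s]. A selected [v] needs [2 * s] for itself and for the surplus of
    the merged tree: either two branches bring their surpluses, or [2 * cnt v] pays alone.
    Unselected vertices pass their [2 * cnt] upwards. *)
Lemma desc_step_bound v : v < n ->
  (if branch v < n then s * (desc n par' (branch v)).+1 else 0)
    + 2 * (if sel v then 0 else cnt v) <= 2 * desc n par v.
Proof.
pose F w := if branch w < n then s * (desc n par' (branch w)).+1 else 0.
pose u w := if sel w then 0 else cnt w.
rewrite -/(F v) -/(u v).
have [d] := ubnP v; elim: d v => // d IH v ltd ltv.
have sumF : \sum_(c < n | par c == v) F c + 2 * cnt v <= 2 * desc n par v.
  rewrite (descE forest_par) (ls_cnt step) //.
  have -> : \sum_(c < n | (par c == v) && ~~ sel c) cnt c = \sum_(c < n | par c == v) u c.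
    by rewrite big_mkcondr; apply: eq_bigr => c _; rewrite /u; case: (sel c).
  rewrite !mulnDr addnCA leq_add2l !big_distrr -big_split /=.
  apply: leq_sum => c /eqP pc; apply: IH => //.
  by have := forest_par (ltn_ord c); lia.
have [sv|sv] := boolP (sel v); last first.
  rewrite /u (negbTE sv); apply: leq_trans sumF; rewrite leq_add2r.
  rewrite {1}/F; case: ifP => //; rewrite /branch (negbTE sv) => ltb.
  have [c [pc bc]] := ls_bel_ex step ltv ltb.
  by rewrite (bigD1 c) /= ?pc ?eqxx // {1}/F bc ltb leq_addr.
rewrite /u sv muln0 addn0; apply: leq_trans sumF.
rewrite /F /branch sv ltv -/branch -/(F _).
have := desc_sel ltv sv; set D := \sum_(c < n | _) _ => leD.
pose k := \sum_(c < n | (par c == v) && (branch c < n)) 1.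
have -> : \sum_(c < n | par c == v) F c = s * D + s * k.
  rewrite /D /k big_mkcondr [X in _ + s * X]big_mkcondr /= !big_distrr -big_split /=.
  apply: eq_bigr => c _; rewrite /F; case: ifP => _; by rewrite ?muln0 // mulnS muln1 addnC.
have : 2 * s <= s * k + 2 * cnt v.
  case: (ls_large step ltv sv) => [|[c [c' [ncc pc pc' bc bc']]]]; first by lia.
  have : 2 <= k by rewrite /k (bigD1 c) /= ?pc ?eqxx // (bigD1 c') //= pc' eqxx bc' eq_sym.
  by nia.
by nia.
Qed.

Lemma desc_step : (forall v, v < n -> 2 * desc n par v < s * s.+1) ->
  forall v, v < n -> desc n par' v < s.
Proof.
move=> small v ltv; have [sv|sv] := boolP (sel v).
  have := desc_step_bound ltv; rewrite /branch sv ltv => le.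
  have lt : s * (desc n par' v).+1 < s * s.+1 by have := small v ltv; lia.
  by have : 0 < s; [lia|move=> s0; rewrite ltn_pmul2l in lt].
by rewrite desc_unsel //; exact: ls_small.
Qed.

(** The selected vertices on the way to [a] form a path of the next forest that ends in [branch a].
    This round only has to supply the edge from there to [a]. *)
Lemma hop_up_sel i a : anc n par i a -> a < n -> sel i ->
  branch a < n /\ anc n par' i (branch a).
Proof.
elim=> [|k ik IH ltk] ltp si; first by rewrite /branch si; split=> //; exact: AncRefl.
have [ltb ab] := IH ltk si.
have [sp|sp] := boolP (sel (par k)); last first.
  have -> // : branch (par k) = branch k.
  by rewrite {1}/branch (negbTE sp) (ls_bel_uniq step ltk).
have -> : branch (par k) = par k by rewrite /branch sp.
split=> //.
have -> : par k = par' (branch k).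
  by rewrite par'_sel ?branch_sel // top_branch // (ls_top step) // sp.
exact: AncStep.
Qed.

(** Either the way to [a] stays in the component, which survives in the next forest, or it leaves
    through [top i], at the price of one edge. *)
Lemma hop_up_unsel i a : anc n par i a -> a < n -> ~~ sel i ->
  anc n par' i a \/ [/\ top i < n, sel (top i) & anc n par (top i) a].
Proof.
move=> ia lta si; have lti : i < n by have := anc_leq forest_par ia; lia.
move: i lti ia si; apply: forest_ind => i lti IH ia si.
case: (anc_inv forest_par ia) => [<-|[_ pa]]; first by left; exact: AncRefl.
have ltp : par i < n by have := anc_leq forest_par pa; lia.
rewrite (ls_top step) //; case: ifP => [sp|/negbT sp]; first by right.
case: (IH sp ltp pa sp) => [pa'|]; last by right.
left; apply: anc_cons => //.
by rewrite (ls_par' step) // (negbTE si) (negbTE sp).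
Qed.

End Level.

(** * All rounds *)

Section Edges.
Variables (n : nat) (sel : nat -> nat -> bool) (bel top : nat -> nat -> nat).

Definition vertex_edges l j : seq (nat * nat) :=
  if sel l j then [::] else
  (if top l j < n then [:: (j, top l j)] else [::]) ++
  (if bel l j < n then [:: (j, bel l j)] else [::]).

(** The last vertex comes first: this is the order in which the top-down pass emits the edges. *)
Fixpoint level_edges l k : seq (nat * nat) :=
  if k is i.+1 then level_edges l i ++ vertex_edges l (n.-1 - i) else [::].

Fixpoint all_edges l : seq (nat * nat) :=
  if l is m.+1 then all_edges m ++ level_edges m n else [::].

Lemma mem_vertex_edges l j a b : (a, b) \in vertex_edges l j ->
  [/\ a = j, ~~ sel l a, b < n & b = top l a \/ b = bel l a].
Proof.
rewrite /vertex_edges; case: (boolP (sel l j)) => // sj; rewrite mem_cat.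
by case/orP; case: ifP => //; rewrite inE => lt /eqP[-> ->]; split=> //; [left|right].
Qed.

Lemma vertex_edges_top l j : ~~ sel l j -> top l j < n ->
  (j, top l j) \in vertex_edges l j.
Proof. by rewrite /vertex_edges => /negbTE-> ->; rewrite mem_head. Qed.

Lemma vertex_edges_bel l j : ~~ sel l j -> bel l j < n ->
  (j, bel l j) \in vertex_edges l j.
Proof. by rewrite /vertex_edges => /negbTE-> ->; rewrite mem_cat mem_head orbT. Qed.

Lemma mem_level_edges l k a b : k <= n ->
  ((a, b) \in level_edges l k) = (n - k <= a < n) && ((a, b) \in vertex_edges l a).
Proof.
elim: k => [|k IH] lek /=; first by rewrite subn0 in_nil; lia.
rewrite mem_cat IH ?(ltnW lek) //.
have [e|ne] := eqVneq a (n.-1 - k); first by rewrite e; case: (_ \in _); rewrite ?andbF //; lia.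
have -> : (a, b) \in vertex_edges l (n.-1 - k) = false.
  by apply/negP => /mem_vertex_edges[ea]; rewrite ea eqxx in ne.
by rewrite orbF; congr andb; lia.
Qed.

Lemma mem_all_edges m a b : (a, b) \in all_edges m <->
  exists2 l, l < m & a < n /\ (a, b) \in vertex_edges l a.
Proof.
elim: m => [|m IH] /=; first by split=> // -[].
rewrite mem_cat; split=> [/orP[/IH[l ltl [lta ab]]|]|[l ltl [lta ab]]].
- by exists l => //; exact: ltnW.
- by rewrite mem_level_edges // subnn => /andP[lta ab]; exists m.
- apply/orP; move: ltl; rewrite ltnS leq_eqVlt => /orP[/eqP e|ltl]; [right|left].
    by rewrite mem_level_edges // subnn lta -e.
  by apply/IH; exists l.
Qed.

Lemma size_all_edges m : size (all_edges m) <= 2 * n * m.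
Proof.
have sv l j : size (vertex_edges l j) <= 2.
  by rewrite /vertex_edges; case: (sel l j) => //; case: (top l j < n); case: (bel l j < n).
have sl l k : size (level_edges l k) <= 2 * k.
  by elim: k => //= k IH; rewrite size_cat; have := sv l (n.-1 - k); lia.
elim: m => //= m IH; rewrite size_cat; have := sl m n; lia.
Qed.

Lemma uniq_level_edges l k : k <= n ->
  (forall j, j < n -> ~~ sel l j -> top l j < n -> top l j <> bel l j) -> uniq (level_edges l k).
Proof.
move=> lek neq; elim: k lek => //= k IH ltk.
rewrite cat_uniq IH ?(ltnW ltk) //=; apply/andP; split.
  apply/hasPn => -[a b] /mem_vertex_edges[-> _ _ _].
  by rewrite mem_level_edges ?(ltnW ltk) //; lia.
have ltj : n.-1 - k < n by lia.
rewrite /vertex_edges; case: (boolP (sel _ _)) => // sj.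
case: ifP => [ltt|_]; case: ifP => _ //=; rewrite inE andbT.
by apply/negP => /eqP[e]; exact: neq ltj sj ltt e.
Qed.

End Edges.

Lemma level_edges_ext n sel bel top sel' bel' top' l l' k : k <= n ->
  (forall j, n - k <= j < n ->
     [/\ sel l j = sel' l' j, bel l j = bel' l' j & top l j = top' l' j]) ->
  level_edges n sel bel top l k = level_edges n sel' bel' top' l' k.
Proof.
elim: k => //= k IH ltk eqs; rewrite IH ?(ltnW ltk) //; last first.
  by move=> j lej; apply: eqs; lia.
have [|s b t] := eqs (n.-1 - k); first by lia.
by rewrite /vertex_edges s b t.
Qed.

Lemma all_edges_ext n sel bel top sel' bel' top' m :
  (forall l j, l < m -> j < n ->
     [/\ sel l j = sel' l j, bel l j = bel' l j & top l j = top' l j]) ->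
  all_edges n sel bel top m = all_edges n sel' bel' top' m.
Proof.
elim: m => //= m IH eqs; rewrite IH; last by move=> l j ltl; apply: eqs; exact: ltnW.
congr cat; apply: level_edges_ext => // j /andP[_ ltj]; exact: eqs.
Qed.

(** Numbers increase along the walk. As emulator edges join ancestors to descendants, it leads
    towards the root and its weight telescopes. *)
Inductive climb (E : seq (nat * nat)) : nat -> nat -> nat -> Prop :=
  | ClimbNil i : climb E 0 i i
  | ClimbCons h i x a : i < x -> ((i, x) \in E) || ((x, i) \in E) ->
      climb E h x a -> climb E h.+1 i a.

Lemma climb_trans E h1 h2 i x a : climb E h1 i x -> climb E h2 x a -> climb E (h1 + h2) i a.
Proof.
elim=> // {}h1 {}i y {}x lt e _ IH /IH; rewrite addSn; exact: ClimbCons.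
Qed.

Section LevelSizes.
Variables (n J : nat) (thr : nat -> nat).
Variables (par cnt bel top : nat -> nat -> nat) (sel : nat -> nat -> bool).

Hypothesis steps : forall l, l < J ->
  level_step n (thr (J.-1 - l)) (par l) (par l.+1) (cnt l) (bel l) (top l) (sel l).
Hypothesis forest0 : is_forest n (par 0).
Hypothesis thr0 : thr 0 = 2.
Hypothesis thrS : forall i, 2 * thr i.+1 = thr i * (thr i).+1.
Hypothesis thrJ : n < thr J.

Lemma levels_forest l : l <= J -> is_forest n (par l).
Proof. by case: l => // l /steps; exact: par'_forest. Qed.

Lemma levels_desc l v : l <= J -> v < n -> desc n (par l) v < thr (J - l).
Proof.
elim: l v => [|l IH] v lel ltv.
  by rewrite subn0; apply: leq_ltn_trans thrJ; exact: desc_leq.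
have -> : J - l.+1 = J.-1 - l by lia.
apply: (desc_step (steps lel)) => // w ltw.
rewrite -thrS; have -> : (J.-1 - l).+1 = J - l by lia.
by rewrite ltn_pmul2l //; apply: IH => //; exact: ltnW.
Qed.

(** The bound on the tree sizes has come down to [thr 0 = 2], so only single vertices are left. *)
Lemma last_level_par v : v < n -> par J v = n.
Proof.
apply: desc_lt2_par; first exact: levels_forest.
by move=> w ltw; rewrite -thr0 -(subnn J); exact: levels_desc.
Qed.

End LevelSizes.

(** * Hop counts and perfect elimination over all rounds *)

Section Levels.
Variables (n J : nat) (thr : nat -> nat).
Variables (par cnt bel top : nat -> nat -> nat) (sel : nat -> nat -> bool).

Hypothesis steps : forall l, l < J ->
  level_step n (thr (J.-1 - l)) (par l) (par l.+1) (cnt l) (bel l) (top l) (sel l).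
Let E := all_edges n sel bel top J.
Let br l := branch (bel l) (sel l).
Let cr l := comp_root n (par l) (sel l).

Lemma anc_levels l l' i j : l <= l' -> l' <= J -> anc n (par l') i j -> j < n ->
  anc n (par l) i j.
Proof.
elim: l' => [|l' IH]; first by rewrite leqn0 => /eqP->.
rewrite leq_eqVlt => /orP[/eqP->//|lel] lel' a ltj.
apply: IH => //; first exact: ltnW.
exact: (anc_par' (steps lel')).
Qed.

Lemma levels_comp l l' i j : l < l' -> l' <= J -> anc n (par l') i j -> j < n ->
  sel l i = sel l j /\ (~~ sel l i -> cr l i = cr l j).
Proof.
move=> ltl lel' a ltj; have lt : l < J by lia.
by apply: (par'_comp (steps lt)) => //; exact: anc_levels ltl lel' a ltj.
Qed.

Lemma all_edgesP a b : (a, b) \in E -> exists l,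
  [/\ l < J, a < n, b < n, ~~ sel l a & sel l b] /\ (b = top l a \/ b = bel l a).
Proof.
move/mem_all_edges => [l ltl [lta /mem_vertex_edges[_ sa ltb ab]]].
exists l; split=> //; split=> //; case: ab => e.
  by rewrite e; exact: (top_sel (steps ltl)).
have eb : br l a = bel l a by rewrite /br /branch (negbTE sa).
by rewrite e -eb; apply: (branch_sel (steps ltl)) => //; rewrite -/(br l) eb -e.
Qed.

Lemma edge_anc l a b : l < J -> a < n -> b < n -> ~~ sel l a ->
  b = top l a \/ b = bel l a -> anc n (par l) a b \/ anc n (par l) b a.
Proof.
move=> ltl lta ltb sa [->|eb]; first by left; exact: (anc_top (steps ltl)).
right; have e : br l a = b by rewrite /br /branch (negbTE sa).
by rewrite -e; apply: (anc_branch (steps ltl)) => //; rewrite -/(br l) e.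
Qed.

Lemma all_edges_anc a b : (a, b) \in E -> anc n (par 0) a b \/ anc n (par 0) b a.
Proof.
move/all_edgesP => [l [[ltl lta ltb sa sb] eb]].
by case: (edge_anc ltl lta ltb sa eb) => ?; [left|right];
  apply: (anc_levels (l' := l)) => //; exact: ltnW.
Qed.

Lemma all_edges_sel_before a b l l0 : l < J -> a < n -> b < n -> ~~ sel l a ->
  b = top l a \/ b = bel l a -> l0 < l -> sel l0 a = sel l0 b.
Proof.
move=> ltl lta ltb sa eb ltl0.
by case: (edge_anc ltl lta ltb sa eb) => /levels_comp ab;
  [have [] := ab l0 ltl0 (ltnW ltl) ltb|have [->] := ab l0 ltl0 (ltnW ltl) lta].
Qed.

(** The round of an edge is the first in which the selection bits of its ends differ, so no edge
    occurs in two rounds. Within a round, [top] is above a vertex and [bel] is not. *)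
Lemma all_edges_uniq : uniq E.
Proof.
have sameP l a b : l < J -> (a, b) \in level_edges n sel bel top l n ->
    [/\ ~~ sel l a, sel l b & forall l0, l0 < l -> sel l0 a = sel l0 b].
  move=> ltl; rewrite mem_level_edges // => /andP[/andP[_ lta]].
  move=> /mem_vertex_edges[_ sa ltb eb]; split=> //.
    case: eb => e; first by rewrite e; exact: (top_sel (steps ltl)).
    have eb : br l a = bel l a by rewrite /br /branch (negbTE sa).
    by rewrite e -eb; apply: (branch_sel (steps ltl)) => //; rewrite -/(br l) eb -e.
  by move=> l0; apply: all_edges_sel_before eb.
rewrite /E; have : J <= J by [].
elim: {1 3}J => //= m IH ltm; rewrite cat_uniq IH ?(ltnW ltm) //=; apply/andP; split.
  apply/hasPn => -[a b] /(sameP _ _ _ ltm)[_ _ same]; apply/negP.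
  move/mem_all_edges => [l ltl [lta ab]]; have := same l ltl.
  have lab : (a, b) \in level_edges n sel bel top l n by rewrite mem_level_edges // subnn lta.
  have [sa sb _] := sameP l a b (ltn_trans ltl ltm) lab.
  by rewrite sb (negbTE sa).
apply: uniq_level_edges => // j ltj sj ltt e.
have eb : br m j = bel m j by rewrite /br /branch (negbTE sj).
have := anc_branch (steps ltm) ltj; rewrite -/(br m) eb -e => /(_ ltt).
move/(anc_leq (ls_forest (steps ltm))).
by have := top_bound (steps ltm) ltj; lia.
Qed.

(** The round is determined by the two ends, and the end that is unselected in it comes first. *)
Lemma all_edges_asym a b : (a, b) \in E -> (b, a) \notin E.
Proof.
move/all_edgesP => [l [[ltl lta ltb sa sb] eb]]; apply/negP.
move/all_edgesP => [l' [[ltl' _ _ sb' sa'] ea]].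
case: (ltngtP l l') => [lt|lt|e].
- by have := all_edges_sel_before ltl' ltb lta sb' ea lt; rewrite (negbTE sa) sb.
- by have := all_edges_sel_before ltl lta ltb sa eb lt; rewrite (negbTE sb') sa'.
- by rewrite e sa' in sa.
Qed.

(* The binary number whose digits are the selection bits of [v], level 0 first. *)
Fixpoint sel_key l v := if l is m.+1 then 2 * sel_key m v + sel m v else 0.

Lemma sel_key_lt l u v : l < J -> (forall l0, l0 < l -> sel l0 u = sel l0 v) ->
  ~~ sel l u -> sel l v -> sel_key J u < sel_key J v.
Proof.
move=> ltl same su sv.
have eqk : sel_key l u = sel_key l v.
  elim: l same {ltl su sv} => //= l IH same.
  by rewrite IH ?same // => l0 lt; apply: same; exact: ltnW.
have : l.+1 <= J by [].
elim: J => // m IH; rewrite leq_eqVlt => /orP[/eqP[<-]|/IH lt] /=; last first.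
  by case: (sel m u); case: (sel m v); lia.
by rewrite eqk (negbTE su) sv; lia.
Qed.

(** The later neighbours of [v] in the chordal completion. The lower selected vertex is taken from
    the root of the component, so it belongs to the boundary even when it does not lie below [v]. *)
Definition boundary (v x : nat) : Prop :=
  x < n /\ exists2 l, l < J & ~~ sel l v /\ (x = top l v \/ x = br l (cr l v)).

Lemma boundary_anc l v x : l < J -> v < n -> x < n -> ~~ sel l v ->
  x = top l v \/ x = br l (cr l v) ->
  [/\ sel l x & exists2 r, r < n /\ anc n (par l) v r & anc n (par l) x r \/ anc n (par l) r x].
Proof.
move=> ltl ltv ltx sv; have [ltc sc tc ac] := comp_rootP (steps ltl) ltv.
move=> [e|e]; split.
- by rewrite e (top_sel (steps ltl)).
- exists v; first by split=> //; exact: AncRefl.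
  by right; rewrite e; exact: (anc_top (steps ltl)).
- by rewrite e; apply: (branch_sel (steps ltl)) => //; rewrite -/(br l) -e.
- exists (cr l v); first by split.
  by left; rewrite e; apply: (anc_branch (steps ltl)) => //; rewrite -/(br l) -e.
Qed.

(** The vertex [x] is linked to [v] by paths of the forest [par l'], through the component root if
    [x] is the lower boundary vertex. Such paths neither leave a component of an earlier round nor
    mix its selected and unselected vertices. *)
Lemma boundary_comp l l' v x : l < l' -> l' < J -> v < n -> x < n -> ~~ sel l' v ->
  x = top l' v \/ x = br l' (cr l' v) ->
  sel l v = sel l x /\ (~~ sel l v -> cr l v = cr l x).
Proof.
move=> ltl ltl' ltv ltx sv xv.
have [_ [r [ltr vr] xr]] := boundary_anc ltl' ltv ltx sv xv.
have [-> cvr] := levels_comp ltl (ltnW ltl') vr ltr.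
case: xr => xr.
  have [e cxr] := levels_comp ltl (ltnW ltl') xr ltr.
  by rewrite -e; split=> // s0; rewrite cvr -?e // cxr.
have [e cxr] := levels_comp ltl (ltnW ltl') xr ltx.
by rewrite -e; split=> // s0; rewrite cvr // cxr.
Qed.

Lemma boundary_key v x : v < n -> boundary v x -> sel_key J v < sel_key J x.
Proof.
move=> ltv [ltx [l ltl [sv xv]]].
have [sx _] := boundary_anc ltl ltv ltx sv xv.
apply: (sel_key_lt ltl) => // l0 ltl0.
by have [] := boundary_comp ltl0 ltl ltv ltx sv xv.
Qed.

Lemma top_comp l u v : l < J -> u < n -> v < n -> cr l u = cr l v -> top l u = top l v.
Proof.
move=> ltl ltu ltv e; have [_ _ -> _] := comp_rootP (steps ltl) ltu.
by have [_ _ -> _] := comp_rootP (steps ltl) ltv; rewrite -/(cr l) e.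
Qed.

Lemma edge_boundary a b : (a, b) \in E -> boundary a b.
Proof.
move/all_edgesP => [l [[ltl lta ltb sa sb] [eb|eb]]]; split=> //; exists l => //.
  by split=> //; left.
have ba : br l a = b by rewrite /br /branch (negbTE sa).
by split=> //; right; rewrite /br /cr (branch_comp_root (steps ltl)) // -/(br l) ba.
Qed.

Hypothesis last_par : forall v, v < n -> par J v = n.

Lemma climb_levels i a : anc n (par 0) i a -> a < n ->
  exists2 h, h <= 2 * J & climb E h i a.
Proof.
suff top_down d l : d + l = J -> forall i a, anc n (par l) i a -> a < n ->
    exists2 h, h <= 2 * d & climb E h i a.
  by apply: top_down; rewrite addn0.
elim: d l => [|d IH] l dl {}i {}a ia lta.
  exists 0 => //; rewrite add0n in dl; rewrite dl in ia.
  rewrite (anc_isolated _ ia) //; first exact: ClimbNil.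
have ltl : l < J by lia.
have {}IH := IH l.+1 ltac:(lia).
have inE_ j x : x \in vertex_edges n sel bel top l j -> j < n -> x.1 = j -> x \in E.
  by case: x => b c jx ltj /= e; rewrite e in jx *; apply/mem_all_edges; exists l.

(* A selected start does without the edge to [top], whence an odd bound with one edge for this
   round. *)
have up x : x < n -> sel l x -> anc n (par l) x a ->
    exists2 h, h <= (2 * d).+1 & climb E h x a.
  move=> ltx sx xa; have [ltb xb] := hop_up_sel (steps ltl) xa lta sx.
  have [h leh xh] := IH _ _ xb ltb.
  have [sa|sa] := boolP (sel l a).
    by exists h; [lia|move: xh; rewrite /branch sa].
  exists (h + 1); first by lia.
  have ba : branch (bel l) (sel l) a = bel l a by rewrite /branch (negbTE sa).
  apply: climb_trans xh _; apply: ClimbCons (ClimbNil _ _).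
    have sb := branch_sel (steps ltl) lta ltb.
    have := anc_leq (ls_forest (steps ltl)) (anc_branch (steps ltl) lta ltb).
    by rewrite leq_eqVlt => /orP[/eqP e|//]; rewrite -e sb in sa.
  rewrite ba; apply/orP; right; apply: (inE_ a) => //.
  by apply: vertex_edges_bel => //; rewrite -ba.
have lti : i < n by have := anc_leq (ls_forest (steps ltl)) ia; lia.
have [si|si] := boolP (sel l i).
  by have [h leh ch] := up i lti si ia; exists h => //; lia.
case: (hop_up_unsel (steps ltl) ia lta si) => [ia'|[ltt st ta]].
  by have [h leh ch] := IH _ _ ia' lta; exists h => //; lia.
have [h leh ch] := up _ ltt st ta; exists h.+1; first by lia.
apply: ClimbCons ch; first by have := top_bound (steps ltl) lti; lia.
by apply/orP; left; apply: (inE_ i) => //; exact: vertex_edges_top.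
Qed.

(** An edge whose ends have equal selection bits survives into the next forest; otherwise its
    selected end is a boundary vertex of the other. No edge survives the last round, so the second
    case must occur. *)
Lemma par_edge_boundary l c : l <= J -> c < n -> par l c < n ->
  boundary c (par l c) \/ boundary (par l c) c.
Proof.
move=> lel; have [d] := ubnP (J - l); elim: d l lel => // d IH l lel ltd ltc ltp.
move: lel; rewrite leq_eqVlt => /orP[/eqP e|ltl].
  by move: ltp; rewrite e last_par // ltnn.
have sp_top : sel l (par l c) -> top l c = par l c.
  by move=> sp; rewrite (ls_top (steps ltl)) // sp.
have next : par l.+1 c = par l c -> boundary c (par l c) \/ boundary (par l c) c.
  by move=> e; rewrite -e; apply: IH => //; [lia|rewrite e].
have [sc|sc] := boolP (sel l c); have [sp|sp] := boolP (sel l (par l c)).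
- by apply: next; rewrite (par'_sel (steps ltl)) // sp_top.
- right; split=> //; exists l => //; split=> //; right.
  have bc : br l c = c by rewrite /br /branch sc.
  have bp : br l (par l c) = c.
    have := ls_bel_uniq (steps ltl) ltc ltp; rewrite -/(br l) bc => e.
    by rewrite /br /branch (negbTE sp) e.
  by rewrite /br /cr (branch_comp_root (steps ltl)) // -/(br l) bp.
- by left; split=> //; exists l => //; split=> //; left; rewrite sp_top.
- by apply: next; rewrite (ls_par' (steps ltl)) // (negbTE sc) (negbTE sp).
Qed.

(** For different rounds, the boundary vertex of the later one shares the component of [v] in the
    earlier one, hence its boundary. Within one round, the lower and the upper boundary vertex
    become child and parent in the next forest, and [par_edge_boundary] applies. *)
Lemma boundary_clique v x y : v < n -> boundary v x -> boundary v y -> x != y ->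
  boundary x y \/ boundary y x.
Proof.
move=> ltv [ltx [l ltl [sv xv]]] [lty [l' ltl' [sv' yv]]] nxy.
have lower l1 l2 x1 x2 : l1 < l2 -> l2 < J -> x1 < n -> x2 < n ->
    ~~ sel l1 v -> ~~ sel l2 v -> x1 = top l1 v \/ x1 = br l1 (cr l1 v) ->
    x2 = top l2 v \/ x2 = br l2 (cr l2 v) -> boundary x2 x1.
  move=> lt12 ltl2 lt1 lt2 s1 s2 e1 e2.
  have [s0 c0] := boundary_comp lt12 ltl2 ltv lt2 s2 e2.
  have ltl1 : l1 < J by exact: ltn_trans lt12 ltl2.
  split=> //; exists l1 => //; rewrite -s0; split=> //.
  by case: e1 => ->; [left; apply: top_comp => //; exact: c0|right; rewrite c0].
case: (ltngtP l l') => [lt|lt|e].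
- by right; exact: lower lt ltl' ltx lty sv sv' xv yv.
- by left; exact: lower lt ltl lty ltx sv' sv yv xv.
have edge z w : z < n -> w < n -> z = br l (cr l v) -> w = top l v ->
    boundary z w \/ boundary w z.
  move=> ltz ltw ez ew; have [ltc _ tc _] := comp_rootP (steps ltl) ltv.
  have sz : sel l z by rewrite ez; apply: (branch_sel (steps ltl)) => //; rewrite -/(br l) -ez.
  have pz : par l.+1 z = w.
    rewrite (par'_sel (steps ltl)) // ez (top_branch (steps ltl)) //; last first.
      by rewrite -/(br l) -ez.
    rewrite ew; apply: top_comp => //.
    by rewrite {1}/cr (comp_rootE (steps ltl)) //; have [_ -> _ _] := comp_rootP (steps ltl) ltv.
  by rewrite -pz; apply: par_edge_boundary => //; rewrite pz.
move: yv; rewrite -e => yv; case: xv yv => ex [] ey.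
- by rewrite ex ey eqxx in nxy.
- by case: (edge y x) => //; [right|left].
- exact: edge.
- by rewrite ex ey eqxx in nxy.
Qed.

Lemma levels_treewidth (V : finType) (pos : V -> nat) (e : rel V) :
  injective pos -> (forall v, pos v < n) ->
  (forall u v, e u v -> ((pos u, pos v) \in E) || ((pos v, pos u) \in E)) ->
  treewidth e <= 2 * J.
Proof.
move=> pos_inj ltp eE.
pose N v := [set x | `[< boundary (pos v) (pos x) >]].
have NP v x : reflect (boundary (pos v) (pos x)) (x \in N v).
  by rewrite inE; exact: asboolP.
apply: (@elimination_treewidth V e N (fun v => sel_key J (pos v))).
- by move=> u v /eE /orP[] /edge_boundary b; apply/orP; [left|right]; apply/NP.
- by move=> u v /NP; exact: boundary_key.
- move=> v x y /NP vx /NP vy nxy.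
  have npq : pos x != pos y by apply: contraNneq nxy => /pos_inj->.
  by case: (boundary_clique (ltp v) vx vy npq) => b; apply/orP; [left|right]; apply/NP.
move=> v; pose s := [seq top l (pos v) | l <- iota 0 J] ++
                    [seq br l (cr l (pos v)) | l <- iota 0 J].
have -> : 2 * J = size s by rewrite size_cat !size_map size_iota; lia.
rewrite cardE -(size_map pos); apply: uniq_leq_size.
  by rewrite map_inj_uniq // enum_uniq.
move=> p /mapP[x]; rewrite mem_enum => /NP[_ [l ltl [_ ex]]] ->.
by rewrite mem_cat; apply/orP; case: ex => ->; [left|right];
  apply/mapP; exists l; rewrite ?mem_iota.
Qed.

End Levels.

(** * Rooting a tree by peeling leaves *)

Section Peeling.
Variables (V : finType) (e : rel V) (r : V).
Hypothesis e_tree : is_tree e.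

Definition out (q : seq V) (v : V) : {set V} := [set u | e v u & u \notin q].

(* [q] is obtained by repeatedly removing a leaf different from [r]. *)
Inductive peeled : seq V -> Prop :=
  | PeeledNil : peeled [::]
  | PeeledRcons q v : peeled q -> v != r -> v \notin q -> #|out q v| = 1 ->
      peeled (rcons q v).

Lemma peeled_uniq q : peeled q -> uniq q.
Proof. by elim=> // {}q v _ uq _ vq _; rewrite rcons_uniq vq. Qed.

Lemma peeled_root q : peeled q -> r \notin q.
Proof. by elim=> // {}q v _ rq nv _ _; rewrite mem_rcons inE negb_or eq_sym nv. Qed.

Lemma peeled_size q : peeled q -> size q < #|V|.
Proof.
move=> pq; have u : uniq (r :: q) by rewrite /= peeled_root // peeled_uniq.
by rewrite -[(size q).+1]/(size (r :: q)) -(card_uniqP u) max_card.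
Qed.

Let e_sym : symmetric e. Proof. by case: e_tree. Qed.
Let e_irr : irreflexive e. Proof. by case: e_tree. Qed.

Lemma outP q v u : (u \in out q v) = e v u && (u \notin q).
Proof. by rewrite inE. Qed.

Lemma card1_eq (A : {set V}) x y : #|A| = 1 -> x \in A -> y \in A -> x = y.
Proof. by move/eqP/cards1P => [z ->] /set1P-> /set1P->. Qed.

(* An interior vertex of the path, when it is peeled first, would still have two
   neighbours. *)
Lemma peeled_path q a p : peeled q -> path e a p -> uniq (a :: p) ->
  a \notin q -> last a p \notin q -> {in a :: p, forall x, x \notin q}.
Proof.
move=> pq ep up; elim: pq => // {}q v _ IH nvr vq ov.
rewrite !mem_rcons !inE !negb_or => /andP[nav aq] /andP[nlv lq].
have {}IH := IH aq lq => x xp; rewrite mem_rcons inE negb_or IH // andbT.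
apply/eqP => exv; rewrite exv {x exv} in xp.
move: xp; rewrite inE eq_sym (negbTE nav) /= => vp.
case/splitPr: vp => p1 [|y p2] in ep up nlv lq IH *.
  by rewrite last_cat /= eqxx in nlv.
move: ep; rewrite cat_path /= => /and4P[_ e1 e2 _].
have : last a p1 = y.
  apply: (card1_eq ov); rewrite outP ?e2 1?e_sym ?e1 /=; apply: IH.
    by rewrite -cat_cons mem_cat mem_last.
  by rewrite -cat_cons mem_cat !inE eqxx !orbT.
move=> ey; move: up; rewrite -cat_cons cat_uniq => /and3P[_ /hasPn h _].
have /h/negP[] : y \in [:: v, y & p2] by rewrite !inE eqxx orbT.
by rewrite -ey mem_last.
Qed.

Lemma tree_path a b : exists2 p, path e a p & last a p = b /\ uniq (a :: p).
Proof.
have [_ _ _ /(_ a b)/connectP[p ep ->] _] := e_tree.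
by case/shortenP: ep => p' ep' up' _; exists p'.
Qed.

Lemma peeled_nbr q u w : peeled q -> u \notin q -> w \notin q -> u != w ->
  exists x, x \in out q u.
Proof.
move=> pq uq wq nuw; have [[|x p] ep [el up]] := tree_path u w.
  by rewrite -el eqxx in nuw.
exists x; rewrite outP; case/andP: (ep) => -> _ /=.
by apply: (peeled_path pq ep up uq); rewrite ?el // !inE eqxx orbT.
Qed.

(** Take the far end [v] of a longest simple path from [r] that avoids [q]. A further remaining
    neighbour of [v] would extend the path if it is off it, and close a cycle if it is on it. *)
Lemma peeled_leaf q u : peeled q -> u \notin q -> u != r ->
  exists v, [/\ v != r, v \notin q & #|out q v| = 1].
Proof.
move=> pq uq nur.
pose e' := [rel x y | e x y && (y \notin q)].
pose P m := `[< exists p, [/\ path e' r p, uniq (r :: p) & size p = m] >].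
have P0 : exists m, P m by exists 0; apply/asboolP; exists [::].
have Pub m : P m -> m <= #|V|.
  move/asboolP => [p [_ up <-]]; apply: leq_trans (leqnSn _) _.
  by rewrite -[(size p).+1]/(size (r :: p)) -(card_uniqP up) max_card.
case: (ex_maxnP P0 Pub) => m /asboolP[p [ep up sp]] mmax.
have [x xr] : exists x, x \in out q r.
  by apply: (peeled_nbr (w := u)) => //; [exact: peeled_root|rewrite eq_sym].
move: xr; rewrite outP => /andP[erx xq].
case/lastP: p => [|p v] in ep up sp.
  suff /mmax : P 1 by rewrite -sp.
  apply/asboolP; exists [:: x]; split=> //=; first by rewrite erx xq.
  by rewrite inE andbT; apply: contraTneq erx => ->; rewrite e_irr.
have path_e : path e r (rcons p v) by apply: sub_path ep => y z /andP[].
move: (ep); rewrite rcons_path => /andP[epp /andP[elv vq]].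
have nvr : v != r.
  by move: up; rewrite /= mem_rcons inE negb_or eq_sym => /andP[/andP[]].
have lq : last r p \notin q.
  have : all (fun y => y \notin q) p.
    elim: (p) (r) epp => //= y p' IH a /andP[/andP[_ ->]]; exact: IH.
  move/allP => h; have := mem_last r p; rewrite inE => /orP[/eqP->|/h//].
  exact: peeled_root.
exists v; split=> //; apply/eqP/cards1P; exists (last r p).
apply/setP => y; rewrite outP inE.
apply/andP/eqP => [[evy yq]|->]; last by rewrite e_sym.
have nyv : y != v by apply: contraTneq evy => ->; rewrite e_irr.
have yp : y \in r :: p.
  apply: contraT => nyp; suff /mmax : P m.+1 by rewrite ltnn.
  apply/asboolP; exists (rcons (rcons p v) y); split.
  - by rewrite rcons_path ep last_rcons /= evy yq.
  - move: up nyp; rewrite -!rcons_cons !(rcons_uniq _ y) => -> nyp.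
    by rewrite mem_rcons inE negb_or nyv nyp.
  - by rewrite size_rcons sp.
apply/eqP; apply: contraT => nyl.
case/splitPr E: (r :: p) / yp => [s1 s2].
have sort_e : sorted e (rcons (r :: p) v) by [].
have uniq_p : uniq (rcons (r :: p) v) by [].
rewrite E rcons_cat rcons_cons in sort_e uniq_p.
have [_ _ _ _ /(_ (y :: rcons s2 v))] := e_tree.
case: s2 => [|z s2] in E sort_e uniq_p *.
  have : last r (r :: p) = last r (s1 ++ [:: y]) by rewrite E.
  by rewrite last_cat /= => el; rewrite el eqxx in nyl.
rewrite /= size_rcons => /(_ isT)/negP[].
have [_ s2e] := cat_sorted2 sort_e.
move: uniq_p; rewrite cat_uniq => /and3P[_ _ u2].
rewrite /ucycleb u2 andbT -[cycle _ _]/(path e y (rcons (rcons (z :: s2) v) y)).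
by rewrite rcons_path last_rcons evy andbT; exact: s2e.
Qed.

Lemma peeled_full : exists2 q, peeled q & size q = #|V|.-1.
Proof.
suff ex k : k <= #|V|.-1 -> exists2 q, peeled q & size q = k by apply: ex.
elim: k => [|k IH] lek; first by exists [::] => //; exact: PeeledNil.
have [q pq sq] := IH (ltnW lek).
have [u uq nur] : exists2 u, u \notin q & u != r.
  have : #|[set x in r :: q]| < #|V|.
    by rewrite cardsE; apply: leq_ltn_trans (card_size _) _; rewrite /= sq -ltn_predRL.
  rewrite -cardsT => lt; have : [set x in r :: q] \proper setT by rewrite properEcard subsetT.
  case/properP => _ [u _]; rewrite !inE negb_or => /andP[nur uq]; by exists u.
have [v [nvr vq ov]] := peeled_leaf pq uq nur.
by exists (rcons q v); [exact: PeeledRcons|rewrite size_rcons sq].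
Qed.

Lemma peeled_touch q u v : peeled q -> size q = #|V|.-1 -> e u v -> (u \in q) || (v \in q).
Proof.
move=> pq sq euv; apply: contraT; rewrite negb_or => /andP[uq vq].
have all_q x : x \notin q -> x = r.
  move=> xq; apply/eqP; apply: contraT => nxr.
  have [y [nyr yq oy]] := peeled_leaf pq xq nxr.
  have := peeled_size (PeeledRcons pq nyr yq oy); rewrite size_rcons sq.
  by rewrite prednK ?ltnn //; apply/card_gt0P; exists r.
by rewrite (all_q u uq) (all_q v vq) e_irr in euv.
Qed.

(* Each edge joins a peeled vertex to its unique neighbour at that time. *)
Lemma peeled_count_edges (I : Type) (L : seq I) (ends : I -> V * V) q :
  peeled q -> size q = #|V|.-1 -> all (fun x => e (ends x).1 (ends x).2) L ->
  (forall u v, e u v ->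
     count (fun x => (ends x == (u, v)) || (ends x == (v, u))) L <= 1) ->
  size L <= size q.
Proof.
move=> pq sq eL cL.
pose touch (s : seq V) x := ((ends x).1 \in s) || ((ends x).2 \in s).
suff le : count (touch q) L <= size q.
  rewrite -(count_predT L); apply: leq_trans le; apply: eq_leq.
  elim: L eL {cL} => //= x L IH /andP[ex eL]; rewrite IH // /touch.
  by rewrite (peeled_touch pq sq ex).
elim: pq {sq} => [|{}q v pq IH nvr vq ov] /=.
  by rewrite (eq_count (a2 := pred0)) ?count_pred0 // => x; rewrite /touch !in_nil.
have [w ow] := cards1P (introT eqP ov).
have : w \in out q v by rewrite ow inE.
rewrite outP => /andP[evw _].
rewrite size_rcons -addn1; apply: leq_trans (leq_add IH (cL _ _ evw)).
rewrite -count_predUI; apply: leq_trans (leq_addr _ _).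
elim: L eL {IH cL} => //= x L IH /andP[ex eL]; apply: leq_add (IH eL).
rewrite /touch !mem_rcons !inE; case: (ends x) ex => a b /= eab.
have outw z : e v z -> z \notin q -> z = w.
  by move=> evz zq; apply/set1P; rewrite -ow outP evz.
case: (boolP (a \in q)) => aq; first by rewrite orbT.
case: (boolP (b \in q)) => bq; first by rewrite !orbT.
rewrite !orbF /= !xpair_eqE; have [ea|nav] := eqVneq a v.
  by rewrite (outw b) ?eqxx // -ea.
have [eb|nbv] := eqVneq b v; last by [].
by rewrite (outw a) ?eqxx ?orbT // -eb e_sym.
Qed.

End Peeling.

Import GRing.Theory.

(** * Peeling on arrays of degrees, neighbour sums and weight sums *)

Section PeelArrays.
Variables (R : realType) (n : nat) (T : wgraph R 'I_n) (r : 'I_n).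
Hypothesis T_tree : is_tree (adj T).
Hypothesis r0 : r = 0 :> nat.
Implicit Types (q : seq 'I_n) (Q deg nbr : nat -> nat) (rw : nat -> R).

Notation out := (out (adj T)).
Notation peeled := (peeled (adj T) r).

Definition peel_sums q deg nbr rw (v : 'I_n) : Prop :=
  [/\ deg v = #|out q v|, nbr v = \sum_(u in out q v) u
    & rw v = (\sum_(u in out q v) wt T v u)%R].

Definition peel_parent nbr rw q (v : 'I_n) : Prop :=
  exists p : 'I_n, [/\ out q v = [set p], nbr v = p & rw v = wt T v p].

(* The first [k] vertices of the queue [q] have been removed, the others are the
   current leaves. *)
Record peel_inv k q Q deg nbr rw : Prop := PeelInv {
  pi_uniq : uniq q;
  pi_root : r \notin q;
  pi_queue i : i < size q -> Q i = nth r q i;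
  pi_le : k <= size q;
  pi_peeled : peeled (take k q);
  pi_leaf v : v != r -> v \notin take k q -> (v \in q) = (#|out (take k q) v| == 1);
  pi_sums v : v \notin take k q -> peel_sums (take k q) deg nbr rw v;
  pi_parent i : i < k -> peel_parent nbr rw (take i q) (nth r q i)
}.

Lemma card_out_le q v : #|out q v| <= n.
Proof. by apply: leq_trans (max_card _) _; rewrite card_ord. Qed.

Lemma sum_out_lt q v : \sum_(u in out q v) u < n * n.
Proof.
have n0 : 0 < n by case: (r) => m; lia.
apply: (@leq_ltn_trans (\sum_(u in out q v) n.-1)).
  by apply: leq_sum => u _; have := ltn_ord u; lia.
rewrite sum_nat_const; have := card_out_le q v; nia.
Qed.

Lemma out_take_rcons q (v x : 'I_n) : out (rcons q v) x = out q x :\ v.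
Proof.
by apply/setP => y; rewrite !inE mem_rcons inE negb_or; case: (adj T x y); rewrite ?andbF ?andbT.
Qed.

(** One turn of the peeling loop. The new arrays are given up to pointwise equality, so the lemma is
    free of machine states, and its two conclusions match the two outcomes of the test whether [p]
    joins the queue. *)
Lemma peel_step k q Q deg nbr rw :
  peel_inv k q Q deg nbr rw -> k < n.-1 ->
  exists v p : 'I_n,
  [/\ k < size q, Q k = v, nbr v = p, v != p & peel_sums (take k q) deg nbr rw p] /\
  forall deg' nbr' rw',
    deg' =1 (fun j => if j == p then deg p - 1 else deg j) ->
    nbr' =1 (fun j => if j == p then nbr p - v else nbr j) ->
    rw' =1 (fun j => if j == p then (rw p - rw v)%R else rw j) ->
    (deg p - 1 = 1 -> 0 < p ->
       forall Q', Q' =1 (fun j => if j == size q then (p : nat) else Q j) ->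
       peel_inv k.+1 (rcons q p) Q' deg' nbr' rw') /\
    (~~ ((deg p - 1 == 1) && (0 < p)) -> peel_inv k.+1 q Q deg' nbr' rw').
Proof.
move=> [uq rq Qq lek pk leaf sums par] ltk.
have szt : size (take k q) = k by rewrite size_takel.
have [u uk nur] : exists2 u, u \notin take k q & u != r.
  have : #|[set x in r :: take k q]| < n.
    by rewrite cardsE; apply: leq_ltn_trans (card_size _) _; rewrite /= szt; lia.
  rewrite -[ltnRHS]card_ord -cardsT => lt.
  have : [set x in r :: take k q] \proper setT by rewrite properEcard subsetT.
  case/properP => _ [u _]; rewrite !inE negb_or => /andP[nur uq']; by exists u.
(* The queue cannot run empty: a leaf other than [r] remains, and all such leaves are queued. *)
have ltkq : k < size q.
  rewrite ltn_neqAle lek andbT; apply/eqP => ek.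
  have [v [nvr vk ov]] := peeled_leaf T_tree pk uk nur.
  by have := leaf v nvr vk; rewrite ov eqxx => vq; rewrite ek take_size vq in vk.
pose v := nth r q k.
have takeS : take k.+1 q = rcons (take k q) v by rewrite (take_nth r).
have vq : v \in q by rewrite mem_nth.
have nvr : v != r by apply: contraNneq rq => <-.
have vk : v \notin take k q.
  by have := take_uniq k.+1 uq; rewrite takeS rcons_uniq => /andP[].
have ov : #|out (take k q) v| = 1 by apply/eqP; rewrite -leaf.
have [p op] := cards1P (introT eqP ov).
have : p \in out (take k q) v by rewrite op inE.
rewrite outP => /andP[evp pkq].
have epv : adj T p v by rewrite adj_sym.
have nvp : v != p by apply: contraTneq evp => ->; rewrite adj_irr.
have [_ nv rv] := sums v vk; rewrite op big_set1 in nv; rewrite op big_set1 in rv.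
have pk1 : peeled (take k.+1 q) by rewrite takeS; exact: PeeledRcons.
have pk1q : p \notin take k.+1 q by rewrite takeS mem_rcons inE negb_or eq_sym nvp.
have vop : v \in out (take k q) p by rewrite outP epv.
have cardp : #|out (take k q) p| = #|out (take k.+1 q) p|.+1.
  by rewrite takeS out_take_rcons (cardsD1 v) vop.
have outx x : x \notin take k q -> x != p -> out (take k.+1 q) x = out (take k q) x.
  move=> xk nxp; rewrite takeS out_take_rcons; apply/setP => y; rewrite in_setD1.
  have [->|//] := eqVneq y v; rewrite /= outP; apply/esym/negbTE; apply: contra nxp.
  move=> /andP[exv _]; rewrite -in_set1 -op outP xk andbT adj_sym //.
(* Even without [v] the vertex [p] has a neighbour left, so it was no leaf before and is not queued
   twice. *)
have pgt1 : p != r -> p \notin q.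
  move=> npr; rewrite leaf // cardp eqSS -leqn0 -ltnNge.
  have rk1 : r \notin take k.+1 q by apply: contra rq; exact: mem_take.
  have [x xo] := peeled_nbr T_tree pk1 pk1q rk1 npr.
  by apply/card_gt0P; exists x.
exists v, p; split.
  by split=> //; [rewrite Qq|exact: sums].
move=> deg' nbr' rw' deg'E nbr'E rw'E.
have [dp np rp] := sums p pkq.
have sums' x : x \notin take k.+1 q -> peel_sums (take k.+1 q) deg' nbr' rw' x.
  move=> xk1; have xk : x \notin take k q.
    by move: xk1; rewrite takeS mem_rcons inE negb_or => /andP[].
  rewrite /peel_sums deg'E nbr'E rw'E.
  have [ex|nxp] := eqVneq x p; last first.
    rewrite outx // [_ == _ :> nat](negbTE nxp); exact: sums.
  rewrite ex eqxx takeS out_take_rcons; split.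
  - by rewrite dp (cardsD1 v) vop /= add1n subn1.
  - rewrite np (bigD1 v) //= addKn; apply: eq_bigl => y; rewrite !inE andbC //.
  - rewrite rp rv (bigD1 v) //= (wt_sym evp) [LHS]addrC addrA addNr add0r.
    by apply: eq_bigl => y; rewrite !inE andbC.
(* Removed vertices keep their sums, since the only vertex updated is [p], which is still
   present. *)
have par' i : i < k.+1 -> peel_parent nbr' rw' (take i q) (nth r q i).
  move=> lti; have ltiq : i < size q by exact: leq_trans lti ltkq.
  have nip : nth r q i != p.
    apply: contraNneq pk1q => <-; rewrite -(nth_take _ lti); apply: mem_nth.
    by rewrite size_takel.
  have parent : peel_parent nbr rw (take i q) (nth r q i).
    move: lti; rewrite ltnS leq_eqVlt => /orP[/eqP->|/par//].
    by exists p.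
  have [y [oy ny ry]] := parent; exists y; rewrite nbr'E rw'E.
  by rewrite -val_eqE /= in nip; rewrite (negbTE nip).
split=> [d1 p0 Q' Q'E|nd].
  have npr : p != r by rewrite -val_eqE /= r0 -lt0n.
  have tk1 : take k.+1 (rcons q p) = take k.+1 q by rewrite -cats1 takel_cat.
  split; rewrite ?tk1 //.
  - by rewrite rcons_uniq uq pgt1.
  - by rewrite mem_rcons inE negb_or eq_sym npr.
  - move=> i; rewrite size_rcons ltnS nth_rcons Q'E leq_eqVlt => /orP[/eqP->|lti].
      by rewrite ltnn eqxx.
    by rewrite lti ltn_eqF // Qq.
  - by rewrite size_rcons; exact: ltnW.
  - move=> x nxr xk1; rewrite mem_rcons inE.
    have xk : x \notin take k q.
      by move: xk1; rewrite takeS mem_rcons inE negb_or => /andP[].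
    have [ex|nxp] := eqVneq x p; last by rewrite outx // leaf.
    by apply/esym/eqP; rewrite ex; move: d1; rewrite dp cardp subn1.
  - move=> i lti; rewrite nth_rcons (leq_trans lti ltkq).
    by rewrite -cats1 takel_cat; [exact: par'|exact: ltnW (leq_trans lti ltkq)].
split=> // x nxr xk1.
have xk : x \notin take k q.
  by move: xk1; rewrite takeS mem_rcons inE negb_or => /andP[].
have [ex|nxp] := eqVneq x p; last by rewrite outx // leaf.
rewrite ex in nxr *; rewrite (negbTE (pgt1 nxr)); apply/esym/negbTE.
move: nd; rewrite negb_and -leqNgt leqn0 dp cardp subn1 /= => /orP[//|/eqP p0].
by move: nxr; rewrite -val_eqE /= r0 p0.
Qed.

Lemma peel_end q Q deg nbr rw : peel_inv n.-1 q Q deg nbr rw ->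
  size q = n.-1 /\ peeled q.
Proof.
move=> [uq rq _ lek pk _ _ _].
have szq : size q = n.-1.
  apply/eqP; rewrite eqn_leq lek andbT.
  have : size (r :: q) <= n.
    by rewrite -[n in _ <= n]card_ord -(card_uniqP _) ?max_card //= rq uq.
  by rewrite /=; lia.
by split=> //; rewrite -szq take_size in pk.
Qed.

(* [o] lists the vertices from the leaves to the root, [par] is the parent
   function on the positions in [o] and [D] is the distance to the root. *)
Record rooted_order (o : seq 'I_n) (par : nat -> nat) (D : nat -> R) : Prop :=
  RootedOrder {
  ro_size : size o = n;
  ro_uniq : uniq o;
  ro_forest : is_forest n par;
  ro_last i : i < n -> par i = n -> i = n.-1;
  ro_adj i : i < n -> par i < n ->
    adj T (nth r o i) (nth r o (par i)) /\
    D i = (D (par i) + wt T (nth r o i) (nth r o (par i)))%R;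
  ro_edge u v : adj T u v -> par (index u o) = index v o \/ par (index v o) = index u o
}.

Lemma peel_order q Q deg nbr rw (o := rcons q r) : peel_inv n.-1 q Q deg nbr rw ->
  [/\ size o = n, uniq o & forall x, x \in o].
Proof.
move=> inv; have [szq pq] := peel_end inv.
have n0 : 0 < n by case: (r) => m; lia.
have szo : size o = n by rewrite size_rcons szq prednK.
have uo : uniq o by rewrite rcons_uniq (pi_root inv) (pi_uniq inv).
split=> // x.
have sub : {subset o <= enum 'I_n} by move=> y _; rewrite mem_enum.
have le : size (enum 'I_n) <= size o by rewrite size_enum_ord szo.
by have [_ ->] := uniq_min_size uo sub le; rewrite mem_enum.
Qed.

Lemma peel_order_parent q Q deg nbr rw i (o := rcons q r) :
  peel_inv n.-1 q Q deg nbr rw -> i < n.-1 ->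
  exists p : 'I_n, [/\ out (take i o) (nth r o i) = [set p], i < index p o,
    adj T (nth r o i) p, nbr (nth r o i) = p & rw (nth r o i) = wt T (nth r o i) p].
Proof.
move=> inv lti; have [szq pq] := peel_end inv; have [szo uo memo] := peel_order inv.
have nth_o : nth r o i = nth r q i by rewrite nth_rcons szq lti.
have take_o : take i o = take i q by rewrite /o -cats1 takel_cat // szq ltnW.
have [p [op np rp]] := pi_parent inv lti.
have : p \in out (take i q) (nth r q i) by rewrite op inE.
rewrite outP => /andP[ep pt].
exists p; rewrite nth_o take_o; split=> //.
rewrite ltnNge; apply/negP => lei.
move: lei; rewrite leq_eqVlt => /orP[/eqP e|lt].
  have := nth_index r (memo p); rewrite e -/o nth_o => e'.
  by rewrite -e' adj_irr in ep.
move: pt => /negP[]; rewrite -take_o -(nth_index r (memo p)) -(nth_take _ lt).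
by apply: mem_nth; rewrite size_takel // szo; lia.
Qed.

Lemma rooted_of_peel q Q deg nbr rw (par : nat -> nat) (D : nat -> R)
    (o := rcons q r) :
  peel_inv n.-1 q Q deg nbr rw -> par n.-1 = n ->
  (forall i (p : 'I_n), i < n.-1 -> nbr (nth r o i) = p ->
     par i = index p o /\ D i = (D (index p o) + rw (nth r o i))%R) ->
  rooted_order o par D.
Proof.
move=> inv parn parE; have [szo uo memo] := peel_order inv.
have n0 : 0 < n by case: (r) => m; lia.
have parent i : i < n.-1 -> exists p : 'I_n,
    [/\ out (take i o) (nth r o i) = [set p], par i = index p o,
       i < index p o, adj T (nth r o i) p & D i = (D (par i) + wt T (nth r o i) p)%R].
  move=> lti; have [p [op ltp ep np rp]] := peel_order_parent inv lti.
  by have [pi Di] := parE i p lti np; exists p; rewrite Di pi rp.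
have idxn x : index x o < n by apply: leq_trans (eq_leq szo); rewrite index_mem.
split=> //.
- move=> i lti; have [lti'|lei] := ltnP i n.-1.
    by have [p [_ -> lt _ _]] := parent i lti'; rewrite lt /=; exact: ltnW.
  by have -> : i = n.-1; [lia|rewrite parn; lia].
- move=> i lti pn; apply/eqP; apply: contraT => ne.
  have [|p [_ e _ _ _]] := parent i; first by lia.
  by have := idxn p; rewrite -e pn ltnn.
- move=> i lti ltp; have lti' : i < n.-1.
    have [//|lei] := ltnP i n.-1.
    have e : i = n.-1 by lia.
    by move: ltp; rewrite e parn ltnn.
  by have [p [_ e _ ep Dp]] := parent i lti'; rewrite e nth_index -?e.
move=> u v euv.
(* When the earlier end of an edge is removed, the later end is still present, so it is the unique
   remaining neighbour. *)
have lower x y : adj T x y -> index x o < index y o -> par (index x o) = index y o.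
  move=> exy ltxy; have ltx : index x o < n.-1.
    by apply: leq_trans ltxy _; rewrite -ltnS prednK.
  have [p [op -> _ _ _]] := parent _ ltx.
  congr index; apply/esym/set1P; rewrite -op nth_index // outP exy /=.
  by apply/negP => yt; have := index_ltn yt; rewrite ltnNge (ltnW ltxy).
case: (ltngtP (index u o) (index v o)) => [lt|lt|e].
- by left; apply: lower.
- by right; apply: lower; rewrite // adj_sym.
- by move: euv; rewrite -(nth_index r (memo u)) e nth_index // adj_irr.
Qed.

Lemma edge_list_size (L : seq ('I_n * 'I_n * R)) : edge_list T L -> size L <= n.-1.
Proof.
move=> [eL cL]; have [q pq sq] := peeled_full r T_tree.
rewrite card_ord in sq; rewrite -sq.
apply: (peeled_count_edges T_tree (ends := fst) pq); first by rewrite sq card_ord.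
  by apply/allP => -[[a b] w] /eL[].
by move=> u v euv; rewrite cL.
Qed.

(** Stated over a commutative monoid to serve for degrees, sums of neighbours and sums of weights
    alike. An edge at [v] is listed once, in an unknown orientation, so both ends of each entry are
    tested. *)
Lemma edge_list_sum (M : Type) (idx : M) (op : Monoid.com_law idx)
    (L : seq ('I_n * 'I_n * R)) (f : 'I_n -> M) v : edge_list T L ->
  \big[op/idx]_(x <- L) op (if x.1.1 == v then f x.1.2 else idx)
                           (if x.1.2 == v then f x.1.1 else idx)
  = \big[op/idx]_(u | adj T v u) f u.
Proof.
move=> [eL cL].
pose ends (u : 'I_n) (x : 'I_n * 'I_n * R) := (x.1 == (v, u)) || (x.1 == (u, v)).
transitivity (\big[op/idx]_(x <- L) \big[op/idx]_(u | adj T v u) (if ends u x then f u else idx)).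
  apply: eq_big_seq => -[[a b] w] /eL[eab _]; rewrite /ends /=.
  have [ea|nav] := eqVneq a v.
    have nbv : (b == v) = false.
      by apply/negbTE; apply: contraTneq eab => ->; rewrite ea adj_irr.
    rewrite nbv Monoid.mulm1 (bigD1 b) /=; last by rewrite -ea.
    rewrite ea eqxx big1 ?Monoid.mulm1 // => u /andP[_ nub].
    by rewrite !xpair_eqE eqxx nbv andbF orbF eq_sym (negbTE nub).
  rewrite Monoid.mul1m; have [eb|nbv] := eqVneq b v.
    rewrite (bigD1 a) /=; last by rewrite -eb adj_sym.
    rewrite eb eqxx orbT big1 ?Monoid.mulm1 // => u /andP[_ nua].
    by rewrite !xpair_eqE eqxx (negbTE nav) andbT /= eq_sym (negbTE nua).
  by rewrite big1 // => u _; rewrite !xpair_eqE (negbTE nav) (negbTE nbv) andbF.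
rewrite exchange_big /=; apply: eq_bigr => u evu.
rewrite -big_mkcond big_const_seq cL //=; exact: Monoid.mulm1.
Qed.

End PeelArrays.

(** * The program *)

(* Int arrays [a*], real arrays [r*]; the scalar [v*] is entry 0 of its own array. *)
Local Notation aDeg := 3 (only parsing).
Local Notation aNbr := 4 (only parsing).
Local Notation aQ := 5 (only parsing).
Local Notation aPos := 6 (only parsing).
Local Notation aPar := 7 (only parsing).
Local Notation aCnt := 8 (only parsing).
Local Notation aBel := 9 (only parsing).
Local Notation aMul := 10 (only parsing).
Local Notation aSel := 11 (only parsing).
Local Notation aTop := 12 (only parsing).
Local Notation aThr := 13 (only parsing).
Local Notation vI := 14 (only parsing).
Local Notation vL := 15 (only parsing).
Local Notation vJ := 16 (only parsing).
Local Notation vS := 17 (only parsing).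
Local Notation vP := 18 (only parsing).
Local Notation vB := 19 (only parsing).
Local Notation vT := 20 (only parsing).
Local Notation vV := 21 (only parsing).
Local Notation rRw := 1 (only parsing).
Local Notation rD := 2 (only parsing).

Notation "c1 ;; c2" := (Seq c1 c2) (at level 90, right associativity).

Definition eN := ICell 0 (IConst 0).
Definition eM := ICell 0 (IConst 1).
Definition eI := ivar vI.

Definition init_cmd := For vI eN
  (IStore aDeg eI (IConst 0) ;; IStore aNbr eI (IConst 0) ;; RStore rRw eI RZero).

(* [aDeg], [aNbr] and [rRw] hold the degree, the sum of the numbers of the
   neighbours and the sum of the incident weights; for a leaf the last two are
   its neighbour and its edge weight, so no adjacency lists are needed. *)
Definition sums_cmd :=
  let u := ICell 1 eI in let v := ICell 2 eI in let w := RCell 0 eI in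
  For vI eM
  (IStore aDeg u (IAdd (ICell aDeg u) (IConst 1)) ;;
   IStore aDeg v (IAdd (ICell aDeg v) (IConst 1)) ;;
   IStore aNbr u (IAdd (ICell aNbr u) v) ;;
   IStore aNbr v (IAdd (ICell aNbr v) u) ;;
   RStore rRw u (RAdd (RCell rRw u) w) ;;
   RStore rRw v (RAdd (RCell rRw v) w)).

Ltac ev r := by rewrite /ieq /req /= /upd /= ?r.

Ltac istep i e r := first [apply: wp_seq | idtac];
  apply: (wp_istore (vi := i) (ve := e)); [ev r | ev r |].

Ltac rstep i e r := first [apply: wp_seq | idtac];
  apply: (wp_rstore (vi := i) (ve := e)); [ev r | ev r |].

Section ReadInput.
Variables (R : realType) (n : nat) (T : wgraph R 'I_n) (r : 'I_n) (W : nat).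
Hypothesis T_tree : is_tree (adj T).
Hypothesis r0 : r = 0 :> nat.
Hypothesis n3 : 2 < n.
Hypothesis W_big : 16 * (n * n) < W.
Implicit Type s : state R.

(** Recovers the body from a [For] loop, so that time bounds need not repeat it. *)
Definition body c := if c is Seq _ (While _ (Seq b _)) then b else Skip.

Lemma runs_init (L : seq ('I_n * 'I_n * R)) s : stores s L -> 
  runs W init_cmd s (for_time 2 n (cost (body init_cmd)))
    (fun s' => stores s' L /\ forall v, v < n ->
       [/\ icell s' aDeg v = 0, icell s' aNbr v = 0 & rcell s' rRw v = 0%R]).
Proof.
move=> st.
have W2 : 2 < W by clear -n3 W_big; nia.
have W1 : 1 < W by clear -W2; lia.
have W0 : 0 < W by clear -W2; lia.
apply: (runs_for (Inv := fun k s' => stores s' L /\ forall v, v < k ->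
       [/\ icell s' aDeg v = 0, icell s' aNbr v = 0 & rcell s' rRw v = 0%R]) (N := n)) => //.
- by clear -n3 W_big; nia.
- by move=> k s' lek xk [[n' _] _].
- move=> k s' ltk xk [st' z]; apply: wp_runs.
  apply: wp_seq; apply: (wp_istore (vi := k) (ve := 0)); [by []|by []|].
  apply: wp_seq; apply: (wp_istore (vi := k) (ve := 0)); [by []|by []|].
  apply: (wp_rstore (vi := k) (ve := 0%R)); [by []|by []|].
  split=> //; split=> // v; rewrite ltnS leq_eqVlt /= /upd /= => /orP[/eqP->|ltv].
    by rewrite eqxx.
  by rewrite (ltn_eqF ltv); exact: z.
Qed.

Lemma edge_sum_take (M : Type) (idx : M) (op : Monoid.com_law idx)
    (L : seq ('I_n * 'I_n * R)) (f : 'I_n -> M) v k a b w :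
  onth L k = Some (a, b, w) ->
  \big[op/idx]_(x <- take k.+1 L) op (if x.1.1 == v then f x.1.2 else idx)
                           (if x.1.2 == v then f x.1.1 else idx) =
  op (\big[op/idx]_(x <- take k L) op (if x.1.1 == v then f x.1.2 else idx)
                           (if x.1.2 == v then f x.1.1 else idx))
     (op (if a == v then f b else idx) (if b == v then f a else idx)).
Proof.
move=> e; have ltk : k < size L by rewrite -onthTE e.
rewrite (take_nth (a, b, w)) // -cats1 big_cat big_seq1 /=.
by rewrite -odflt_onth e.
Qed.

Lemma runs_sums (L : seq ('I_n * 'I_n * R)) s : edge_list T L -> stores s L ->
  (forall v, v < n ->
       [/\ icell s aDeg v = 0, icell s aNbr v = 0 & rcell s rRw v = 0%R]) ->
  runs W sums_cmd s (for_time 2 (size L) (cost (body sums_cmd)))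
    (fun s' => icell s' 0 0 = n /\
       forall v, peel_sums T [::] (icell s' aDeg) (icell s' aNbr) (rcell s' rRw) v).
Proof.
move=> eL st z.
have W1 : 1 < W by clear -n3 W_big; nia.
have W0 : 0 < W by clear -W1; lia.
have lem := edge_list_size r T_tree eL.
pose dsum k v := \sum_(x <- take k L)
  ((if x.1.1 == v then 1 else 0) + (if x.1.2 == v then 1 else 0)).
pose nsum k v := \sum_(x <- take k L)
  ((if x.1.1 == v then nat_of_ord x.1.2 else 0) + (if x.1.2 == v then nat_of_ord x.1.1 else 0)).
pose wsum k v := (\sum_(x <- take k L)
  ((if x.1.1 == v then wt T v x.1.2 else 0) + (if x.1.2 == v then wt T v x.1.1 else 0)))%R.
(* The last two bounds of the invariant exclude overflow: [k] stays below [n], hence the sums below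
   [2 * n * n]. *)
apply: (runs_for (Inv := fun k s' => stores s' L /\ forall v : 'I_n,
       [/\ icell s' aDeg v = dsum k v, icell s' aNbr v = nsum k v,
          rcell s' rRw v = wsum k v, icell s' aDeg v <= 2 * k
        & icell s' aNbr v <= 2 * k * n]) (N := size L)).
- by clear -n3 W_big lem; nia.
- split=> // v; have [d0 m0 w0] := z v (ltn_ord v).
  by rewrite /dsum /nsum /wsum take0 !big_nil /= /upd /= d0 m0 w0.
- by move=> k s' lek xk [[_ m' _] _]; split.
- move=> k s' ltk xk [st' inv]; apply: wp_runs.
  have [_ _ stk] := st'.
  have : onth L k by rewrite onthTE.
  case E: (onth L k) => [[[a b] w]|//] _.
  have [ak bk wk] := stk k a b w E.
  have [eab ew] : adj T a b /\ w = wt T a b.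
    by apply: eL.1; apply/onthP; exists k.
  have nab : (a == b :> nat) = false.
    by apply/negbTE; apply: contraTneq eab => /ord_inj->; rewrite adj_irr.
  have nba : (b == a :> nat) = false by rewrite eq_sym.
  have [da na wa dale nale] := inv a; have [db nb wb dble nble] := inv b.
  have lta := ltn_ord a; have ltb := ltn_ord b.
  have b1 : icell s' 3 a + 1 < W by clear -lem ltk dale dble nale nble lta ltb n3 W_big; nia.
  have b2 : icell s' 3 b + 1 < W by clear -lem ltk dale dble nale nble lta ltb n3 W_big; nia.
  have b3 : icell s' 4 a + b < W by clear -lem ltk dale dble nale nble lta ltb n3 W_big; nia.
  have b4 : icell s' 4 b + a < W by clear -lem ltk dale dble nale nble lta ltb n3 W_big; nia.
  istep (a : nat) (icell s' 3 a + 1) (xk, ak, bk, wk, nab, nba).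
  istep (b : nat) (icell s' 3 b + 1) (xk, ak, bk, wk, nab, nba).
  istep (a : nat) (icell s' 4 a + b) (xk, ak, bk, wk, nab, nba).
  istep (b : nat) (icell s' 4 b + a) (xk, ak, bk, wk, nab, nba).
  rstep (a : nat) ((rcell s' 1 a + w)%R) (xk, ak, bk, wk, nab, nba).
  rstep (b : nat) ((rcell s' 1 b + w)%R) (xk, ak, bk, wk, nab, nba).
  split=> //; split=> // v.
  have -> : dsum k.+1 v = dsum k v + ((if a == v then 1 else 0) + (if b == v then 1 else 0)).
    exact: (edge_sum_take addn (fun=> 1) v E).
  have -> : nsum k.+1 v = nsum k v +
      ((if a == v then nat_of_ord b else 0) + (if b == v then nat_of_ord a else 0)).
    exact: (edge_sum_take addn (@nat_of_ord n) v E).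
  have -> : wsum k.+1 v = (wsum k v +
      ((if a == v then wt T v b else 0) + (if b == v then wt T v a else 0)))%R.
    exact: (edge_sum_take +%R (wt T v) v E).
  have [dv nv wv dvle nvle] := inv v.
  have bd x : x <= 2 * k -> x + 1 <= 2 * k.+1 by clear; lia.
  have bn x y : x <= 2 * k * n -> y < n -> x + y <= 2 * k.+1 * n by clear; nia.
  rewrite /= /upd /= -!(inj_eq val_inj) /= ![nat_of_ord v == _]eq_sym.
  case: (eqVneq (nat_of_ord b) v) => [eb|nb'].
    move/ord_inj: eb => eb; subst v; rewrite nab.
    by rewrite ew (wt_sym eab) add0r !add0n -db -nb -wb; split=> //; [exact: bd|exact: bn].
  case: (eqVneq (nat_of_ord a) v) => [ea|na'].
    move/ord_inj: ea => ea; subst v.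
    by rewrite ew addr0 !addn0 -da -na -wa; split=> //; [exact: bd|exact: bn].
  rewrite !addr0 !addn0 -dv -nv -wv; split=> //; first by move: dvle; clear; lia.
  by move: nvle; clear; nia.
move=> s' [[n' _ _] inv]; split=> // v.
have [dv nv wv _ _] := inv v.
have outE : (fun u => u \in out (adj T) [::] v) =1 adj T v by move=> u; rewrite outP andbT.
split.
- rewrite dv /dsum take_size (edge_list_sum addn (fun=> 1) v eL) /= sum1_card.
  by apply: eq_card => u; rewrite outE.
- rewrite nv /nsum take_size (edge_list_sum addn (@nat_of_ord n) v eL) /=.
  by apply: eq_bigl => u; rewrite outE.
- rewrite wv /wsum take_size (edge_list_sum +%R (wt T v) v eL) /=.
  by apply: eq_bigl => u; rewrite outE.
Qed.

End ReadInput.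

(** * Rooting the tree by program *)

Definition incr x := iset x (IAdd (ivar x) (IConst 1)).

Definition leaves_cmd :=
  iset vT (IConst 0) ;;
  For vI eN
    (If (ILt (IConst 0) eI)
       (If (IEq (ICell aDeg eI) (IConst 1)) (IStore aQ (ivar vT) eI ;; incr vT) Skip)
       Skip).

Definition peel_cmd :=
  let v := ivar vV in let p := ivar vP in
  For vI (ISub eN (IConst 1))
    (iset vV (ICell aQ eI) ;;
     iset vP (ICell aNbr v) ;;
     IStore aDeg p (ISub (ICell aDeg p) (IConst 1)) ;;
     IStore aNbr p (ISub (ICell aNbr p) v) ;;
     RStore rRw p (RSub (RCell rRw p) (RCell rRw v)) ;;
     If (ILt (IConst 0) p)
       (If (IEq (ICell aDeg p) (IConst 1)) (IStore aQ (ivar vT) p ;; incr vT) Skip)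
       Skip).

(** The root 0 is never queued, so it is appended as the last vertex before the positions are
    computed. *)
Definition pos_cmd :=
  IStore aQ (ISub eN (IConst 1)) (IConst 0) ;;
  For vI eN (IStore aPos (ICell aQ eI) eI).

(* From here on a vertex is represented by its position in [aQ]. *)
Definition par_cmd :=
  let j := ISub (ISub eN (IConst 2)) eI in let p := ivar vP in
  IStore aPar (ISub eN (IConst 1)) eN ;;
  RStore rD (ISub eN (IConst 1)) RZero ;;
  For vI (ISub eN (IConst 1))
    (iset vP (ICell aPos (ICell aNbr (ICell aQ j))) ;;
     IStore aPar j p ;;
     RStore rD j (RAdd (RCell rD p) (RCell rRw (ICell aQ j)))).

(* [aThr] lists the thresholds up to [n]; the loop has [n] turns only to avoid a
   second kind of loop, most of them do nothing. *)
Definition thr_cmd :=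
  iset vS (IConst 2) ;; iset vJ (IConst 0) ;;
  For vI eN
    (If (ILt (ivar vS) (IAdd eN (IConst 1)))
       (IStore aThr (ivar vJ) (ivar vS) ;;
        iset vS (IDiv (IMul (ivar vS) (IAdd (ivar vS) (IConst 1))) (IConst 2)) ;;
        incr vJ)
       Skip).

(* Chosen so that [desc_step] turns trees with fewer than [threshold i.+1]
   vertices into trees with fewer than [threshold i]. *)
Fixpoint threshold i := if i is j.+1 then (threshold j * (threshold j).+1) %/ 2 else 2.

Lemma thresholdS i : 2 * threshold i.+1 = threshold i * (threshold i).+1.
Proof. by rewrite /= mulnC divnK // dvdn2 oddM /= andbN. Qed.

Lemma threshold_gt i : i.+1 < threshold i.
Proof. by elim: i => // i IH; have := thresholdS i; nia. Qed.

Lemma ltnS_eqVlt i k : (i < k.+1) = (i == k) || (i < k).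
Proof. by rewrite ltnS leq_eqVlt. Qed.

Definition leaves_time n := ((cost (iset vT (IConst 0))) +
  for_time 2 n (cost (body (For vI eN (If (ILt (IConst 0) eI)
       (If (IEq (ICell aDeg eI) (IConst 1)) (IStore aQ (ivar vT) eI ;; incr vT) Skip)
       Skip))))).+1.

Definition pos_time n := ((cost (IStore aQ (ISub eN (IConst 1)) (IConst 0))) +
      for_time 2 n (cost (IStore aPos (ICell aQ eI) eI))).+1.

Definition par_time n := ((cost (IStore aPar (ISub eN (IConst 1)) eN)) +
    ((cost (RStore rD (ISub eN (IConst 1)) RZero)) +
     for_time 4 n.-1 (cost (body (For vI eN
    (let j := ISub (ISub eN (IConst 2)) eI in let p := ivar vP in
     iset vP (ICell aPos (ICell aNbr (ICell aQ j))) ;;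
     IStore aPar j p ;;
     RStore rD j (RAdd (RCell rD p) (RCell rRw (ICell aQ j)))))))).+1).+1.

Definition thr_time n := ((cost (iset vS (IConst 2))) + ((cost (iset vJ (IConst 0))) +
    for_time 2 n (cost (body (For vI eN (If (ILt (ivar vS) (IAdd eN (IConst 1)))
       (IStore aThr (ivar vJ) (ivar vS) ;;
        iset vS (IDiv (IMul (ivar vS) (IAdd (ivar vS) (IConst 1))) (IConst 2)) ;;
        incr vJ) Skip))))).+1).+1.

Section Rooting.
Variables (R : realType) (n : nat) (T : wgraph R 'I_n) (r : 'I_n) (W : nat).
Hypothesis T_tree : is_tree (adj T).
Hypothesis r0 : r = 0 :> nat.
Hypothesis n3 : 2 < n.
Hypothesis W_big : 16 * (n * n) < W.
Implicit Type s : state R.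

Let W0 : 0 < W. Proof. by clear -n3 W_big; nia. Qed.
Let W1 : 1 < W. Proof. by clear -n3 W_big; nia. Qed.
Let W2 : 2 < W. Proof. by clear -n3 W_big; nia. Qed.
Let W3 : n.+2 < W. Proof. by clear -n3 W_big; nia. Qed.

Let size_uniq (q : seq 'I_n) : uniq q -> size q <= n.
Proof. by move/card_uniqP <-; rewrite -[leqRHS]card_ord max_card. Qed.

Lemma runs_leaves s : icell s 0 0 = n ->
  (forall v, peel_sums T [::] (icell s aDeg) (icell s aNbr) (rcell s rRw) v) ->
  runs W leaves_cmd s (leaves_time n)
    (fun s' => icell s' 0 0 = n /\ exists q, icell s' vT 0 = size q /\
       peel_inv T r 0 q (icell s' aQ) (icell s' aDeg) (icell s' aNbr) (rcell s' rRw)).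
Proof.
move=> n0 sums.
apply: runs_seq; apply: wp_runs; istep 0 0 n0.
pose Inv k s' := icell s' 0 0 = n /\
  (forall v, peel_sums T [::] (icell s' aDeg) (icell s' aNbr) (rcell s' rRw) v) /\
  exists q, [/\ icell s' vT 0 = size q, uniq q,
    (forall i, i < size q -> icell s' aQ i = nth r q i)
    & forall v : 'I_n, (v \in q) = [&& v < k, 0 < v & icell s' aDeg v == 1]].
apply: (runs_for (Inv := Inv) (N := n)).
- by apply: ltn_trans W3.
- by split=> //; split=> //; exists [::]; split=> // v; rewrite in_nil ltn0.
- by move=> k s' _ _ [].
- move=> k s' ltk xk [nn [sm [q [tq uq Qq qE]]]]; apply: wp_runs.
  have keep : (0 < k) && (icell s' aDeg k == 1) = false ->
      icell s' vI 0 = k /\ Inv k.+1 (set_ivar s' vI k.+1).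
    move=> no; split=> //; split=> //; split=> //; exists q; split=> // v.
    rewrite qE ltnS_eqVlt /= /upd /=; case: (eqVneq (v : nat) k) => [->|//].
    by rewrite ltnn no.
  apply: (wp_ilt (v1 := 0) (v2 := k)); [ev xk|ev xk|].
  case: ifP => k0; last by apply: keep; rewrite k0.
  apply: (wp_ieq (v1 := icell s' aDeg k) (v2 := 1)); [ev xk|ev xk|].
  case: ifP => dk; last by apply: keep; rewrite k0 dk.
  pose v := Ordinal ltk.
  have vq : v \notin q by rewrite qE /= ltnn.
  have lts : size q < n by apply: (@size_uniq (v :: q)); rewrite /= vq.
  have tW : size q + 1 < W by clear -lts W3; lia.
  istep (size q) k (xk, tq); istep 0 (size q + 1) (xk, tq).
  split=> //; split=> //; split=> //; exists (rcons q v); split=> //.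
  + by rewrite /= /upd /= size_rcons addn1.
  + by rewrite rcons_uniq vq.
  + move=> i; rewrite size_rcons ltnS leq_eqVlt nth_rcons /= /upd /=.
    case/orP => [/eqP->|lti]; first by rewrite ltnn eqxx.
    by rewrite lti (ltn_eqF lti) Qq.
  + move=> u; rewrite mem_rcons inE qE ltnS_eqVlt /= /upd /= -val_eqE /=.
    by case: (eqVneq (u : nat) k) => [->|//]; rewrite k0 dk.
move=> s' [nn [sm [q [tq uq Qq qE]]]]; split=> //; exists q; split=> //; split=> //.
- by rewrite qE r0 ltnn andbF.
- by rewrite take0; exact: PeeledNil.
- move=> v nvr _; rewrite take0 qE ltn_ord; have [<- _ _] := sm v.
  by rewrite lt0n; move: nvr; rewrite -val_eqE /= r0 => ->.
- by move=> v _; rewrite take0.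
Qed.

Lemma runs_peel s q0 : icell s 0 0 = n -> icell s vT 0 = size q0 ->
  peel_inv T r 0 q0 (icell s aQ) (icell s aDeg) (icell s aNbr) (rcell s rRw) ->
  runs W peel_cmd s (for_time 4 n.-1 (cost (body peel_cmd)))
    (fun s' => icell s' 0 0 = n /\ exists q,
       peel_inv T r n.-1 q (icell s' aQ) (icell s' aDeg) (icell s' aNbr) (rcell s' rRw)).
Proof.
move=> n0 tq0 inv0.
pose Inv k s' := icell s' 0 0 = n /\ exists q, icell s' vT 0 = size q /\
  peel_inv T r k q (icell s' aQ) (icell s' aDeg) (icell s' aNbr) (rcell s' rRw).
apply: (runs_for (Inv := Inv) (N := n.-1)).
- by clear -W3; lia.
- by split=> //; exists q0.
- move=> k s' _ _ [nn _]; rewrite /= nn subn1; split=> //; split=> //.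
  by clear -W3; lia.
- move=> k s' ltk xk [nn [q [tq inv]]]; apply: wp_runs.
  have [v [p [[ltkq Qk vp nvp [dp np rp]] next]]] := peel_step T_tree r0 inv ltk.
  have dle : icell s' aDeg p < W.
    by rewrite dp; have := card_out_le T (take k q) p; clear -W3; lia.
  have nle : icell s' aNbr p < W.
    by rewrite np; have := sum_out_lt T r0 (take k q) p; clear -W_big; lia.
  have tW : size q + 1 < W.
    by have := size_uniq (pi_uniq inv); clear -W3; lia.
  have nvp' : (v == p :> nat) = false by apply/negbTE.
  istep 0 (v : nat) (xk, Qk).
  istep 0 (p : nat) (xk, Qk, vp).
  istep (p : nat) (icell s' aDeg p - 1) (xk, Qk, vp).
  istep (p : nat) (icell s' aNbr p - v) (xk, Qk, vp).
  rstep (p : nat) (rcell s' rRw p - rcell s' rRw v)%R (xk, Qk, vp).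
  set s1 := State _ _.
  have [push nopush] := next (icell s1 aDeg) (icell s1 aNbr) (rcell s1 rRw)
    (fun j => erefl) (fun j => erefl) (fun j => erefl).
  have idle : ~~ ((icell s' aDeg p - 1 == 1) && (0 < p)) ->
      icell s1 vI 0 = k /\ Inv k.+1 (set_ivar s1 vI k.+1).
    by move=> /nopush np'; split=> //; split=> //; exists q.
  apply: (wp_ilt (v1 := 0) (v2 := p)); [ev xk|ev xk|].
  case: ifP => p0; last by apply: idle; rewrite p0 andbF.
  apply: (wp_ieq (v1 := icell s' aDeg p - 1) (v2 := 1)); [ev (eqxx (p : nat))|ev xk|].
  case: ifP => d1; last by apply: idle; rewrite d1.
  istep (size q) (p : nat) (xk, tq); istep 0 (size q + 1) (xk, tq).
  split=> //; split=> //; exists (rcons q p); split; first by rewrite /= /upd /= size_rcons addn1.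
  by apply: push => //; exact/eqP.
by move=> s' [nn [q' [_ inv]]]; split=> //; exists q'.
Qed.

Definition order_in s (o : seq 'I_n) := icell s 0 0 = n /\
  forall i, i < n -> icell s aQ i = nth r o i.

Lemma runs_pos s q : icell s 0 0 = n ->
  peel_inv T r n.-1 q (icell s aQ) (icell s aDeg) (icell s aNbr) (rcell s rRw) ->
  runs W pos_cmd s (pos_time n)
    (fun s' => [/\ order_in s' (rcons q r),
       forall i, i < n -> icell s' aPos (nth r (rcons q r) i) = i
       & exists Q, peel_inv T r n.-1 q Q (icell s' aDeg) (icell s' aNbr) (rcell s' rRw)]).
Proof.
move=> n0 inv; have [szo uo memo] := peel_order r0 inv.
have [szq _] := peel_end r0 inv.
have nW : n < W by clear -W3; lia.
apply: runs_seq; apply: wp_runs; istep n.-1 0 (n0, subn1).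
apply: (runs_for (Inv := fun k s' => [/\ order_in s' (rcons q r),
       forall i, i < k -> icell s' aPos (nth r (rcons q r) i) = i
       & exists Q, peel_inv T r n.-1 q Q (icell s' aDeg) (icell s' aNbr) (rcell s' rRw)])
   (N := n)) => //.
- split=> //; last by exists (icell s aQ).
  split=> // i lti; rewrite /= /upd /= nth_rcons szq.
  case: ltngtP => // [lt|gt]; last by clear -gt lti; lia.
  by rewrite (pi_queue inv) ?szq.
- by move=> k s' _ _ [[nn _] _ _].
move=> k s' ltk xk [[nn Qo] pos ex]; apply: wp_runs.
have Qk := Qo k ltk.
istep (nth r (rcons q r) k : nat) k (xk, Qk).
split=> //; split=> // i; rewrite ltnS_eqVlt /= /upd /= => /orP[/eqP->|lti].
  by rewrite eqxx.
have -> : (nth r (rcons q r) i == nth r (rcons q r) k :> nat) = false.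
  apply/negbTE; rewrite (inj_eq val_inj) nth_uniq ?szo ?(ltn_trans lti) //.
  by rewrite (ltn_eqF lti).
exact: pos.
Qed.

Lemma runs_par s q : order_in s (rcons q r) ->
  (forall i, i < n -> icell s aPos (nth r (rcons q r) i) = i) ->
  (exists Q, peel_inv T r n.-1 q Q (icell s aDeg) (icell s aNbr) (rcell s rRw)) ->
  runs W par_cmd s (par_time n)
    (fun s' => order_in s' (rcons q r) /\
       rooted_order T r (rcons q r) (icell s' aPar) (rcell s' rD)).
Proof.
set o := rcons q r => -[n0 Qo] pos [Q inv].
have [szo uo memo] := peel_order r0 inv; rewrite -/o in szo uo memo.
have nW : n < W by clear -W3; lia.
have n1W : n.-1 < W by clear -W3; lia.
apply: runs_seq; apply: wp_runs; istep n.-1 n (n0, subn1).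
apply: runs_seq; apply: wp_runs; rstep n.-1 (0%R : R) (n0, subn1).
apply: (runs_for (Inv := fun k s' => [/\ order_in s' o,
    forall i, i < n -> icell s' aPos (nth r o i) = i,
    peel_inv T r n.-1 q Q (icell s' aDeg) (icell s' aNbr) (rcell s' rRw),
    icell s' aPar n.-1 = n
    & forall i (p : 'I_n), n.-1 - k <= i < n.-1 -> icell s' aNbr (nth r o i) = p ->
     icell s' aPar i = index p o /\
     rcell s' rD i = (rcell s' rD (index p o) + rcell s' rRw (nth r o i))%R])
   (N := n.-1)) => //.
- split=> //; first by rewrite /= /upd /= eqxx.
  by move=> i p; rewrite subn0 => /andP[le lt]; rewrite ltnNge le in lt.
- move=> k s' _ _ [[nn _] _ _ _ _]; rewrite /= nn subn1; split=> //.
- move=> k s' ltk xk [[nn Qo'] pos' inv' pn pE]; apply: wp_runs.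
  set j := n.-1 - k.+1.
  have jE : n - 2 - k = j by rewrite /j; clear; lia.
  have n2W : n - 2 < W by clear -W3; lia.
  have ltj : j < n.-1 by rewrite /j; clear -ltk; lia.
  have ltjn : j < n by clear -ltj; lia.
  have [p [op ltp ep np rp]] := peel_order_parent r0 inv' ltj.
  rewrite -/o in op ltp ep np rp.
  have ltpn : index p o < n by rewrite -[ltnRHS]szo index_mem.
  have pp : icell s' aPos p = index p o by rewrite -{1}(nth_index r (memo p)) pos'.
  have Qj := Qo' j ltjn.
  istep 0 (index p o) (xk, nn, jE, Qj, np, pp).
  istep j (index p o) (xk, nn, jE).
  have rdE : (rcell s' rD (index p o) + rcell s' rRw (nth r o j))%R =
             (rcell s' rD (index p o) + wt T (nth r o j) p)%R by rewrite rp.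
  rstep j ((rcell s' rD (index p o) + rcell s' rRw (nth r o j))%R) (xk, nn, jE, Qj).
  split=> //; split=> //.
    by rewrite /= /upd /= (gtn_eqF ltj).
  move=> i x; rewrite /= /upd /= => /andP[lei lti] nx.
  have [y [_ lty _ ny _]] := peel_order_parent r0 inv' lti.
  have exy : x = y by apply: ord_inj; rewrite -nx -ny.
  rewrite -exy -/o in lty.
  have ji : j <= i by [].
  have -> : (index x o == j) = false by apply: gtn_eqF; exact: leq_ltn_trans lty.
  case: (eqVneq i j) => [ei|nij].
    rewrite ei in nx *; have -> : x = p by apply: ord_inj; rewrite -nx -np.
    by [].
  apply: pE => //; rewrite lti andbT.
  by move: ji nij; rewrite /j; clear -ltk; lia.
move=> s' [oi _ inv' pn pE]; split=> //.
apply: (rooted_of_peel r0 inv') => // i p lti; apply: pE.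
by rewrite subnn.
Qed.

Lemma runs_thr s : icell s 0 0 = n ->
  runs W thr_cmd s (thr_time n)
    (fun s' => [/\ icell s' aQ = icell s aQ, icell s' aPar = icell s aPar,
       rcell s' = rcell s, icell s' 0 0 = n
       & exists J, [/\ icell s' vJ 0 = J, J <= n, n < threshold J,
          forall i, i < J -> threshold i <= n &
          forall i, i < J -> icell s' aThr i = threshold i]]).
Proof.
move=> n0.
have nW : n < W by clear -W3; lia.
have n1W : n + 1 < W by clear -W3; lia.
apply: runs_seq; apply: wp_runs; istep 0 2 n0.
apply: runs_seq; apply: wp_runs; istep 0 0 n0.
apply: (runs_for (Inv := fun k s' => [/\ icell s' aQ = icell s aQ,
       icell s' aPar = icell s aPar,
       rcell s' = rcell s, icell s' 0 0 = n
       & exists J, [/\ icell s' vJ 0 = J, icell s' vS 0 = threshold J,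
          J <= k /\ (k <= J \/ n < threshold J),
          forall i, i < J -> threshold i <= n &
          forall i, i < J -> icell s' aThr i = threshold i]]) (N := n)) => //.
- split=> //; exists 0; split=> //; by split=> //; left.
- by move=> k s' _ _ [].
- move=> k s' ltk xk [Qs Ps rs nn [J [jE sE [lJ kJ] tle tE]]]; apply: wp_runs.
  apply: (wp_ilt (v1 := threshold J) (v2 := n + 1)); [ev (sE, nn)|ev nn|].
  case: ifP => lt; last first.
    split=> //; split=> //; exists J; split=> //; split; first exact: leqW.
    by right; move: lt; clear; lia.
  have tJ : threshold J <= n by move: lt; clear; lia.
  have mW : threshold J * (threshold J + 1) < W.
    apply: (@leq_ltn_trans (n * (n + 1))); last by move: n3 W_big; clear; nia.
    by apply: leq_mul => //; rewrite leq_add2r.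
  have aW : threshold J + 1 < W by move: tJ n1W; clear; lia.
  have JW : J + 1 < W by move: lJ ltk n1W; clear; lia.
  have tW : threshold J < W by clear -aW; lia.
  istep J (threshold J) (jE, sE).
  apply: wp_seq; apply: (wp_istore (vi := 0) (ve := threshold J.+1));
    [by []|rewrite /ieq /= /upd /= sE; split; [by []|by rewrite addn1]|].

  istep 0 (J + 1) (jE, sE).
  have eJ : J = k by case: kJ; move: lJ tJ; clear; lia.
  split=> //; split=> //; exists J.+1; split=> //.
  + by rewrite /= /upd /= addn1.
  + by rewrite eJ; split=> //; left.
  + by move=> i; rewrite ltnS_eqVlt => /orP[/eqP->|/tle].
  + move=> i; rewrite ltnS_eqVlt /= /upd /= => /orP[/eqP->|lti]; first by rewrite eqxx.
    by rewrite (ltn_eqF lti) tE.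
move=> s' [Qs Ps rs nn [J [jE sE [lJ kJ] tle tE]]]; split=> //; exists J; split=> //.
(* If every turn stored a threshold, then [J] is at least [n], and thresholds exceed their
   indices. *)
case: kJ => // nJ; have := threshold_gt J; move: nJ; clear; lia.
Qed.

End Rooting.

(** * One round as a program *)

Definition clear_cmd :=
  For vI (IAdd eN (IConst 1))
    (IStore aCnt eI (IConst 1) ;; IStore aBel eI eN ;; IStore aMul eI (IConst 0)).

Definition up_body :=
  let p := ivar vP in let b := ivar vB in
  iset vP (ICell aPar eI) ;;
  If (ILt (ICell aCnt eI) (ivar vS))
     (IStore aSel eI (ICell aMul eI)) (IStore aSel eI (IConst 1)) ;;
  If (IEq (ICell aSel eI) (IConst 1))
     (* The second store has no effect: both branches write the same cells. *)
     (iset vB eI ;; IStore aCnt p (ICell aCnt p))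
     (iset vB (ICell aBel eI) ;;
      IStore aCnt p (IAdd (ICell aCnt p) (ICell aCnt eI))) ;;
  If (ILt b eN)
     (If (ILt (ICell aBel p) eN) (IStore aMul p (IConst 1)) (IStore aBel p b))
     Skip.

Definition up_cmd := For vI eN up_body.

Definition emit :=
  let a := ivar vV in let b := ivar vB in
  IStore 1 eM (ICell aQ a) ;; IStore 2 eM (ICell aQ b) ;;
  If (ILt a b) (RStore 0 eM (RSub (RCell rD a) (RCell rD b)))
               (RStore 0 eM (RSub (RCell rD b) (RCell rD a))) ;;
  IStore 0 (IConst 1) (IAdd eM (IConst 1)).

Definition emit_if x :=
  If (ILt (ICell x (ivar vV)) eN) (iset vB (ICell x (ivar vV)) ;; emit) Skip.

(** The decreasing order makes [aTop p] available when [j] is visited. [aPar] can be overwritten in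
    place, because [j] reads no parent but its own. *)
Definition down_body :=
  let j := ivar vV in let p := ivar vP in
  iset vV (ISub (ISub eN (IConst 1)) eI) ;;
  iset vP (ICell aPar j) ;;
  If (IEq (ICell aSel p) (IConst 1))
     (IStore aTop j p) (IStore aTop j (ICell aTop p)) ;;
  If (IEq (ICell aSel j) (IConst 1))
     (IStore aPar j (ICell aTop j))
     (If (IEq (ICell aSel p) (IConst 1)) (IStore aPar j eN) (IStore aPar j p) ;;
      emit_if aTop ;; emit_if aBel).

Definition down_cmd := IStore aSel eN (IConst 1) ;; For vI eN down_body.

Section BottomUp.
Variables (n t : nat) (par : nat -> nat).
Hypothesis forest_par : is_forest n par.
Hypothesis le_tn : t <= n.
Implicit Types C B M S : nat -> nat.

Notation br B S := (branch B (fun v => S v == 1)).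

(** [C], [B], [M] and [S] are the contents of [aCnt], [aBel], [aMul] and [aSel]. They summarize, for
    every vertex, its children among the first [k]; as children precede parents, the summary of a
    vertex is complete when it is reached. [M] flags vertices with two branches, and [ui_bound] is
    there to exclude overflow. *)
Record up_inv k C B M S : Prop := UpInv {
  ui_cnt v : v <= n -> C v = 1 + \sum_(c < k | (par c == v) && (S c != 1)) C c;
  ui_bound v : v <= n -> C v <= 1 + k * n;
  ui_sel v : v < k -> S v = if C v < t then M v else 1;
  ui_mul v : v <= n -> M v <= 1;
  ui_bel v : v <= n -> B v <= n;
  ui_some c : c < k -> br B S c < n -> B (par c) < n;
  ui_ex v : v <= n -> B v < n -> exists c, [/\ c < k, par c = v & br B S c = B v];
  ui_uniq c : c < k -> M (par c) = 0 -> br B S c < n -> B (par c) = br B S c;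
  ui_two v : v <= n -> M v = 1 -> exists c d,
    [/\ c != d, c < k, d < k, par c = v /\ par d = v & br B S c < n /\ br B S d < n]
}.

Lemma up_init C B M S : (forall v, v < n.+1 -> [/\ C v = 1, B v = n & M v = 0]) ->
  up_inv 0 C B M S.
Proof.
move=> z; split=> // v lev; have [c b m] := z v lev; rewrite ?c ?b ?m //.
- by rewrite big_ord0.
- by rewrite ltnn.
Qed.

(** [x] is the selection bit of [k] and [b] its branch. The pointwise equations cover all outcomes
    of the loop body at once, so that each of its exits is checked by computation. *)
Lemma up_step k C B M S C' B' M' S' (p := par k)
    (x := if C k < t then M k else 1) (b := if x == 1 then k else B k) :
  up_inv k C B M S -> k < n ->
  S' =1 (fun j => if j == k then x else S j) ->
  C' =1 (fun j => if (x != 1) && (j == p) then C p + C k else C j) ->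
  B' =1 (fun j => if [&& b < n, ~~ (B p < n) & j == p] then b else B j) ->
  M' =1 (fun j => if [&& b < n, B p < n & j == p] then 1 else M j) ->
  up_inv k.+1 C' B' M' S'.
Proof.
move=> [cnt bound selE mul bel some ex unq two] ltk S'E C'E B'E M'E.
have /andP[ltkp lepn] : k < p <= n by exact: forest_par.
have np j : j <= k -> (j == p) = false by move=> lej; apply: ltn_eqF; exact: leq_ltn_trans ltkp.
have C'k j : j <= k -> C' j = C j by move=> /np e; rewrite C'E e andbF.
have B'k j : j <= k -> B' j = B j by move=> /np e; rewrite B'E e !andbF.
have M'k j : j <= k -> M' j = M j by move=> /np e; rewrite M'E e !andbF.
have S'k j : j < k -> S' j = S j by move=> ltj; rewrite S'E (ltn_eqF ltj).
have br'k j : j < k -> br B' S' j = br B S j.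
  by move=> ltj; rewrite /branch S'k // B'k // ltnW.
have br'kk : br B' S' k = b by rewrite /branch S'E eqxx B'k.
have bn : b <= n by rewrite /b; case: ifP => _; [exact: ltnW|exact: bel (ltnW ltk)].
split.
- move=> v lev; rewrite big_mkcond big_ord_recr /= -big_mkcond /=.
  rewrite (eq_bigl (fun c : 'I_k => (par c == v) && (S c != 1))); last first.
    by move=> c; rewrite S'k.
  rewrite (eq_bigr (fun c : 'I_k => C c)); last by move=> c _; rewrite C'k // ltnW.
  rewrite addnA -cnt // S'E eqxx (C'k k (leqnn k)) C'E -/p.
  case: (eqVneq v p) => [->|nvp]; first by rewrite ?eqxx ?andbT; case: ifP; rewrite ?addn0.
  by rewrite andbF ?(eq_sym p) ?(negbTE nvp) addn0.
- move=> v lev; rewrite C'E; case: ifP => [/andP[x1 /eqP ev]|_]; last first.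
    by apply: leq_trans (bound v lev) _; rewrite leq_add2l leq_mul2r leqnSn orbT.
  have := bound p lepn; have : C k <= n.
    by move: x1; rewrite /x; case: ifP => // lt _; apply: leq_trans le_tn; exact: ltnW.
  by clear; lia.
- move=> v; rewrite ltnS_eqVlt => /orP[/eqP->|ltv]; first by rewrite S'E eqxx C'k // M'k.
  by rewrite S'k // C'k ?M'k ?selE // ltnW.
- by move=> v lev; rewrite M'E; case: ifP => // _; exact: mul.
- by move=> v lev; rewrite B'E; case: ifP => // _; exact: bel.
- move=> c; rewrite ltnS_eqVlt => /orP[/eqP->|ltc].
    rewrite br'kk B'E -/p eqxx andbT => ltb; rewrite ltb /=.
    by case: (boolP (B p < n)).
  rewrite br'k // => /(some c ltc) lt; rewrite B'E; case: ifP => // /and3P[_ + /eqP e].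
  by rewrite -e lt.
- move=> v lev; rewrite B'E; case: ifP => [/and3P[ltb _ /eqP->] _|_].
    by exists k; split=> //.
  by move=> /(ex v lev)[c [ltc pc bc]]; exists c; rewrite br'k //; split=> //; exact: leqW.
- move=> c; rewrite ltnS_eqVlt => /orP[/eqP->|ltc].
    rewrite br'kk M'E B'E -/p eqxx !andbT => + ltb; rewrite ltb /=.
    by case: (boolP (B p < n)).
  rewrite br'k // M'E; case: ifP => // _ m0 ltb; have e := unq c ltc m0 ltb.
  rewrite B'E; case: ifP => // /and3P[_ + /eqP ep].
  by rewrite -ep e ltb.
- move=> v lev; rewrite M'E; case: ifP => [/and3P[ltb ltB /eqP->] _|_ /(two v lev)].
    have [c [ltc pc bc]] := ex p lepn ltB.
    exists c, k; rewrite br'k // br'kk bc; split=> //; first by rewrite ltn_eqF.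
    exact: leqW.
  move=> [c [d [ncd ltc ltd pcd bcd]]]; exists c, d; rewrite !br'k //.
  by split=> //; exact: leqW.
Qed.

Lemma up_level_step C B M S top par' (sel := fun v => (v == n) || (S v == 1)) :
  up_inv n C B M S ->
  (forall v, v < n -> top v = if sel (par v) then par v else top (par v)) ->
  (forall v, v < n -> par' v = if sel v then top v else if sel (par v) then n else par v) ->
  level_step n t par par' C B top sel.
Proof.
move=> [cnt bound selE mul bel some ex unq two] topE par'E.
have seln v : v < n -> sel v = (S v == 1) by move=> ltv; rewrite /sel (ltn_eqF ltv).
have brE c : c < n -> branch B sel c = br B S c by move=> ltc; rewrite /branch seln.
split=> //.
- by rewrite /sel eqxx.
- move=> v ltv; rewrite cnt ?(ltnW ltv) //; congr (1 + _).
  by apply: eq_bigl => c; rewrite seln.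
- by move=> v ltv; rewrite seln // selE //; case: ifP => // ->.
- move=> v ltv; rewrite seln // selE //; case: ifP => [lt /eqP m1|/negbT]; last first.
    by rewrite -leqNgt => le _; left.
  right; have [c [d [ncd ltc ltd [pc pd] [bc bd]]]] := two v (ltnW ltv) m1.
  by exists (Ordinal ltc), (Ordinal ltd); rewrite !brE.
- by move=> v ltv; exact: bel (ltnW ltv).
- move=> c ltc ltp; rewrite brE // seln // => ltb sp; apply: unq => //.
  move: sp; rewrite selE //; case: ifP => // _ m1; apply/eqP.
  by have := mul _ (ltnW ltp); rewrite leq_eqVlt (negbTE m1) ltnS leqn0.
- move=> v ltv /(ex v (ltnW ltv))[c [ltc pc bc]].
  by exists (Ordinal ltc); rewrite brE.
Qed.

End BottomUp.

Definition agree (xs : seq nat) (m m' : nat -> nat -> nat) := forall x, x \notin xs -> m' x = m x.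

Lemma agree_upd xs m m' a i v : a \in xs -> agree xs m m' -> agree xs m (upd m' a i v).
Proof.
move=> axs h x nx; rewrite -(h x nx) /upd.
by case: eqP => // e; rewrite e axs in nx.
Qed.

Lemma agree_trans xs ys zs m1 m2 m3 : all (mem zs) xs -> all (mem zs) ys ->
  agree xs m1 m2 -> agree ys m2 m3 -> agree zs m1 m3.
Proof.
move=> /allP xz /allP yz h1 h2 x nx; rewrite h2 ?h1 //; apply: contra nx.
  exact: xz.
exact: yz.
Qed.

Section Emission.
Variables (R : realType) (n : nat) (r : 'I_n) (W : nat) (o : seq 'I_n).
Hypothesis n3 : 2 < n.
Hypothesis W_big : 16 * (n * n) < W.
Implicit Type s : state R.

Let W0 : 0 < W. Proof. by clear -n3 W_big; nia. Qed.
Let W1 : 1 < W. Proof. by clear -n3 W_big; nia. Qed.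
Let W2 : 2 < W. Proof. by clear -n3 W_big; nia. Qed.
Let W3 : n.+2 < W. Proof. by clear -n3 W_big; nia. Qed.

Definition edge_weight (D : nat -> R) (a b : nat) := (if (a < b)%N then D a - D b else D b - D a)%R.

Definition edges_in s (E : seq (nat * nat)) := icell s 0 1 = size E /\
  forall i a b, onth E i = Some (a, b) ->
    [/\ icell s 1 i = nth r o a, icell s 2 i = nth r o b
      & rcell s 0 i = edge_weight (rcell s rD) a b].

Lemma wp_emit s E a b (Q : state R -> Prop) :
  order_in r s o -> edges_in s E -> (size E).+1 < W ->
  icell s vV 0 = a -> icell s vB 0 = b -> a < n -> b < n ->
  (forall s', agree [:: 0; 1; 2] (icell s) (icell s') -> icell s' 0 0 = n ->
     rcell s' rD = rcell s rD -> edges_in s' (rcons E (a, b)) -> Q s') ->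
  wp W emit s Q.
Proof.
move=> [n0 Qo] [sE Ei] sW av bv lta ltb QP.
have sW1 : size E + 1 < W by rewrite addn1.
have sW0 : size E < W by exact: ltnW.
istep (size E) (nth r o a : nat) (sE, av, Qo).
istep (size E) (nth r o b : nat) (sE, bv, Qo).
apply: wp_seq.
set s1 := State _ _.
(* Both branches of the conditional end in this explicit state, so the code after it is verified
   only once. *)
pose s2 := State (icell s1) (upd (rcell s1) 0 (size E) (edge_weight (rcell s rD) a b)).
apply: (wp_mono (Q1 := fun s' => s' = s2)) => [s' ->|].
  istep 1 (size E).+1 (sE, addn1).
  apply: QP => //.
  - by do 3!apply: agree_upd => //.
  - split; first by rewrite /= /upd /= size_rcons.
    move=> i c d; rewrite -cats1 onth_cat /= /upd /=.
    case: ltngtP => [lti|//|->].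
      + by move=> /Ei.
      + by move=> gti; rewrite onth1P => -[e _]; move: gti e; clear; lia.
      + by rewrite subnn /= => -[<- <-].
apply: (wp_ilt (v1 := a) (v2 := b)); [ev av|ev bv|].
rewrite /s2 /edge_weight; case: ifP => lt.
  rstep (size E) (rcell s rD a - rcell s rD b)%R (sE, av, bv).
  by rewrite lt.
rstep (size E) (rcell s rD b - rcell s rD a)%R (sE, av, bv).
by rewrite lt.
Qed.

End Emission.

Section LevelPasses.
Variables (R : realType) (n : nat) (r : 'I_n) (W : nat) (o : seq 'I_n).
Hypothesis n3 : 2 < n.
Hypothesis W_big : 16 * (n * n) < W.
Implicit Type s : state R.

Let W0 : 0 < W. Proof. by clear -n3 W_big; nia. Qed.
Let W1 : 1 < W. Proof. by clear -n3 W_big; nia. Qed.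
Let W2 : 2 < W. Proof. by clear -n3 W_big; nia. Qed.
Let W3 : n.+2 < W. Proof. by clear -n3 W_big; nia. Qed.

(** Entry [n] is cleared as well, because the roots pass their data on to it in the bottom-up
    pass. *)
Lemma runs_clear s : icell s 0 0 = n ->
  runs W clear_cmd s (for_time 4 n.+1 (cost (body clear_cmd)))
    (fun s' => [/\ agree [:: vI; aCnt; aBel; aMul] (icell s) (icell s'), rcell s' = rcell s
      & forall v, v < n.+1 ->
        [/\ icell s' aCnt v = 1, icell s' aBel v = n & icell s' aMul v = 0]]).
Proof.
move=> n0.
apply: (runs_for (Inv := fun k s' =>
   [/\ agree [:: vI; aCnt; aBel; aMul] (icell s) (icell s'), rcell s' = rcell s
      & forall v, v < k ->
        [/\ icell s' aCnt v = 1, icell s' aBel v = n & icell s' aMul v = 0]]) (N := n.+1)) => //.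
- by clear -W3; lia.
- by split=> //; apply: agree_upd.
- move=> k s' _ _ [ag _ _]; have := ag 0 isT => e.
  by rewrite /= e n0 addn1; split=> //; split=> //; clear -W3; lia.
move=> k s' ltk xk [ag rE z]; apply: wp_runs.
have e := ag 0 isT.
istep k 1 xk; istep k n (xk, e, n0); istep k 0 xk.
split=> //; split=> //; first by do 4!apply: agree_upd => //.
move=> v; rewrite ltnS_eqVlt /= /upd /= => /orP[/eqP->|ltv]; first by rewrite eqxx.
by rewrite (ltn_eqF ltv); exact: z.
Qed.

Lemma runs_up s t (par := icell s aPar) : icell s 0 0 = n -> icell s vS 0 = t -> t <= n ->
  is_forest n par ->
  up_inv n t par 0 (icell s aCnt) (icell s aBel) (icell s aMul) (icell s aSel) ->
  runs W up_cmd s (for_time 2 n (cost up_body))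
    (fun s' => [/\ agree [:: vI; vP; vB; aCnt; aBel; aMul; aSel] (icell s) (icell s'),
       rcell s' = rcell s
     & up_inv n t par n (icell s' aCnt) (icell s' aBel) (icell s' aMul) (icell s' aSel)]).
Proof.
move=> n0 tE le_tn fp inv0.
apply: (runs_for (Inv := fun k s' =>
    [/\ agree [:: vI; vP; vB; aCnt; aBel; aMul; aSel] (icell s) (icell s'),
       rcell s' = rcell s
     & up_inv n t par k (icell s' aCnt) (icell s' aBel) (icell s' aMul) (icell s' aSel)])
   (N := n)) => //.
- by clear -W3; lia.
- by split=> //; apply: agree_upd.
- by move=> k s' _ _ [ag _ _]; rewrite /= (ag 0 isT).
move=> k s' ltk xk [ag rE inv]; apply: wp_runs.
have e0 := ag 0 isT; have eP := ag aPar isT; have eS := ag vS isT.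
have nn : icell s' 0 0 = n by rewrite e0.
have tt : icell s' vS 0 = t by rewrite eS.
set C := icell s' aCnt in inv *; set B := icell s' aBel in inv *.
set M := icell s' aMul in inv *; set S := icell s' aSel in inv *.
pose p := par k; have /andP[ltkp lepn] : k < p <= n by exact: fp.
have pk : icell s' aPar k = p by rewrite eP.
pose x := if C k < t then M k else 1; pose b := if x == 1 then k else B k.
have CW : C p + C k < W.
  have := ui_bound inv lepn; have := ui_bound inv (ltnW ltk).
  have : k * n <= n * n by rewrite leq_mul2r (ltnW ltk) orbT.
  by move: n3 W_big; clear; nia.
istep 0 p (xk, pk).
apply: wp_seq.
pose s1 := State (upd (upd (icell s') vP 0 p) aSel k x) (rcell s').
apply: (wp_mono (Q1 := fun s'' => s'' = s1)) => [s'' ->{s''}|]; last first.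
  apply: (wp_ilt (v1 := C k) (v2 := t)); [ev xk|ev tt|].
  rewrite /s1 /x; case: ifP => lt.
    by istep k (M k) (xk); rewrite lt.
  by istep k 1 (xk); rewrite lt.
apply: wp_seq.
pose s2 := State (upd (upd (icell s1) vB 0 b) aCnt p
    (if x == 1 then C p else C p + C k)) (rcell s').
apply: (wp_mono (Q1 := fun s'' => s'' = s2)) => [s'' ->{s''}|]; last first.
  apply: (wp_ieq (v1 := x) (v2 := 1)); [ev (xk, eqxx k)|ev xk|].
  rewrite /s2 /b; case: ifP => x1.
    by istep 0 k xk; istep p (C p) xk; rewrite x1.
  by istep 0 (B k) xk; istep p (C p + C k) xk; rewrite x1.
apply: (wp_ilt (v1 := b) (v2 := n)); [ev xk|ev nn|].
have step := up_step fp le_tn inv ltk.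
have CE : icell s2 aCnt =1 (fun j => if (x != 1) && (j == p) then C p + C k else C j).
  move=> j; rewrite /s2 /s1 /= /upd /=.
  by case: (eqVneq j p) => [->|_]; case: (x == 1).
have agr m : agree [:: vI; vP; vB; aCnt; aBel; aMul; aSel] (icell s2) m ->
    agree [:: vI; vP; vB; aCnt; aBel; aMul; aSel] (icell s) m.
  have ag2 : agree [:: vI; vP; vB; aCnt; aBel; aMul; aSel] (icell s) (icell s2).
    rewrite /s2 /s1 /=; by do 4!apply: agree_upd => //.
  exact: (agree_trans _ _ ag2).
case: ifP => ltb; last first.
  split=> //; split=> //; first by apply: agr; apply: agree_upd.
  by apply: step => // j; rewrite /= -/x -/b ltb.
apply: (wp_ilt (v1 := B p) (v2 := n)); [ev xk|ev nn|].
case: ifP => ltB.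
  istep p 1 xk; split=> //; split=> //; first by apply: agr; do 2!apply: agree_upd => //.
  by apply: step => // j; rewrite /= -/x -/b ltb ltB.
istep p b xk; split=> //; split=> //; first by apply: agr; do 2!apply: agree_upd => //.
by apply: step => // j; rewrite /= -/x -/b ltb ltB.
Qed.

Lemma wp_emit_if x s E a (Q : state R -> Prop) :
  order_in r s o -> edges_in r o s E -> (size E).+1 < W ->
  icell s vV 0 = a -> a < n -> x \notin [:: 0; 1; 2; vB] ->
  (forall s', agree [:: 0; 1; 2; vB] (icell s) (icell s') -> icell s' 0 0 = n ->
     rcell s' rD = rcell s rD ->
     edges_in r o s' (E ++ if icell s x a < n then [:: (a, icell s x a)] else [::]) -> Q s') ->
  wp W (emit_if x) s Q.
Proof.
move=> oi Ei sW av lta nx QP; have [n0 Qo] := oi.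
apply: (wp_ilt (v1 := icell s x a) (v2 := n)); [ev av|ev n0|].
case: ifP => lt; last by apply: QP => //; rewrite lt cats0.
istep 0 (icell s x a) av.
apply: (wp_emit (r := r) (o := o) n3 W_big (a := a) (b := icell s x a) (E := E)) => //.
move=> s' ag nn rE es; apply: QP => //; last by rewrite lt cats1.
by apply: (agree_trans (xs := [:: vB])) ag => //; apply: agree_upd.
Qed.

Lemma runs_down s E (par := icell s aPar) (bel := icell s aBel)
    (sel := fun v => (v == n) || (icell s aSel v == 1)) :
  order_in r s o -> is_forest n par -> edges_in r o s E -> size E + 2 * n < W ->
  runs W down_cmd s ((cost (IStore aSel eN (IConst 1))) + for_time 2 n (cost down_body)).+1
    (fun s' => [/\ agree [:: 0; 1; 2; vI; vP; vB; vV; aSel; aTop; aPar] (icell s) (icell s'),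
       order_in r s' o, rcell s' rD = rcell s rD,
       forall v, v < n ->
         icell s' aTop v = (if sel (par v) then par v else icell s' aTop (par v)) /\
         icell s' aPar v = (if sel v then icell s' aTop v else if sel (par v) then n else par v)
     & edges_in r o s' (E ++ level_edges n (fun=> sel) (fun=> bel) (fun=> icell s' aTop) 0 n)]).
Proof.
move=> oi fp Ei sW; have [n0 Qo] := oi.
have nW : n < W by clear -W3; lia.
have n1W : n - 1 < W by clear -W3; lia.
apply: runs_seq; apply: wp_runs; istep n 1 n0.
pose xs := [:: 0; 1; 2; vI; vP; vB; vV; aSel; aTop; aPar].
pose Inv k s' := [/\ agree xs (icell s) (icell s'),
    order_in r s' o /\ rcell s' rD = rcell s rD,
    forall v, v <= n -> (icell s' aSel v == 1) = sel v,
    (forall v, v < n - k -> icell s' aPar v = par v) /\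
    (forall v, n - k <= v < n ->
       icell s' aTop v = (if sel (par v) then par v else icell s' aTop (par v)) /\
       icell s' aPar v = (if sel v then icell s' aTop v else if sel (par v) then n else par v))
  & edges_in r o s' (E ++ level_edges n (fun=> sel) (fun=> bel) (fun=> icell s' aTop) 0 k)].
apply: (runs_for (Inv := Inv) (N := n)) => //.
- split=> //.
  + by do 2!apply: agree_upd => //.
  + move=> v lev; rewrite /= /upd /= /sel; case: (eqVneq v n) => //.
  + split=> // v; rewrite subn0 => /andP[le lt]; by rewrite ltnNge le in lt.
  + by rewrite cats0.
- by move=> k s' _ _ [_ [[nn _] _] _ _ _].
- move=> k s' ltk xk [ag [[nn Qo'] rE] selE [parE topE] es]; apply: wp_runs.
  pose j := n.-1 - k; have jE : n - 1 - k = j by rewrite subn1.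
  have ltj : j < n by rewrite /j; move: n3; clear; lia.
  have jnk : j < n - k by rewrite /j; move: ltk; clear; lia.
  have njk i : n - k <= i -> j < i by move: jnk; clear; lia.
  pose p := par j; have /andP[ltjp lepn] : j < p <= n by exact: fp.
  have pj : icell s' aPar j = p by rewrite parE.
  have belE : icell s' aBel = bel by exact: ag.
  pose tv := if sel p then p else icell s' aTop p.
  istep 0 j (xk, nn, jE).
  istep 0 p (pj, eqxx j).
  apply: wp_seq.
  pose s1 := State (upd (upd (upd (icell s') vV 0 j) vP 0 p) aTop j tv) (rcell s').
  apply: (wp_mono (Q1 := fun s'' => s'' = s1)) => [s'' ->{s''}|]; last first.
    apply: (wp_ieq (v1 := icell s' aSel p) (v2 := 1)); [ev xk|ev xk|].
    rewrite /s1 /tv -selE //; case: ifP => sp.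
      by istep j p (xk); rewrite sp.
    by istep j (icell s' aTop p) (xk); rewrite sp.
  pose pv := if sel j then tv else if sel p then n else p.
  pose s2 := State (upd (icell s1) aPar j pv) (rcell s').
  pose V := vertex_edges n (fun=> sel) (fun=> bel) (fun=> icell s2 aTop) 0 j.
  have ag1 : agree xs (icell s) (icell s1) by rewrite /s1 /=; do 3!apply: agree_upd => //.
  have ag2 : agree xs (icell s) (icell s2) by rewrite /s2 /s1 /=; do 4!apply: agree_upd => //.
  have top2 v : icell s2 aTop v = if v == j then tv else icell s' aTop v by [].
  have edgesE top' : top' =1 icell s2 aTop ->
      level_edges n (fun=> sel) (fun=> bel) (fun=> top') 0 k.+1
      = level_edges n (fun=> sel) (fun=> bel) (fun=> icell s' aTop) 0 k ++ V.
    move=> tE; rewrite /= -/j; congr cat.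
      apply: level_edges_ext; first exact: ltnW.
      by move=> i /andP[lei _]; split=> //; rewrite tE top2 gtn_eqF // njk.
    by rewrite /V /vertex_edges tE.
  (* What remains of the loop body only emits the edges of [j]. *)
  have final s'' : agree [:: 0; 1; 2; vB] (icell s2) (icell s'') -> icell s'' 0 0 = n ->
      rcell s'' rD = rcell s' rD ->
      edges_in r o s''
        ((E ++ level_edges n (fun=> sel) (fun=> bel) (fun=> icell s' aTop) 0 k) ++ V) ->
      icell s'' vI 0 = k /\ Inv k.+1 (set_ivar s'' vI k.+1).
    move=> ag' nn' rE' es'.
    have eI := ag' vI isT; have eQ := ag' aQ isT; have eS := ag' aSel isT.
    have eP := ag' aPar isT; have eT := ag' aTop isT.
    have eTv v : icell s'' aTop v = if v == j then tv else icell s' aTop v by rewrite eT.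
    have ePv v : icell s'' aPar v = if v == j then pv else icell s' aPar v by rewrite eP.
    have jnS : n - k.+1 = j by rewrite /j; clear; lia.
    split; first by rewrite eI.
    split.
    - apply: agree_upd => //; exact: (agree_trans (xs := xs) _ _ ag2 ag').
    - split; last by rewrite /= rE'.
      split; first by rewrite /= /upd.
      by move=> i lti; rewrite /= /upd /= eQ; exact: Qo'.
    - by move=> v lev; rewrite /= /upd /= eS; exact: selE.
    - rewrite jnS; split=> v.
        move=> ltv; rewrite /= /upd /= ePv (ltn_eqF ltv) parE //.
        exact: ltn_trans ltv jnk.
      move=> /andP[]; rewrite leq_eqVlt => lev ltv; rewrite /= /upd /= !eTv !ePv.
      case: (eqVneq v j) lev => [->|nvj] /= lev.
        by rewrite -/p (gtn_eqF ltjp).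
      have lev' : n - k <= v < n.
        by rewrite ltv andbT; move: lev; rewrite -jnS; move: ltk; clear; lia.
      have [-> ->] := topE v lev'; split=> //.
      have /andP[ltvp _] := fp v ltv.
      by rewrite (gtn_eqF (ltn_trans lev ltvp)).
    - by rewrite (edgesE _ _) ?catA // => v; rewrite eT.
  have sel_j : (icell s1 aSel j == 1) = sel j by exact: selE (ltnW ltj).
  apply: (wp_ieq (v1 := icell s1 aSel j) (v2 := 1)); [by []|by []|].
  rewrite sel_j; case: (boolP (sel j)) => sj.
    have pvE : pv = tv by rewrite /pv sj.
    istep j pv (eqxx j, pvE).
    by apply: final => //; rewrite /V /vertex_edges sj cats0.
  apply: wp_seq.
  apply: (wp_mono (Q1 := fun s'' => s'' = s2)) => [s'' ->{s''}|]; last first.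
    apply: (wp_ieq (v1 := icell s1 aSel p) (v2 := 1)); [by []|by []|].
    have -> : (icell s1 aSel p == 1) = sel p by exact: selE.
    rewrite /s2 /pv (negbTE sj); case: (boolP (sel p)) => sp.
      by istep j n (nn, eqxx j).
    by istep j p (eqxx j).
  set F := level_edges _ _ _ _ _ _ in es final.
  have szF : size F <= 2 * k.
    rewrite /F; elim: (k) => //= i IH; rewrite size_cat mulnS addnC.
    by apply: leq_add => //; rewrite /vertex_edges; case: ifP => // _; do 2!case: ifP.
  have sz0 : size (E ++ F) + 2 <= size E + 2 * n.
    by rewrite size_cat; move: szF ltk; clear; lia.
  have oi2 : order_in r s2 o by split.
  apply: wp_seq; apply: (wp_emit_if (E := E ++ F) (a := j) oi2) => //.
    by move: sz0 sW; clear; lia.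
  move=> s3 ag3 nn3 rE3 es3.
  have eV := ag3 vV isT; have eB : icell s3 aBel = bel by rewrite (ag3 aBel isT); exact: belE.
  have oi3 : order_in r s3 o by split=> // i lti; rewrite (ag3 aQ isT); exact: Qo'.
  apply: (wp_emit_if (a := j) oi3 es3) => //.
  - rewrite size_cat.
    have : size (if icell s2 aTop j < n then [:: (j, icell s2 aTop j)] else [::]) <= 1.
      by case: ifP.
    by move: sz0 sW; clear; lia.
  - by rewrite eV.
  move=> s4 ag4 nn4 rE4 es4; apply: final => //.
  - exact: (agree_trans (xs := [:: 0; 1; 2; vB]) _ _ ag3 ag4).
  - by rewrite rE4 rE3.
  move: es4; rewrite -catA eB.
  by rewrite /V /vertex_edges (negbTE sj).
move=> s' [ag [oi' rE] selE [_ topE] es]; split=> // v ltv; apply: topE.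
by rewrite subnn.
Qed.

End LevelPasses.

(** * The loop over the rounds *)

Definition level_body :=
  iset vS (ICell aThr (ISub (ISub (ivar vJ) (IConst 1)) (ivar vL))) ;;
  clear_cmd ;; up_cmd ;; down_cmd.

(** The edge count is reset and the output overwrites the input list: after the rooting, the tree is
    only accessed through [aQ], [aPar] and [rD]. *)
Definition levels_cmd :=
  IStore 0 (IConst 1) (IConst 0) ;; For vL (ivar vJ) level_body.

Definition level_time n :=
  (cost (iset vS (ICell aThr (ISub (ISub (ivar vJ) (IConst 1)) (ivar vL)))) +
   (for_time 4 n.+1 (cost (body clear_cmd)) +
    (for_time 2 n (cost up_body) +
     (cost (IStore aSel eN (IConst 1)) + for_time 2 n (cost down_body)).+1).+1).+1).+1.

Definition levels_time n J :=
  (cost (IStore 0 (IConst 1) (IConst 0)) + for_time 2 J (level_time n)).+1.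

Section LevelLoop.
Variables (R : realType) (n : nat) (r : 'I_n) (W : nat) (o : seq 'I_n).
Hypothesis n3 : 2 < n.
Hypothesis W_big : 16 * (n * n) < W.
Implicit Type s : state R.

Let W3 : n.+2 < W. Proof. by clear -n3 W_big; nia. Qed.
Let W2 : 2 < W. Proof. by clear -n3 W_big; nia. Qed.
Let W1 : 1 < W. Proof. by clear -n3 W_big; nia. Qed.
Let W0 : 0 < W. Proof. by clear -n3 W_big; nia. Qed.

Definition level_vars :=
  [:: 0; 1; 2; vI; vP; vB; vV; vS; aCnt; aBel; aMul; aSel; aTop; aPar].

Lemma runs_level s E t J l (par := icell s aPar) :
  order_in r s o -> is_forest n par -> edges_in r o s E -> size E + 2 * n < W ->
  icell s vJ 0 = J -> icell s vL 0 = l -> l < J -> J <= n ->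
  icell s aThr (J.-1 - l) = t -> t <= n ->
  runs W level_body s (level_time n)
    (fun s' => [/\ agree level_vars (icell s) (icell s'), order_in r s' o,
       rcell s' rD = rcell s rD
     & exists cnt bel top sel,
         level_step n t par (icell s' aPar) cnt bel top sel /\
         edges_in r o s' (E ++ level_edges n (fun=> sel) (fun=> bel) (fun=> top) 0 n)]).
Proof.
move=> oi fp Ei sW JE lE ltl leJ tE le_tn; have [n0 Qo] := oi.
have JW : J < W by clear -leJ W3; lia.
have J1W : J.-1 < W by clear -JW; lia.
rewrite /level_body; apply: runs_seq; apply: wp_runs.
istep 0 t (JE, lE, subn1, tE).
set s1 := State _ _.
have oi1 : order_in r s1 o by [].
apply: runs_seq; apply: runs_weaken (runs_clear n3 W_big (s := s1) _) => // s2 [ag2 rE2 z2].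
have inv0 : up_inv n t (icell s2 aPar) 0
    (icell s2 aCnt) (icell s2 aBel) (icell s2 aMul) (icell s2 aSel).
  exact: up_init z2.
have e0 : icell s2 0 0 = n by rewrite (ag2 0 isT).
have eP2 : icell s2 aPar = par by rewrite (ag2 aPar isT).
have eS2 : icell s2 vS 0 = t by rewrite (ag2 vS isT).
have fp2 : is_forest n (icell s2 aPar) by rewrite eP2.
apply: runs_seq; apply: runs_weaken (runs_up n3 W_big e0 eS2 le_tn fp2 inv0) => //.
move=> s3 [ag3 rE3 inv3].
have eP3 : icell s3 aPar = par by rewrite (ag3 aPar isT).
have oi3 : order_in r s3 o.
  by split; [rewrite (ag3 0 isT)|move=> i lti; rewrite (ag3 aQ isT) (ag2 aQ isT); exact: Qo].
have es3 : edges_in r o s3 E.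
  have [sE Es] := Ei; split; first by rewrite (ag3 0 isT) (ag2 0 isT).
  by move=> i a b /Es; rewrite (ag3 1 isT) (ag2 1 isT) (ag3 2 isT) (ag2 2 isT) rE3 rE2.
have fp3 : is_forest n (icell s3 aPar) by rewrite eP3.
apply: runs_weaken (runs_down n3 W_big oi3 fp3 es3 sW) => //.
move=> s4 [ag4 oi4 rE4 topE es4].
split=> //.
- apply: (agree_trans (xs := [:: vS; vI; aCnt; aBel; aMul; vP; vB; aSel]) _ _ _ ag4) => //.
  apply: (agree_trans (xs := [:: vS; vI; aCnt; aBel; aMul]) _ _ _ ag3) => //.
  by apply: (agree_trans (xs := [:: vS]) _ _ _ ag2) => //; apply: agree_upd.
- by rewrite rE4 rE3 rE2.
exists (icell s3 aCnt), (icell s3 aBel), (icell s4 aTop),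
  (fun v => (v == n) || (icell s3 aSel v == 1)); split=> //.
rewrite eP2 in inv3; rewrite eP3 in topE.
by apply: (up_level_step fp inv3) => // v /topE[].
Qed.

Lemma runs_levels s J : order_in r s o -> is_forest n (icell s aPar) ->
  icell s vJ 0 = J -> J <= n -> (forall i, i < J -> threshold i <= n) ->
  (forall i, i < J -> icell s aThr i = threshold i) ->
  runs W levels_cmd s (levels_time n J)
    (fun s' => [/\ order_in r s' o, rcell s' rD = rcell s rD
      & exists par cnt bel top sel,
          [/\ par 0 = icell s aPar,
            forall l, l < J -> level_step n (threshold (J.-1 - l)) (par l) (par l.+1)
              (cnt l) (bel l) (top l) (sel l)
          & edges_in r o s' (all_edges n sel bel top J)]]).
Proof.
move=> oi fp JE leJ tle tE; have [n0 Qo] := oi.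
have JW : J < W by clear -leJ W3; lia.
apply: runs_seq; apply: wp_runs; istep 1 0 n0.
apply: (runs_for (Inv := fun l s' =>
  [/\ order_in r s' o /\ rcell s' rD = rcell s rD, icell s' vJ 0 = J,
      icell s' aThr = icell s aThr
    & exists par cnt bel top sel,
          [/\ par 0 = icell s aPar, par l = icell s' aPar,
            forall l', l' < l -> level_step n (threshold (J.-1 - l')) (par l') (par l'.+1)
              (cnt l') (bel l') (top l') (sel l')
          & edges_in r o s' (all_edges n sel bel top l)]]) (N := J)) => //.
- split=> //.
  exists (fun=> icell s aPar), (fun _ _ => 0), (fun _ _ => 0), (fun _ _ => 0), (fun _ _ => true).
  by split=> //; split=> // i a b; rewrite onth0n.
- by move=> l s' _ _ [_ JE' _ _]; split.
- move=> l s' ltl xl [[oi' rE] JE' tE' [par [cnt [bel [top [sel [par0 parl steps Ei]]]]]]].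
  have fpl : is_forest n (icell s' aPar).
    rewrite -parl; case: (l) steps => [_|m st]; first by rewrite par0.
    exact: (par'_forest (st m (ltnSn m))).
  have sW : size (all_edges n sel bel top l) + 2 * n < W.
    have := size_all_edges n sel bel top l.
    have : 2 * n * l <= 2 * n * n by rewrite leq_mul2l (ltnW (leq_trans ltl leJ)) orbT.
    by move: n3 W_big; clear; nia.
  have lt' : J.-1 - l < J by move: ltl; clear; lia.
  have tl : icell s' aThr (J.-1 - l) = threshold (J.-1 - l) by rewrite tE'; exact: tE.
  apply: runs_weaken (runs_level oi' fpl Ei sW JE' xl ltl leJ tl (tle _ lt')) => //.
    move=> s2 [ag oi2 rE2 [c2 [b2 [t2 [s2' [st2 Ei2]]]]]].
    have eL := ag vL isT; split; first by rewrite eL.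
    split.
    + by split=> //; rewrite /= rE2.
    + by rewrite /= /upd /= (ag vJ isT).
    + by rewrite -tE' -(ag aThr isT).
    (* The arrays are reused in every round, so the data of round [l] are recorded by extending the
       functions of the level. *)
    exists (fun l' => if l' == l.+1 then icell s2 aPar else par l'),
      (fun l' => if l' == l then c2 else cnt l'), (fun l' => if l' == l then b2 else bel l'),
      (fun l' => if l' == l then t2 else top l'), (fun l' => if l' == l then s2' else sel l').
    split=> //.
    + by rewrite eqxx.
    + move=> l'; rewrite ltnS leq_eqVlt => /orP[/eqP->|ltl'].
        by rewrite !eqxx (ltn_eqF (ltnSn l)) parl.
      rewrite eqSS !(ltn_eqF ltl') (ltn_eqF (leqW ltl')); exact: steps.
    rewrite /= (all_edges_ext (sel' := sel) (bel' := bel) (top' := top)); last first.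
      by move=> l' j ltl' _; rewrite (ltn_eqF ltl').
    rewrite (level_edges_ext
      (sel' := fun=> s2') (bel' := fun=> b2) (top' := fun=> t2) (l' := 0)) //.
    by move=> j _; rewrite eqxx.
move=> s' [[oi' rE] _ _ [par [cnt [bel [top [sel [par0 _ steps Ei]]]]]]].
by split=> //; exists par, cnt, bel, top, sel.
Qed.

End LevelLoop.

(** * Distances in the emulator *)

Import Order.TTheory Num.Theory.
Local Open Scope ring_scope.

Section Walks.
Variables (R : realType) (V : finType) (G : wgraph R V).

Lemma path_weight_ge0 u p : path (adj G) u p -> 0 <= path_weight G u p.
Proof.
elim: p u => //= x p IH u /andP[eux px]; apply: addr_ge0 (IH _ px); exact: wt_ge0.
Qed.

Lemma path_weight_cat u p q :
  path_weight G u (p ++ q) = path_weight G u p + path_weight G (last u p) q.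
Proof. by elim: p u => [|x p IH] u /=; rewrite ?add0r // IH addrA. Qed.

(** Weights are nonnegative, so cutting out a closed part makes a walk neither longer nor
    heavier. *)
Lemma simple_of_walk u p : path (adj G) u p ->
  exists q, [/\ is_path G u (last u p) q, (size q <= size p)%N
              & path_weight G u q <= path_weight G u p].
Proof.
have [m] := ubnP (size p); elim: m p u => // m IH [|x p] u /=; first by exists [::].
rewrite ltnS => lem /andP[eux px].
have [q [[pq lq uq] sq wq]] := IH p x lem px.
have [uxq|uxq] := boolP (u \in x :: q); last first.
  exists (x :: q); split; rewrite /= ?lerD2l //; split=> //; first by rewrite /= eux.
  by rewrite cons_uniq uxq.
case/splitPl E: q / uxq pq lq uq sq wq => [q1 q2 lq1] pq lq uq sq wq.
move: pq; rewrite cat_path lq1 => /andP[pq1 pq2].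
exists q2; split.
- split=> //; first by rewrite -lq last_cat lq1.
  move: uq; rewrite -cat_cons cat_uniq => /and3P[_ /hasPn h uq2].
  rewrite /= uq2 andbT; apply/negP => /h /negP[]; rewrite -lq1; exact: mem_last.
- by apply: leqW; apply: leq_trans sq; rewrite size_cat leq_addl.
- apply: le_trans (le_trans wq _); first by rewrite path_weight_cat lq1 lerDr path_weight_ge0.
  by rewrite lerDr wt_ge0.
Qed.

End Walks.

Lemma ereal_inf_dominated (R : realType) (A B : classical_sets.set (\bar R)) :
  (forall x, A x -> exists2 y, B y & (y <= x)%E) ->
  (forall y, B y -> exists2 x, A x & (x <= y)%E) -> ereal_inf A = ereal_inf B.
Proof.
move=> AB BA; apply/eqP; rewrite eq_le; apply/andP; split.
  by apply: le_ereal_inf_tmp => x /BA; exact: ge_ereal_inf.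
by apply: le_ereal_inf_tmp => x /AB; exact: ge_ereal_inf.
Qed.

Section RootedDistances.
Variables (R : realType) (n : nat) (par : nat -> nat) (D : nat -> R).
Variables (pos : 'I_n -> nat) (ord : nat -> 'I_n).
Hypothesis forest_par : is_forest n par.
Hypothesis pos_lt : forall v, (pos v < n)%N.
Hypothesis posK : forall v, ord (pos v) = v.
Hypothesis ordK : forall i, (i < n)%N -> pos (ord i) = i.
Hypothesis D_par : forall i, (i < n)%N -> (par i < n)%N -> D (par i) <= D i.

Lemma D_anc i j : anc n par i j -> (j < n)%N -> D j <= D i.
Proof.
by elim=> // k ik IH ltk ltp; apply: le_trans (IH ltk); exact: D_par.
Qed.

(** At the nearest common ancestor the left-hand side is the tree distance. Any common ancestor is
    allowed, so the nearest one never has to be computed. *)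
Definition meets (W : R) i j :=
  exists a, [/\ (a < n)%N, anc n par i a, anc n par j a & D i + D j - 2 * D a <= W].

(* The edges of [G] join ancestors to descendants and are as long as the tree
   path between their ends. *)
Definition vertical (G : wgraph R 'I_n) := forall u v, adj G u v ->
  (anc n par (pos u) (pos v) /\ wt G u v = D (pos u) - D (pos v)) \/
  (anc n par (pos v) (pos u) /\ wt G u v = D (pos v) - D (pos u)).

(** If the first step goes up, the ancestor found for the rest of the walk still serves. If it goes
    down from [u], that ancestor is comparable with [u], and the upper one of the two serves. *)
Lemma vertical_meets G u p : vertical G -> path (adj G) u p ->
  meets (path_weight G u p) (pos u) (pos (last u p)).
Proof.
move=> vG; elim: p u => [|x p IH] u /=.
  by exists (pos u); split; [|exact: AncRefl|exact: AncRefl|lra].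
move=> /andP[eux /IH[a [lta xa va le]]].
case: (vG u x eux) => -[ux ->].
  by exists a; split=> //; [exact: anc_trans ux xa|lra].
have Dxu := D_anc ux (pos_lt u).
case: (anc_total forest_par ux xa) => [ua|au].
  by exists a; split=> //; have := D_anc ua lta; lra.
exists (pos u); split; [by []|exact: AncRefl|exact: anc_trans va au|].
by have := D_anc au (pos_lt u); have := D_anc xa lta; lra.
Qed.

(* Ancestor-descendant pairs are joined by walks of exact weight with at most
   [h] edges. *)
Definition vertical_walks h (G : wgraph R 'I_n) := forall u v, anc n par (pos u) (pos v) ->
  exists p, [/\ path (adj G) u p, last u p = v, (size p <= h)%N
              & path_weight G u p = D (pos u) - D (pos v)].

Lemma rev_walk (G : wgraph R 'I_n) u p : path (adj G) u p ->
  exists q, [/\ path (adj G) (last u p) q, last (last u p) q = u, size q = size p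
              & path_weight G (last u p) q = path_weight G u p].
Proof.
elim: p u => [|x p IH] u /=; first by exists [::].
move=> /andP[eux /IH[q [pq lq sq wq]]].
exists (rcons q u); rewrite rcons_path pq lq adj_sym eux last_rcons size_rcons sq.
split=> //; rewrite -cats1 path_weight_cat lq wq /= addr0 addrC.
by rewrite (wt_sym eux).
Qed.

Lemma meets_walk h G W u v : vertical_walks h G -> meets W (pos u) (pos v) ->
  exists p, [/\ is_path G u v p, (size p <= 2 * h)%N & path_weight G u p <= W].
Proof.
move=> wG [a [lta ua va le]]; rewrite -(ordK lta) in ua va le.
have [p [pp lp sp wp]] := wG _ _ ua; have [q [pq lq sq wq]] := wG _ _ va.
have [q' [pq' lq' sq' wq']] := rev_walk pq; rewrite lq in pq' lq' wq'.
have pw : path (adj G) u (p ++ q') by rewrite cat_path pp lp.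
have [s [ps ss ws]] := simple_of_walk pw.
exists s; split; first by move: ps; rewrite last_cat lp lq'.
  by apply: leq_trans ss _; rewrite size_cat sq'; lia.
by apply: le_trans ws _; rewrite path_weight_cat lp wp wq' wq; lra.
Qed.

(** The tree is itself a vertical graph, so the two inequalities are the same argument with [T] and
    [K] exchanged; edges are counted in one direction only. The factor 2 stands for climbing to the
    common ancestor and descending from it. *)
Lemma vertical_emulator h g T K :
  vertical T -> vertical K -> vertical_walks g T -> vertical_walks h K ->
  hop_emulator (2 * h) T K.
Proof.
move=> vT vK wT wK u v; apply: ereal_inf_dominated => x [p]; rewrite /=.
  move=> [[pp lp _] _] <-.
  have := vertical_meets vK pp; rewrite lp => /(meets_walk wT)[q [pq _ wq]].
  by exists (path_weight T u q)%:E; [exists q|rewrite lee_fin].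
move=> [pp lp _] <-.
have := vertical_meets vT pp; rewrite lp => /(meets_walk wK)[q [pq sq wq]].
by exists (path_weight K u q)%:E; [exists q|rewrite lee_fin].
Qed.

End RootedDistances.

(** * The emulator as a weighted graph *)

Section Emulator.
Variables (R : realType) (n : nat) (T : wgraph R 'I_n) (r : 'I_n).
Variables (o : seq 'I_n) (D : nat -> R).
Variables (J : nat) (thr : nat -> nat).
Variables (par cnt bel top : nat -> nat -> nat) (sel : nat -> nat -> bool).

Hypothesis oT : rooted_order T r o (par 0) D.
Hypothesis steps : forall l, (l < J)%N ->
  level_step n (thr (J.-1 - l)) (par l) (par l.+1) (cnt l) (bel l) (top l) (sel l).
Hypothesis last_par : forall v, (v < n)%N -> par J v = n.

Let E := all_edges n sel bel top J.
Let pos v := index v o.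
Let ord := nth r o.

Let memo v : v \in o.
Proof.
have sub : {subset o <= enum 'I_n} by move=> y _; rewrite mem_enum.
have le : (size (enum 'I_n) <= size o)%N by rewrite size_enum_ord (ro_size oT).
by have [_ ->] := uniq_min_size (ro_uniq oT) sub le; rewrite mem_enum.
Qed.

Let pos_lt v : (pos v < n)%N.
Proof. by apply: leq_trans (eq_leq (ro_size oT)); rewrite index_mem. Qed.

Let posK v : ord (pos v) = v. Proof. exact: nth_index. Qed.

Let ordK i : (i < n)%N -> pos (ord i) = i.
Proof. by move=> lti; rewrite /pos /ord index_uniq ?(ro_size oT) ?(ro_uniq oT). Qed.

Let pos_inj : injective pos. Proof. exact: can_inj posK. Qed.

Let D_par i : (i < n)%N -> (par 0 i < n)%N -> D (par 0 i) <= D i.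
Proof.
move=> lti ltp; have [e ->] := ro_adj oT lti ltp.
by rewrite lerDl wt_ge0.
Qed.

Definition emu_adj : rel 'I_n := fun u v =>
  ((index u o, index v o) \in E) || ((index v o, index u o) \in E).

(* Positions decrease with the depth. *)
Definition emu_wt (u v : 'I_n) : R :=
  if (index u o < index v o)%N then D (index u o) - D (index v o)
  else D (index v o) - D (index u o).

Lemma emu_adj_sym : symmetric emu_adj.
Proof. by move=> u v; rewrite /emu_adj orbC. Qed.

Lemma emu_adj_irr : irreflexive emu_adj.
Proof.
move=> u; rewrite /emu_adj orbb; apply/negP => e.
by have := all_edges_asym steps e; rewrite e.
Qed.

Lemma emu_wt_sym u v : emu_adj u v -> emu_wt u v = emu_wt v u.
Proof.
rewrite /emu_wt; case: (ltngtP (index u o) (index v o)) => // e.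
by rewrite -[u]posK -[v]posK /pos e.
Qed.

Lemma emu_vertical u v : emu_adj u v ->
  (anc n (par 0) (pos u) (pos v) /\ emu_wt u v = D (pos u) - D (pos v)) \/
  (anc n (par 0) (pos v) (pos u) /\ emu_wt u v = D (pos v) - D (pos u)).
Proof.
move=> euv.
have : anc n (par 0) (pos u) (pos v) \/ anc n (par 0) (pos v) (pos u).
  by case/orP: euv => /(all_edges_anc steps)[]; [left|right|right|left].
have nuv : pos u != pos v.
  by apply: contraTneq euv => /pos_inj->; rewrite emu_adj_irr.
case=> a; have := anc_leq (ro_forest oT) a; rewrite leq_eqVlt.
  by rewrite (negbTE nuv) /= => lt; left; rewrite /emu_wt -!/(pos _) lt.
rewrite eq_sym (negbTE nuv) /= => lt; right.
by rewrite /emu_wt -!/(pos _) ltnNge (ltnW lt).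
Qed.

Lemma emu_wt_ge0 u v : emu_adj u v -> 0 <= emu_wt u v.
Proof.
by case/emu_vertical => -[a ->]; rewrite subr_ge0 (D_anc D_par a).
Qed.

Definition emulator : wgraph R 'I_n :=
  WGraph emu_adj_sym emu_adj_irr emu_wt_sym emu_wt_ge0.

Lemma emulator_hop : hop_emulator (2 * (2 * J)) T emulator.
Proof.
apply: (@vertical_emulator R n (par 0) D pos ord (ro_forest oT) pos_lt ordK D_par
          (2 * J) n).
- move=> u v euv.
  have one x y : adj T x y -> par 0 (pos x) = pos y ->
      anc n (par 0) (pos x) (pos y) /\ wt T x y = D (pos x) - D (pos y).
    move=> exy pxy; split; first by rewrite -pxy; apply: AncStep => //; exact: AncRefl.
    have [] := ro_adj oT (pos_lt x); rewrite pxy // -!/(ord _) !posK => _ ->; lra.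
  case: (ro_edge oT euv) => e; [left|right]; first exact: one.
  by rewrite (wt_sym euv); apply: one; rewrite // adj_sym.
- exact: emu_vertical.
- have walk i j : anc n (par 0) i j -> (j < n)%N -> exists p,
      [/\ path (adj T) (ord i) p, last (ord i) p = ord j, (size p <= j - i)%N
        & path_weight T (ord i) p = D i - D j].
    elim=> [|k ik IH ltk ltp]; first by exists [::]; rewrite /= subrr.
    have [p [pp lp sp wp]] := IH ltk; have [ekp Dk] := ro_adj oT ltk ltp.
    exists (rcons p (ord (par 0 k))); rewrite rcons_path pp lp ekp last_rcons size_rcons.
    split=> //; last first.
      by rewrite -cats1 path_weight_cat wp lp /= addr0 Dk /ord; lra.
    have := anc_leq (ro_forest oT) ik; have := ro_forest oT ltk; lia.
  move=> u v /walk-/(_ (pos_lt v))[p]; rewrite !posK => -[pp lp sp wp].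
  exists p; split=> //; apply: leq_trans sp _.
  by have := pos_lt v; lia.
have walk h i j : climb E h i j -> (j < n)%N -> exists p,
    [/\ path emu_adj (ord i) p, last (ord i) p = ord j, size p = h
      & path_weight emulator (ord i) p = D i - D j].
  elim=> [{}i|{}h {}i x {}j ltix e c IH] ltj; first by exists [::]; rewrite /= subrr.
  have ltx : (x < n)%N.
    by case/orP: e => /(all_edgesP steps)[l [[]]].
  have [p [pp lp sp wp]] := IH ltj.
  exists (ord x :: p); rewrite /= lp sp wp pp; split=> //.
    rewrite andbT /emu_adj -!/(pos _) !ordK //; exact: ltn_trans ltix ltx.
  rewrite /emu_wt -!/(pos _) !ordK //; last exact: ltn_trans ltix ltx.
  by rewrite ltix; lra.
move=> u v a.
have [h leh /walk-/(_ (pos_lt v))[p]] := climb_levels steps last_par a (pos_lt v).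
by rewrite !posK => -[pp lp sp wp]; exists p; split=> //; rewrite sp.
Qed.

Lemma emulator_treewidth : (treewidth (adj emulator) <= 2 * J)%N.
Proof.
exact: (levels_treewidth steps last_par pos_inj pos_lt).
Qed.

(** That each edge is listed exactly once, in one orientation, is [all_edges_uniq] together with
    [all_edges_asym]. *)
Lemma emulator_edge_list (L : seq ('I_n * 'I_n * R)) :
  L = [seq (ord ab.1, ord ab.2, emu_wt (ord ab.1) (ord ab.2)) | ab <- E] ->
  edge_list emulator L.
Proof.
move=> ->; have Elt a b : (a, b) \in E -> (a < n)%N /\ (b < n)%N.
  by move=> /(all_edgesP steps)[l [[]]].
split=> [u v w /mapP[[a b] ab [-> -> ->]]|u v].
  split=> //; have [lta ltb] := Elt a b ab.
  by rewrite /= /emu_adj -!/(pos _) !ordK // ab.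
rewrite /= /emu_adj -!/(pos _) => euv.
rewrite count_map (eq_in_count (a2 := predU (pred1 (pos u, pos v)) (pred1 (pos v, pos u)))).
  have nuv : (pos u, pos v) != (pos v, pos u).
    apply/eqP => -[/pos_inj e _]; move: euv; rewrite e orbb => e'.
    by have := all_edges_asym steps e'; rewrite e'.
  have := count_predUI (pred1 (pos u, pos v)) (pred1 (pos v, pos u)) E.
  rewrite (eq_count (a1 := predI _ _) (a2 := pred0)) ?count_pred0 ?addn0; last first.
    by move=> x /=; apply/negP => /andP[/eqP-> e]; rewrite e in nuv.
  move=> ->; have uE := all_edges_uniq steps.
  rewrite !count_uniq_mem //.
  case/orP: euv => e; rewrite -/E in e *; rewrite e (negbTE (all_edges_asym steps e)) //.
move=> [a b] /Elt[lta ltb] /=; rewrite !xpair_eqE.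
have eo c v' : (c < n)%N -> (ord c == v') = (c == pos v').
  move=> ltc; apply/eqP/eqP => [<-|->]; by rewrite ?ordK ?posK.
by rewrite !eo.
Qed.

End Emulator.

(** * The theorem *)

Definition emulator_program :=
  init_cmd ;; sums_cmd ;; leaves_cmd ;; peel_cmd ;; pos_cmd ;; par_cmd ;; thr_cmd ;;
  levels_cmd.

Lemma for_time_le h N t M : (N <= M)%N -> (0 < M)%N ->
  (for_time h N t <= (t + 2 * h + 40) * M)%N.
Proof. by rewrite /for_time; nia. Qed.

Definition program_time n m J :=
  ((for_time 2 n (cost (body init_cmd)) + (for_time 2 m (cost (body sums_cmd)) +
   (leaves_time n + (for_time 4 n.-1 (cost (body peel_cmd)) + (pos_time n + (par_time n +
    (thr_time n + levels_time n J).+1).+1).+1).+1).+1).+1).+1)%N.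

(** Here [m] is the number of edges and [J] the number of rounds. The closure lemmas follow the
    syntax of a time bound, which yields a factor [A] without computing it. *)
Definition near_linear (f : nat -> nat -> nat -> nat) := exists A : nat, forall n m J,
  (0 < n -> m <= n -> 0 < J -> f n m J <= A * (n * J))%N.

Lemma near_linear_const c : near_linear (fun _ _ _ => c).
Proof. by exists c => n m J n0 _ J0; rewrite leq_pmulr // muln_gt0 n0. Qed.

Lemma near_linear_add f g : near_linear f -> near_linear g ->
  near_linear (fun n m J => f n m J + g n m J)%N.
Proof.
move=> [A fA] [B gB]; exists (A + B)%N => n m J n0 lem J0.
by rewrite mulnDl leq_add ?fA ?gB.
Qed.

Lemma near_linear_succ f : near_linear f -> near_linear (fun n m J => (f n m J).+1).
Proof.
move=> /near_linear_add/(_ (near_linear_const 1))[A fA].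
by exists A => n m J n0 lem J0; rewrite -addn1; exact: fA.
Qed.

Lemma near_linear_for h c (N : nat -> nat -> nat -> nat) :
  (forall n m J, 0 < n -> m <= n -> N n m J <= 2 * n)%N ->
  near_linear (fun n m J => for_time h (N n m J) c).
Proof.
move=> NP; exists ((c + 2 * h + 40) * 2)%N => n m J n0 lem J0.
apply: leq_trans (for_time_le _ _ (NP n m J n0 lem) _) _; first by rewrite muln_gt0.
by rewrite -mulnA leq_mul2l leq_mul2l leq_pmulr ?orbT.
Qed.

Ltac near_linear := repeat first
  [ assumption
  | exact: near_linear_const
  | apply: near_linear_for; move=> *; lia
  | apply: near_linear_succ
  | apply: near_linear_add ].

Lemma levels_time_near_linear : near_linear (fun n _ J => levels_time n J).
Proof.
have [A level_le] : near_linear (fun n _ _ => level_time n).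
  by rewrite /level_time; near_linear.
apply: near_linear_succ; apply: near_linear_add; first exact: near_linear_const.
(* A round does not depend on [J], so its bound is used at [J = 1]. The loop adds 22 per turn and 22
   once, each contributing at most [22 * (n * J)]. *)
exists (A + 44)%N => n m J n0 lem J0; rewrite /for_time.
have := level_le n m 1%N n0 lem isT; rewrite muln1.
by set lt := level_time n; nia.
Qed.

Lemma program_time_near_linear : near_linear program_time.
Proof.
have levels := levels_time_near_linear.
rewrite /program_time /leaves_time /pos_time /par_time /thr_time.
near_linear.
Qed.

(** * Bounds in terms of [log2 (log2 n)] *)

Section LogLog.
Variable R : realType.

Lemma ln2_gt0 : 0 < ln 2 :> R.
Proof. by apply: ln_gt0; lra. Qed.

Lemma ler_log2 (x y : R) : 0 < x -> x <= y -> log2 x <= log2 y.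
Proof.
move=> x0 xy; rewrite /log2 ler_pM2r ?invr_gt0 ?ln2_gt0 //.
by rewrite ler_ln ?posrE //; exact: lt_le_trans xy.
Qed.

Lemma log2X k : log2 (2 ^+ k : R) = k%:R.
Proof. by rewrite /log2 lnXn // -[ln 2 *+ k]mulr_natl mulfK // gt_eqF // ln2_gt0. Qed.

Lemma log2_ge (x : R) m k : 0 < x -> 2 ^+ m <= x ^+ k.+1 -> m%:R / k.+1%:R <= log2 x.
Proof.
move=> x0 le; rewrite ler_pdivrMr ?ltr0n // -log2X.
apply: le_trans (ler_log2 _ le) _; first exact: exprn_gt0.
by rewrite /log2 lnXn // -[ln x *+ k.+1]mulr_natr mulrAC.
Qed.

(** A positive lower bound lets additive constants be absorbed. It follows from [2 ^ 3 <= 3 ^ 2] and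
    then from [2 <= (3 / 2) ^ 2]. *)
Lemma loglog_ge (n : nat) : (3 <= n)%N -> 1 / 2 <= log2 (log2 n%:R) :> R.
Proof.
move=> n3; have n3R : 3 <= n%:R :> R by rewrite ler_nat.
have h : 3 / 2 <= log2 n%:R :> R by apply: (log2_ge (m := 3) (k := 1)); nra.
by apply: (log2_ge (m := 1) (k := 1)); nra.
Qed.

(** The factor 2 carries the induction: from [t >= 2 * x] follows [t * (t + 1) / 2 >= 2 * x ^ 2]. It
    starts with [threshold 2 = 6]; [threshold 1 = 3] would be too small. *)
Lemma threshold_double_exp i : (2 * 2 ^ (2 ^ i) <= threshold i.+2)%N.
Proof.
elim: i => // i IH; have := thresholdS i.+2.
rewrite [(2 ^ i.+1)%N]expnSr (expnM 2 (2 ^ i) 2).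
by set x := (2 ^ (2 ^ i))%N in IH *; nia.
Qed.

(** The last threshold up to [n] gives [J - 3 <= x] for [x = log2 (log2 n)]. As [x >= 1 / 2], the 3
    is at most [6 * x], whence the factor 7, which also covers [J <= 3]. *)
Lemma levels_loglog n J : (3 <= n)%N -> (forall i, (i < J)%N -> (threshold i <= n)%N) ->
  J%:R <= 7 * log2 (log2 n%:R) :> R.
Proof.
move=> n3 tle; have := loglog_ge n3; set x := log2 _ => x_ge.
have [J3|J3] := leqP J 3.
  have : J%:R <= 3 :> R by rewrite ler_nat.
  lra.
have := tle (J - 3).+2 ltac:(lia).
move/(leq_trans (threshold_double_exp _)) => le.
have le1 : (2 ^ (2 ^ (J - 3)) <= n)%N by move: le; clear; lia.
have : (J - 3)%:R <= x.
  rewrite -log2X; apply: ler_log2; first by rewrite exprn_gt0.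
  rewrite -natrX -log2X; apply: ler_log2; first by rewrite exprn_gt0.
  by rewrite -natrX ler_nat.
rewrite natrB ?(ltnW J3) //; lra.
Qed.

End LogLog.

Lemma word_values_gt n : (2 < n)%N -> (16 * (n * n) < word_values 6 n)%N.
Proof.
move=> n3; rewrite /word_values [(6 * _)%N]mulnC expnM.
have := trunc_log_ltn n (ltnSn 1); set x := (2 ^ _)%N => ltx.
apply: (@leq_trans (n.+1 ^ 6)); last by rewrite leq_exp2r.
rewrite !expnS expn0; nia.
Qed.

Section Main.
Variables (R : realType) (n : nat) (T : wgraph R 'I_n).
Hypothesis n3 : (2 < n)%N.
Hypothesis T_tree : is_tree (adj T).

Let r : 'I_n := Ordinal (ltn_trans (ltn0Sn 1) n3).

(** The existence of the emulator is obtained by running the program, so some input has to be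
    exhibited. *)
Lemma exists_edge_list : exists L, edge_list T L.
Proof.
pose P := [pred e : 'I_n * 'I_n | adj T e.1 e.2 && (e.1 < e.2)%N].
exists [seq (e.1, e.2, wt T e.1 e.2) | e <- enum P]; split.
  by move=> u v w /mapP[[a b]]; rewrite mem_enum /= => /andP[/= ab _] [-> -> ->].
move=> u v euv; rewrite count_map /=.
have count_pair a b : adj T a b -> (a < b)%N ->
    count (fun e : 'I_n * 'I_n => (e == (a, b)) || (e == (b, a))) (enum P) = 1%N.
  move=> eab ltab; rewrite (eq_in_count (a2 := pred1 (a, b))).
    by rewrite count_uniq_mem ?enum_uniq // mem_enum inE /= eab ltab.
  move=> [c d]; rewrite mem_enum => /andP[_ /= ltcd]; rewrite /= !xpair_eqE.
  case: (eqVneq c b) ltcd => [->|_]; last by rewrite orbF.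
  by case: (eqVneq d a) => [->|]; rewrite ?orbF // ltnNge (ltnW ltab).
rewrite (eq_count (a2 := fun e : 'I_n * 'I_n => (e == (u, v)) || (e == (v, u)))); last first.
  by move=> [a b].
case: (ltngtP u v) => [lt|lt|/ord_inj e].
- exact: count_pair.
- rewrite (eq_count (a2 := fun e => (e == (v, u)) || (e == (u, v)))).
    by apply: count_pair; rewrite // adj_sym.
  by move=> e; rewrite orbC.
- by rewrite e adj_irr in euv.
Qed.

Lemma exists_input L : edge_list T L -> exists s : state R, stores s L.
Proof.
move=> _; pose d := (r, r, 0 : R).
exists (State (fun a i => if a == 0%N then (if i == 0%N then n else size L)
   else if a == 1%N then nat_of_ord (nth d L i).1.1 else nat_of_ord (nth d L i).1.2)
   (fun _ i => (nth d L i).2)).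
by split=> // k u v w e; rewrite /= -(odflt_onth d) e.
Qed.

Lemma last_threshold : exists J, [/\ (0 < J <= n)%N, (n < threshold J)%N
  & forall i, (i < J)%N -> (threshold i <= n)%N].
Proof.
have ex : exists J, (n < threshold J)%N by exists n; apply: ltnW; exact: threshold_gt.
case: (ex_minnP ex) => J ltJ Jmin; exists J; split=> //; last first.
  by move=> i lti; rewrite leqNgt; apply/negP => /Jmin; rewrite leqNgt lti.
rewrite Jmin ?andbT; last by apply: ltnW; exact: threshold_gt.
by case: (J) ltJ => //=; rewrite ltnNge ltnW.
Qed.

Lemma runs_program (L : seq ('I_n * 'I_n * R)) s W J : (16 * (n * n) < W)%N ->
  edge_list T L -> stores s L ->
  (J <= n)%N -> (n < threshold J)%N -> (forall i, (i < J)%N -> (threshold i <= n)%N) ->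
  runs W emulator_program s (program_time n (size L) J) (fun s' =>
    exists K L', [/\ hop_emulator (2 * (2 * J)) T K, (treewidth (adj K) <= 2 * J)%N,
      edge_list K L' & stores s' L']).
Proof.
move=> W_big eL st leJ ltJ tle; have r0 : r = 0%N :> nat by [].
rewrite /program_time.
apply: runs_seq; apply: runs_weaken (runs_init n3 W_big st) => // s1 [st1 z1].
apply: runs_seq; apply: runs_weaken (runs_sums r T_tree n3 W_big eL st1 z1) => // s2 [n2 sums2].
apply: runs_seq; apply: runs_weaken (runs_leaves (r := r) r0 n3 W_big n2 sums2) => //.
move=> s3 [nn3 [q3 [tq3 inv3]]].
apply: runs_seq; apply: runs_weaken (runs_peel T_tree r0 n3 W_big nn3 tq3 inv3) => //.
move=> s4 [n4 [q inv4]].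
apply: runs_seq; apply: runs_weaken (runs_pos r0 n3 W_big n4 inv4) => // s5 [oi5 pos5 inv5].
apply: runs_seq; apply: runs_weaken (runs_par r0 n3 W_big oi5 pos5 inv5) => // s6 [oi6 rooted].
have [n6 Qo6] := oi6.
apply: runs_seq; apply: runs_weaken (runs_thr n3 W_big n6) => //.
move=> s7 [Q7 P7 R7 n7 [J' [JE leJ' ltJ' tle' tE]]].
have eJ : J' = J.
  case: (ltngtP J' J) => // lt; first by have := tle _ lt; rewrite leqNgt ltJ'.
  by have := tle' _ lt; rewrite leqNgt ltJ.
rewrite eJ in JE leJ' tle' tE.
set o := rcons q r in oi6 rooted.
have oi7 : order_in r s7 o by split=> // i lti; rewrite Q7; exact: Qo6.
rewrite -P7 -R7 in rooted.
apply: runs_weaken (runs_levels n3 W_big oi7 (ro_forest rooted) JE leJ' tle tE) => //.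
move=> s8 [[n8 Qo8] rE [par [cnt [bel [top [sel [par0 steps [sE Ei]]]]]]]].
rewrite -par0 in rooted.
have last := last_level_par steps (ro_forest rooted) (erefl _) thresholdS ltJ.
pose E := all_edges n sel bel top J.
pose D := rcell s7 rD.
pose L' := [seq (nth r o ab.1, nth r o ab.2, emu_wt o D (nth r o ab.1) (nth r o ab.2)) | ab <- E].
exists (emulator rooted steps), L'; split.
- exact: emulator_hop.
- exact: emulator_treewidth.
- exact: emulator_edge_list.
split=> //; first by rewrite sE size_map.
move=> k u v w; rewrite onth_map.
case e: (onth E k) => [[a b]|//] /= [<- <- <-].
have [-> -> ->] := Ei _ _ _ e; split=> //.
have abE : (a, b) \in E by apply/onthP; exists k.
have [l [[_ lta ltb _ _] _]] := all_edgesP steps abE.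
have idx i : (i < n)%N -> index (nth r o i) o = i.
  by move=> lti; rewrite index_uniq ?(ro_size rooted) ?(ro_uniq rooted).
by rewrite /emu_wt !idx // /edge_weight rE.
Qed.

End Main.

Theorem theorem10 :
  exists (p : cmd) (c C : nat),
  forall (R : realType) (n : nat) (T : wgraph R 'I_n),
    (3 <= n)%N -> is_tree (adj T) ->
    (exists K : wgraph R 'I_n, loglog_emulator C T K) /\
    (forall (L : seq ('I_n * 'I_n * R)) (s : state R),
       edge_list T L -> stores s L ->
       exists (K : wgraph R 'I_n) (t : nat) (s' : state R)
              (L' : seq ('I_n * 'I_n * R)),
         [/\ loglog_emulator C T K,
             exec (word_values c n) p s t s',
             t%:R <= C%:R * (n%:R * log2 (log2 n%:R)) :> R,
             edge_list K L'
           & stores s' L']).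
Proof.
have [A time_le] := program_time_near_linear.
(* With [x = log2 (log2 n)] and [J <= 7 * x], the at most [4 * J] hops give 28, and the time
   [A * (n * J)] gives [7 * A]. The 6 is the word length for which [word_values_gt] excludes
   overflow. *)
exists emulator_program, 6, (28 + 7 * A)%N => R n T n3 T_tree.
have [J [/andP[J0 leJ] ltJ tle]] := last_threshold n3.
have Jx := levels_loglog R n3 tle; have x_ge := loglog_ge R n3.
set x := log2 (log2 n%:R) in Jx x_ge *.
have A0 : 0 <= A%:R :> R by rewrite ler0n.
have small k : (k <= 4 * J)%N -> k%:R <= (28 + 7 * A)%:R * x.
  rewrite -(ler_nat R) natrM natrD natrM => le; nra.
have main (L : seq ('I_n * 'I_n * R)) (s : state R) : edge_list T L -> stores s L ->
    exists (K : wgraph R 'I_n) (t : nat) (s' : state R) (L' : seq ('I_n * 'I_n * R)),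
      [/\ loglog_emulator (28 + 7 * A) T K, exec (word_values 6 n) emulator_program s t s',
        t%:R <= (28 + 7 * A)%:R * (n%:R * x), edge_list K L' & stores s' L'].
  move=> eL st.
  have [t [s' [ex let_ [K [L' [hopK twK eL' st']]]]]] :=
    runs_program n3 T_tree (word_values_gt n3) eL st leJ ltJ tle.
  exists K, t, s', L'; split=> //.
    exists (2 * (2 * J))%N; split=> //; apply: small; first by rewrite mulnA.
    by apply: leq_trans twK _; rewrite leq_mul2r orbT.
  have n0 : (0 < n)%N by exact: ltn_trans n3.
  have szL : (size L <= n)%N.
    by apply: leq_trans (edge_list_size (Ordinal n0) T_tree eL) (leq_pred n).
  have : t%:R <= A%:R * (n%:R * J%:R) :> R.
    rewrite -!natrM ler_nat; apply: leq_trans let_ _; exact: time_le.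
  have nn : 0 <= n%:R :> R by rewrite ler0n.
  have : n%:R * J%:R <= n%:R * (7 * x) by rewrite ler_wpM2l.
  move=> h1 h2; apply: le_trans h2 _.
  apply: le_trans (ler_wpM2l A0 h1) _.
  have : 0 <= n%:R * x by apply: mulr_ge0 => //; lra.
  by rewrite natrD natrM => h3; nra.
split=> //.
have [L eL] := exists_edge_list T; have [s st] := exists_input n3 eL.
by have [K [t [s' [L' [lK _ _ _ _]]]]] := main L s eL st; exists K.
Qed.
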